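(* Let $n\ge2$, let $\Omega=\mathbb{R}^n\setminus\overline{G}$, where $G$ is a convex subdomain of $\mathbb{R}^n$, and let $\boldsymbol{u}$ be an $n$-component vector-valued function with bounded harmonic components in $\Omega$. Then for any point $x\in\Omega$ the inequality $$|\mathrm{div}\,\boldsymbol{u}(x)|\le\frac{D_n}{d_x}\,\sup_\Omega|\boldsymbol{u}|$$ holds, where $$D_n=\frac{2\,\omega_{n-1}}{\omega_n}\int_0^{\pi/2}\bigl[1+n(n-2)\cos^2\vartheta\bigr]^{1/2}\sin^{n-2}\vartheta\,d\vartheta .$$
   Context: $|\cdot|$ is the Euclidean length of a vector or the absolute value of a scalar. $d_x$ is the distance from $x\in\Omega$ to $\partial\Omega$. $\omega_n$ is the area of the $(n-1)$-dimensional unit sphere in $\mathbb{R}^n$ (so $\omega_1=2$, $\omega_2=2\pi$). Functions are real-valued. *)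

(* Defs.v *)
From HB Require Import structures.
From mathcomp Require Import all_boot all_order all_algebra.
From mathcomp Require Import all_classical all_reals all_analysis.

Set Implicit Arguments.
Unset Strict Implicit.
Unset Printing Implicit Defensive.

Import Order.TTheory GRing.Theory Num.Theory.
Import numFieldNormedType.Exports.

Local Open Scope classical_set_scope.
Local Open Scope ring_scope.

(* The library norm `|v| on 'rV[R]_n is the sup norm; it induces the same
   topology as enorm, so open, closure, continuity are the usual notions. *)
Definition enorm (R : realType) (n : nat) (v : 'rV[R]_n) : R :=
  Num.sqrt (\sum_(i < n) v ord0 i ^+ 2).

Definition boundary (T : topologicalType) (A : set T) : set T :=
  closure A `\` interior A.

Definition dist_boundary (R : realType) (n : nat) (A : set 'rV[R]_n)
    (x : 'rV[R]_n) : R :=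
  inf [set enorm (x - y) | y in boundary A].

Definition domain (T : topologicalType) (G : set T) : Prop :=
  [/\ open G, G !=set0 & connected G].

Definition partial (R : realType) (n : nat) (i : 'I_n) (f : 'rV[R]_n -> R) :
    'rV[R]_n -> R :=
  'D_(delta_mx ord0 i) f.

Definition grad (R : realType) (n : nat) (f : 'rV[R]_n -> R) (x : 'rV[R]_n) :
    'rV[R]_n :=
  \row_i partial i f x.

Definition laplacian (R : realType) (n : nat) (f : 'rV[R]_n -> R)
    (x : 'rV[R]_n) : R :=
  \sum_(i < n) partial i (partial i f) x.

Definition divergence (R : realType) (n : nat) (u : 'rV[R]_n -> 'rV[R]_n)
    (x : 'rV[R]_n) : R :=
  \sum_(i < n) partial i (fun y => u y ord0 i) x.

(* 'D_v is a total operator, hence the explicit derivability conditions. *)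
Definition C1_on (R : realType) (n : nat) (A : set 'rV[R]_n)
    (f : 'rV[R]_n -> R) : Prop :=
  forall x, A x -> {for x, continuous f} /\
    forall i : 'I_n, derivable f x (delta_mx ord0 i) /\
                     {for x, continuous (partial i f)}.

Definition C2_on (R : realType) (n : nat) (A : set 'rV[R]_n)
    (f : 'rV[R]_n -> R) : Prop :=
  C1_on A f /\ forall i : 'I_n, C1_on A (partial i f).

Definition harmonic_on (R : realType) (n : nat) (A : set 'rV[R]_n)
    (f : 'rV[R]_n -> R) : Prop :=
  C2_on A f /\ forall x, A x -> laplacian f x = 0.

(* Lebesgue integral over R^k, as an iterated integral; by Tonelli this is the
   k-dimensional integral for the nonnegative measurable f it is used with. *)
Fixpoint integral_rV (R : realType) (k : nat) :
    ('rV[R]_k -> \bar R) -> \bar R :=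
  match k return ('rV[R]_k -> \bar R) -> \bar R with
  | 0%N => fun f => f 0
  | k'.+1 => fun f =>
      (\int[lebesgue_measure]_t
         integral_rV (fun v : 'rV[R]_k' => f (row_mx (t%:M : 'M[R]_1) v)))%E
  end.

(* k-dimensional area of the graph of g over A, a hypersurface in R^(k+1). *)
Definition graph_area (R : realType) (k : nat) (A : set 'rV[R]_k)
    (g : 'rV[R]_k -> R) : \bar R :=
  integral_rV
    ((fun y => (Num.sqrt (1 + enorm (grad g y) ^+ 2))%:E) \_ A).

(* Area of the unit sphere S^(n-1) of R^n, n >= 1: twice the area of the open
   upper hemisphere, the graph of sqrt(1 - |y|^2) over the unit ball of
   R^(n-1). In particular sphere_area R 1 = 2 (two points). *)
Definition sphere_area (R : realType) (n : nat) : R :=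
  2 * fine (graph_area [set y : 'rV[R]_n.-1 | enorm y < 1]
                       (fun y => Num.sqrt (1 - enorm y ^+ 2))).

Definition div_const (R : realType) (n : nat) : R :=
  2 * sphere_area R n.-1 / sphere_area R n *
  \int[lebesgue_measure]_(t in `[0%R, pi / 2])
    (Num.sqrt (1 + n%:R * (n%:R - 2) * cos t ^+ 2) * sin t ^+ (n - 2)).

(* Main.v *)
Require Import Defs.
From HB Require Import structures.
From mathcomp Require Import all_boot all_order all_algebra.
From mathcomp Require Import all_classical all_reals all_analysis.
From mathcomp Require Import measurable_realfun ring lra.

Set Implicit Arguments.
Unset Strict Implicit.
Unset Printing Implicit Defensive.

Import Order.TTheory GRing.Theory Num.Theory.
Import numFieldNormedType.Exports.

Local Open Scope classical_set_scope.
Local Open Scope ring_scope.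

(** The estimate is one on a half-space. If [xi] is the point of the
    closure of [G] nearest to [x], the hyperplane through [xi] orthogonal
    to [x - xi] has [G] on one side, so the open half-space on the other
    side lies in [Omega] ([supporting_half_space]), and [x] has height [h =
    dist_boundary Omega x] above that hyperplane
    ([dist_boundary_complement]).

    On a half-space with inner unit normal [nu] the Poisson formula writes
    [u(x)] as the integral of [u(q) K(x - q)] over the points [q] of the
    hyperplane, divided by the integral of [K(x - q)], where [K(w) = (w .
    nu) / |w|^n]. Differentiating, [|div u(x)|] is at most [sup |u|] times
    the quotient of the integrals of [|grad K|] and [K]. Now [|grad K(w)| =
    |w|^-n (1 + n (n - 2) cos^2 t)^(1/2)], with [t] the angle between [w]
    and [nu] ([kernel_grad_norm]), and in polar coordinates about the foot
    of [x] the radius is [h tan t]; so the quotient is [1 / h] times a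
    quotient of two integrals over [t] from [0] to [pi / 2]
    ([radial_primitive]). The denominator is the integral of [sin^(n - 2)],
    which is also the inverse of twice the ratio of the areas of the unit
    spheres of R^(n - 1) and R^n ([div_constE]), and the quotient is
    [div_const] ([div_const_total_mass]).

    Integrals over the hyperplane are replaced by finite sums over a fine
    grid, which are exactly harmonic and can be differentiated term by
    term. Three facts make this work. Sums of a radial density over a grid
    are close to its integral ([quad_sum_le], [quad_sum_ge]), because the
    number of grid points in a ball is close to the volume of the ball over
    that of a cell ([grid_count_le], [grid_count_ge]). The sums
    [poisson_sum] are close to [u] near the hyperplane, because their
    weights are an approximate identity ([poisson_near_boundary]). They
    stay close to [u] at a fixed height by the maximum principle, a
    superharmonic barrier taking care of infinity ([half_space_comparison],
    [poisson_approximation]). The divergence is then reached through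
    difference quotients of the sums ([divergence_difference_quotient],
    [half_space_estimate]). *)

(** * The Euclidean inner product and norm *)

Section euclid.
Context {R : realType}.

Definition sqnorm (k : nat) (v : 'rV[R]_k) : R := \sum_(i < k) v ord0 i ^+ 2.

Lemma sqnorm_ge0 k (v : 'rV[R]_k) : 0 <= sqnorm v.
Proof. by apply: sumr_ge0 => i _; exact: sqr_ge0. Qed.

Lemma enorm_sqr k (v : 'rV[R]_k) : enorm v ^+ 2 = sqnorm v.
Proof. by rewrite sqr_sqrtr// sqnorm_ge0. Qed.

Lemma enorm_ge0 k (v : 'rV[R]_k) : 0 <= enorm v.
Proof. exact: sqrtr_ge0. Qed.

Definition dot (k : nat) (u v : 'rV[R]_k) : R := \sum_(i < k) u ord0 i * v ord0 i.

Lemma dotC k (u v : 'rV[R]_k) : dot u v = dot v u.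
Proof. by apply: eq_bigr => i _; rewrite mulrC. Qed.

Lemma dotDl k (u v w : 'rV[R]_k) : dot (u + v) w = dot u w + dot v w.
Proof. by rewrite -big_split; apply: eq_bigr => i _; rewrite mxE mulrDl. Qed.

Lemma dotZl k a (u v : 'rV[R]_k) : dot (a *: u) v = a * dot u v.
Proof. by rewrite mulr_sumr; apply: eq_bigr => i _; rewrite mxE mulrA. Qed.

Lemma dotNl k (u v : 'rV[R]_k) : dot (- u) v = - dot u v.
Proof. by rewrite -scaleN1r dotZl mulN1r. Qed.

Lemma dotDr k (u v w : 'rV[R]_k) : dot w (u + v) = dot w u + dot w v.
Proof. by rewrite !(dotC w) dotDl. Qed.

Lemma dotZr k a (u v : 'rV[R]_k) : dot u (a *: v) = a * dot u v.
Proof. by rewrite !(dotC u) dotZl. Qed.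

Lemma dotNr k (u v : 'rV[R]_k) : dot u (- v) = - dot u v.
Proof. by rewrite !(dotC u) dotNl. Qed.

Lemma dotE k (u v : 'rV[R]_k) : dot u v = (u *m v^T) ord0 ord0.
Proof. by rewrite mxE; apply: eq_bigr => i _; rewrite mxE. Qed.

Lemma sqnormE k (u : 'rV[R]_k) : sqnorm u = dot u u.
Proof. by apply: eq_bigr => i _; rewrite expr2. Qed.

Lemma sqnormD k (u v : 'rV[R]_k) :
  sqnorm (u + v) = sqnorm u + 2 * dot u v + sqnorm v.
Proof. by rewrite !sqnormE dotDl !dotDr (dotC v u); ring. Qed.

Lemma sqnormZ k a (u : 'rV[R]_k) : sqnorm (a *: u) = a ^+ 2 * sqnorm u.
Proof. by rewrite !sqnormE dotZl dotZr; ring. Qed.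

Lemma sqnormN k (u : 'rV[R]_k) : sqnorm (- u) = sqnorm u.
Proof. by rewrite !sqnormE dotNl dotNr opprK. Qed.

Lemma sqnorm_eq0 k (u : 'rV[R]_k) : sqnorm u = 0 -> u = 0.
Proof.
move=> /eqP; rewrite psumr_eq0 => [/allP u0|i _]; last exact: sqr_ge0.
apply/rowP => i; rewrite mxE; apply/eqP; rewrite -sqrf_eq0.
by apply: u0; rewrite mem_index_enum.
Qed.

Lemma sqr_coord_le k (u : 'rV[R]_k) i : u ord0 i ^+ 2 <= sqnorm u.
Proof. by rewrite /sqnorm (bigD1 i)//= lerDl sumr_ge0// => j _; exact: sqr_ge0. Qed.

Lemma coord_le k (u : 'rV[R]_k) i : `|u ord0 i| <= enorm u.
Proof. by rewrite -(sqrtr_sqr (u ord0 i)) ler_wsqrtr// sqr_coord_le. Qed.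

Lemma cauchy_schwarz k (u v : 'rV[R]_k) : dot u v ^+ 2 <= sqnorm u * sqnorm v.
Proof.
have [v0|v0] := eqVneq (sqnorm v) 0.
  by rewrite (sqnorm_eq0 v0) -(scale0r v) dotZr mul0r expr0n/= mulr_ge0// sqnorm_ge0.
have vp : 0 < sqnorm v by rewrite lt_def v0 sqnorm_ge0.
have := sqnorm_ge0 (sqnorm v *: u + (- dot u v) *: v).
rewrite sqnormD !sqnormZ dotZl dotZr.
rewrite (_ : _ + _ = sqnorm v * (sqnorm u * sqnorm v - dot u v ^+ 2)); last ring.
by rewrite pmulr_rge0// subr_ge0.
Qed.

Lemma dot_le k (u v : 'rV[R]_k) : `|dot u v| <= enorm u * enorm v.
Proof.
rewrite -(@ler_pXn2r _ 2)// ?nnegrE ?mulr_ge0 ?enorm_ge0//.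
by rewrite real_normK ?num_real// exprMn !enorm_sqr cauchy_schwarz.
Qed.

Lemma enorm_triangle k (u v : 'rV[R]_k) : enorm (u + v) <= enorm u + enorm v.
Proof.
rewrite -(@ler_pXn2r _ 2)// ?nnegrE ?addr_ge0 ?enorm_ge0//.
rewrite sqrrD !enorm_sqr sqnormD lerD2r lerD2l mulr2n mulrDl !mul1r.
by have := le_trans (ler_norm _) (dot_le u v); lra.
Qed.

Lemma enormN k (u : 'rV[R]_k) : enorm (- u) = enorm u.
Proof. by rewrite /enorm -!/(sqnorm _) sqnormN. Qed.

Lemma enormB_sym k (u v : 'rV[R]_k) : enorm (u - v) = enorm (v - u).
Proof. by rewrite -enormN opprB. Qed.

Lemma enorm_lt k (u : 'rV[R]_k) r : 0 <= r -> (enorm u < r) = (sqnorm u < r ^+ 2).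
Proof. by move=> r0; rewrite -enorm_sqr ltr_pXn2r// nnegrE enorm_ge0. Qed.

Lemma enorm_le k (u : 'rV[R]_k) r : 0 <= r -> (enorm u <= r) = (sqnorm u <= r ^+ 2).
Proof. by move=> r0; rewrite -enorm_sqr ler_pXn2r// nnegrE enorm_ge0. Qed.

Lemma enormZ k a (u : 'rV[R]_k) : enorm (a *: u) = `|a| * enorm u.
Proof. by rewrite /enorm -!/(sqnorm _) sqnormZ sqrtrM ?sqr_ge0// sqrtr_sqr. Qed.

End euclid.

(** * Derivatives of real functions *)

Section derivative_rules.
Context {R : realType}.
Implicit Types (f g : R -> R) (x a b : R).

(** The rules are stated for explicit functions [fun y => _], so that the
    derivative of a composite expression can be assembled as one term and
    converted once by [is_derive_eq]. *)
Lemma der_id x : is_derive x 1 (fun y : R => y) 1.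
Proof. exact: is_derive_id. Qed.

Lemma der_cst c x : is_derive x 1 (fun=> c : R) 0.
Proof. exact: is_derive_cst. Qed.

Lemma derD f g x a b : is_derive x 1 f a -> is_derive x 1 g b ->
  is_derive x 1 (fun y => f y + g y) (a + b).
Proof. by move=> df dg; exact: is_deriveD. Qed.

Lemma derB f g x a b : is_derive x 1 f a -> is_derive x 1 g b ->
  is_derive x 1 (fun y => f y - g y) (a - b).
Proof. by move=> df dg; exact: is_deriveB. Qed.

Lemma derN f x a : is_derive x 1 f a -> is_derive x 1 (fun y => - f y) (- a).
Proof. by move=> df; exact: is_deriveN. Qed.

Lemma derM f g x a b : is_derive x 1 f a -> is_derive x 1 g b ->
  is_derive x 1 (fun y => f y * g y) (a * g x + f x * b).
Proof.
move=> df dg; apply: (is_derive_eq (is_deriveM df dg)).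
by rewrite addrC /GRing.scale/= mulrC.
Qed.

Lemma derX f x a n : is_derive x 1 f a ->
  is_derive x 1 (fun y => f y ^+ n) (n%:R * a * f x ^+ n.-1).
Proof.
move=> df; have -> : (fun y => f y ^+ n) = f ^+ n by apply/funext => y; rewrite exprfctE.
by apply: (is_derive_eq (is_deriveX n df)); rewrite /GRing.scale/= mulr_natl; ring.
Qed.

Lemma derV f x a : f x != 0 -> is_derive x 1 f a ->
  is_derive x 1 (fun y => (f y)^-1) (- a / f x ^+ 2).
Proof.
move=> fx0 df; apply: (is_derive_eq (is_deriveV fx0 df)).
by rewrite /GRing.scale/= mulNr mulrC mulNr.
Qed.

Lemma der_comp (h : R -> R) f x a b : is_derive x 1 f a ->
  is_derive (f x) 1 h b -> is_derive x 1 (fun y => h (f y)) (b * a).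
Proof. by move=> df dh; exact: (@is_derive1_comp _ h f). Qed.

Lemma is_derive_cts f x a : is_derive x 1 f a -> {for x, continuous f}.
Proof. by case=> df _; apply: differentiable_continuous; exact/derivable1_diffP. Qed.

Lemma mean_value f (df : R -> R) a b : a < b ->
  (forall x, a <= x <= b -> is_derive x 1 f (df x)) ->
  exists2 c, a < c < b & f b - f a = df c * (b - a).
Proof.
move=> ab dfE; have [||c + e] := @MVT R f df a b ab.
- by move=> x; rewrite in_itv/= => /andP[ax xb]; apply: dfE; rewrite !ltW.
- apply: continuous_in_subspaceT => x; rewrite inE/= in_itv/= => axb.
  exact: is_derive_cts (dfE x axb).
by rewrite in_itv/=; exists c.
Qed.

Lemma continuous_lt_ball f x b : {for x, continuous f} -> f x < b ->
  exists2 th : R, 0 < th & forall y : R, `|y - x| < th -> f y < b.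
Proof.
move=> cf fb; have /nbhs_ballP[th /= th0 hth] : \forall y \near x, f y < b.
  exact: (cvgr_lt _ cf).
by exists th => // y yx; apply: hth; rewrite /ball/= distrC.
Qed.

End derivative_rules.

(** * Antiderivatives and the integrals of powers of the sine *)

Section antiderivatives.
Context {R : realType}.
Implicit Types (f F : R -> R) (a b : R).
Local Notation mu := (@lebesgue_measure R).

Lemma continuous_integrable f a b : continuous f ->
  mu.-integrable `[a, b] (EFin \o f).
Proof.
move=> cf; apply: continuous_compact_integrable; first exact: segment_compact.
exact: continuous_subspaceT.
Qed.

Lemma antiderivative f (A B : R) : continuous f ->
  exists P : R -> R, forall x : R, A < x < B -> is_derive x 1 P (f x).
Proof.
move=> cf; exists (fun x => \int[mu]_(t in `[A, x]) f t)%R => x /andP[Ax xB].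
have [] := @continuous_FTC1_closed _ f A x B xB (continuous_integrable _ _ cf) Ax (cf x).
by move=> dP eP; apply: DeriveDef; [exact: dP|rewrite -derive1E; exact: eP].
Qed.

Lemma ftc f F a b : a <= b ->
  (forall x, a <= x <= b -> {for x, continuous f}) ->
  (forall x, a <= x <= b -> is_derive x 1 F (f x)) ->
  (\int[mu]_(x in `[a, b]) (f x)%:E = (F b - F a)%:E)%E.
Proof.
rewrite le_eqVlt => /orP[/eqP <-|ab] cf dF.
  by rewrite subrr set_itv1 integral_set1.
have cF x : a <= x <= b -> {for x, continuous F}.
  by move=> xab; exact: is_derive_cts (dF x xab).
rewrite EFinB; apply: continuous_FTC2 => //.
- apply: continuous_in_subspaceT => x; rewrite inE/= in_itv/=.
  exact: cf.
- split.
  + by move=> x; rewrite in_itv/= => /andP[ax xb]; have [] := dF x; rewrite ?ltW.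
  + by apply: cvg_at_right_filter; apply: cF; rewrite lexx ltW.
  + by apply: cvg_at_left_filter; apply: cF; rewrite lexx ltW.
- move=> x; rewrite in_itv/= => /andP[ax xb].
  by rewrite derive1E; have [|_ ->] := dF x; rewrite ?ltW.
Qed.

Lemma Rftc f F a b : a <= b ->
  (forall x, a <= x <= b -> {for x, continuous f}) ->
  (forall x, a <= x <= b -> is_derive x 1 F (f x)) ->
  \int[mu]_(x in `[a, b]) f x = F b - F a.
Proof. by move=> ab cf dF; rewrite /Rintegral (ftc ab cf dF). Qed.

End antiderivatives.
Section wallis.
Context {R : realType}.
Local Notation mu := (@lebesgue_measure R).

Definition wallis (j : nat) : R := \int[mu]_(t in `[0, pi / 2]) sin t ^+ j.

Lemma continuous_sinX (j : nat) : continuous (fun t : R => sin t ^+ j).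
Proof.
by move=> x; apply: (@continuous_comp _ _ _ (@sin R) (fun y => y ^+ j));
  [exact: continuous_sin | exact: exprn_continuous].
Qed.

(** The integral from [0] to [pi] is twice the one from [0] to [pi / 2]
    because the sine is symmetric about [pi / 2]: the derivative of [P (pi
    - x) + P x] vanishes. The interval from [-1] to [5] is an open one
    around [0] and [pi], where [P] can be differentiated. *)
Lemma sinX_primitive (j : nat) : exists P : R -> R,
  (forall x : R, -1 < x < 5 -> is_derive x 1 P (sin x ^+ j)) /\
  P pi - P 0 = 2 * wallis j /\ 0 < wallis j.
Proof.
have [P dP] := @antiderivative R _ (-1) 5 (@continuous_sinX j).
have pi4 : pi < 4 :> R by have := @pihalf_lt2 R; lra.
have pi0 := @pi_gt0 R.
exists P; split => //.
have sympi x : 0 <= x <= pi / 2 -> P (pi - x) + P x = P pi + P 0.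
  rewrite le_eqVlt => /andP[/orP[/eqP<-|x0 xpi]]; first by rewrite subr0.
  have [y yx|c _] := @mean_value R (fun x => P (pi - x) + P x) (fun=> 0) 0 x x0.
    have -> : 0 = sin (pi - y) ^+ j * (0 - 1) + sin y ^+ j.
      by rewrite sinB sinpi cospi mul0r sub0r mulN1r opprK sub0r mulrN1 addNr.
    apply: derD; last by apply: dP; lra.
    by apply: (der_comp (derB (der_cst pi y) (der_id y))); apply: dP; lra.
  by rewrite mul0r subr0 => /eqP; rewrite subr_eq0 => /eqP.
have W : wallis j = P (pi / 2) - P 0.
  apply: Rftc; first lra.
    by move=> x _; exact: continuous_sinX.
  by move=> x x0; apply: dP; lra.
split.
  have := sympi (pi / 2); rewrite W.
  have -> : pi - pi / 2 = pi / 2 :> R by lra.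
  by move=> e; have {e} := e (ltac:(lra)); lra.
rewrite W.
have [||c cI ->] := @mean_value R P (fun x => sin x ^+ j) 0 (pi/2); first lra.
- by move=> y ?; apply: dP; lra.
- apply: mulr_gt0; last lra.
  by apply: exprn_gt0; exact: sin_gt0_pihalf.
Qed.

Lemma wallis_gt0 j : 0 < wallis j.
Proof. by have [P [_ []]] := sinX_primitive j. Qed.
End wallis.

(** * Integrating out one coordinate of a ball or of a sphere *)

Section ball_integrals.
Context {R : realType}.
Local Notation mu := (@lebesgue_measure R).

(** This is [(c - s) ^ ((j - 1) / 2)] for [s < c]. With [s] the squared
    norm of a point, [j = 1] gives the indicator of the ball of radius
    [sqrt c], and [j = 0], [c = 1] gives the area density of the unit
    hemisphere over the unit ball; one family thus yields both volumes of
    balls and areas of spheres. *)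
Definition profile (j : nat) (c s : R) : R :=
  if s < c then Num.sqrt (c - s) ^+ j / Num.sqrt (c - s) else 0.

Lemma profile_ge0 j c s : 0 <= profile j c s.
Proof.
by rewrite /profile; case: ifP => // _; rewrite mulr_ge0 ?invr_ge0 ?exprn_ge0 ?sqrtr_ge0.
Qed.

Lemma profile_continuous j (c t : R) : t ^+ 2 < c ->
  {for t, continuous (fun t : R => Num.sqrt (c - t ^+ 2) ^+ j / Num.sqrt (c - t ^+ 2))}.
Proof.
rewrite -subr_gt0 => p.
have d1 := derB (der_cst c t) (derX 2 (der_id t)).
have d2 := der_comp d1 (is_derive1_sqrt p).
have d3 : Num.sqrt (c - t ^+ 2) != 0 by rewrite gt_eqF// sqrtr_gt0.
have d4 := derM (derX j d2) (@derV _ (fun s => Num.sqrt (c - s ^+ 2)) t _ d3 d2).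
exact: is_derive_cts d4.
Qed.

(** The substitution [t = sqrt c * cos a] turns the profile into [sin a ^
    j]. The angle [th] keeps [t] away from the endpoints, where the profile
    is unbounded for [j = 0]. *)
Lemma integral_profile_cap (j : nat) (c : R) (P : R -> R) (th : R) : 0 < c ->
  (forall x : R, -1 < x < 5 -> is_derive x 1 P (sin x ^+ j)) ->
  0 < th < 1 -> let rho : R := Num.sqrt c * cos th in
  (\int[mu]_(t in `[(- rho)%R, rho]) (profile j c (t ^+ 2))%:E =
   (Num.sqrt c ^+ j * (P (pi - th) - P th))%:E)%E.
Proof.
move=> c0 dP th01 rho.
set r := Num.sqrt c; have r0 : 0 < r by rewrite sqrtr_gt0.
have rE : c = r ^+ 2 by rewrite sqr_sqrtr// ltW.
have pi1 := @pihalf_ge1 R.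
have pi2 := @pihalf_lt2 R.
have th_itv : th \in `[0, pi] by rewrite in_itv/=; lra.
have cth1 : cos th < 1.
  by rewrite -[X in _ < X]cos0 ltr_cos ?in_itv/= ?lexx ?pi_ge0//; lra.
have cth0 : 0 < cos th by apply: cos_gt0_pihalf; lra.
have rhor : rho < r by rewrite /rho -/r; nra.
have rho0 : 0 < rho by rewrite mulr_gt0.
pose h (t : R) := Num.sqrt (c - t ^+ 2) ^+ j / Num.sqrt (c - t ^+ 2).
have tc t : - rho <= t <= rho -> t ^+ 2 < c by rewrite rE; nra.
have dh t (tI : - rho <= t <= rho) := @profile_continuous j c t (tc t tI).
rewrite (_ : (\int[mu]_(t in _) _)%E = (\int[mu]_(t in `[(- rho)%R, rho]) (h t)%:E)%E); last first.
  by apply: eq_integral => t; rewrite inE/= in_itv/= => /tc tI; rewrite /profile tI.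
pose H (t : R) := - (r ^+ j) * P (acos (t / r)).
have -> : r ^+ j * (P (pi - th) - P th) = H rho - H (- rho).
  rewrite /H; have -> : rho / r = cos th by rewrite /rho -/r; field; rewrite gt_eqF.
  have -> : - rho / r = - cos th by rewrite /rho -/r; field; rewrite gt_eqF.
  rewrite acosN; last lra.
  by rewrite cosK//; ring.
apply: ftc => [|//|t tI]; first lra.
have tr : -1 < t / r < 1.
  by rewrite ltr_pdivrMr// ltr_pdivlMr//; lra.
have d1 : is_derive t 1 (fun t : R => t / r) (1 * r^-1 + t * 0) by apply: (derM (der_id t) (der_cst _ _)).
have d2 := der_comp d1 (is_derive1_acos tr).
have a0 : 0 < acos (t / r) by apply: acos_gt0; lra.
have a1 : acos (t / r) < pi by apply: acos_ltpi; lra.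
have d3 := der_comp d2 (dP (acos (t / r)) (ltac:(lra))).
have d4 := derM (der_cst (- (r ^+ j)) t) d3.
apply: (is_derive_eq d4); rewrite /h sin_acos; last lra.
have -> : Num.sqrt (c - t ^+ 2) = r * Num.sqrt (1 - (t / r) ^+ 2).
  rewrite -[X in X * _](@ger0_norm _ r) ?ltW// -sqrtr_sqr -sqrtrM ?sqr_ge0//; congr Num.sqrt.
  by rewrite rE; field; rewrite gt_eqF.
have s0 : 0 < Num.sqrt (1 - (t / r) ^+ 2) by rewrite sqrtr_gt0; nra.
move: s0; set s := Num.sqrt (1 - _) => s0; rewrite exprMn; field.
by rewrite !gt_eqF.
Qed.

Lemma profile_measurable j (c : R) :
  measurable_fun [set: R] (fun t : R => (profile j c (t ^+ 2))%:E).
Proof.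
apply/measurable_EFinP.
have -> : (fun t : R => profile j c (t ^+ 2)) =
    (fun t : R => Num.sqrt (c - t ^+ 2) ^+ j / Num.sqrt (c - t ^+ 2))
      \_ [set t : R | t ^+ 2 < c].
  apply/funext => t; rewrite patchE /profile; case: ifPn => tc.
    by rewrite ifT// inE.
  by rewrite ifN// notin_setE/=; exact/negP.
have oc : open [set t : R | t ^+ 2 < c].
  apply: (@open_comp _ _ (fun t : R => t ^+ 2) [set s | s < c]) => [t _|].
    exact: exprn_continuous.
  exact: open_lt.
have mc : measurable [set t : R | t ^+ 2 < c] by exact: open_measurable.
apply/(measurable_restrictT _ mc); apply: open_continuous_measurable_fun => //.
by move=> t; rewrite inE; exact: profile_continuous.
Qed.

(** Integrating out one coordinate raises the index of the profile by one.
    The segments of [integral_profile_cap] exhaust the support as [th]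
    tends to [0], and monotone convergence applies. *)
Lemma integral_profile (j : nat) (c : R) :
  (\int[mu]_t (profile j c (t ^+ 2))%:E = (2 * wallis j * profile j.+1 c 0)%:E)%E.
Proof.
have [c0|c0] := leP c 0.
  rewrite /profile ltNge c0/= mulr0; apply: integral0_eq => t _.
  by rewrite ltNge (le_trans c0) ?sqr_ge0.
have [P [dP [WP _]]] := @sinX_primitive R j.
set r := Num.sqrt c; have r0 : 0 < r by rewrite sqrtr_gt0.
have rE : c = r ^+ 2 by rewrite sqr_sqrtr// ltW.
rewrite [in RHS]/profile c0 subr0 -/r -WP.
have -> : r ^+ j.+1 / r = r ^+ j by rewrite exprS mulrAC divff ?gt_eqF// mul1r.
pose th (i : nat) : R := i.+2%:R^-1.
have th0 i : 0 < th i < 1 by rewrite invr_gt0 ltr0n/= invf_lt1 ?ltr1n// ltr0n.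
pose rho i : R := r * cos (th i).
pose F i := `[(- rho i)%R, rho i]%classic.
have pi1 := @pihalf_ge1 R.
have thpi i : th i \in `[0, pi] by have := th0 i; rewrite in_itv/=; lra.
have rho_lt i : rho i < r.
  have : cos (th i) < 1.
    by rewrite -[X in _ < X]cos0 ltr_cos ?in_itv/= ?lexx ?pi_ge0//; have := th0 i; lra.
  by rewrite /rho; nra.
have bigF : \bigcup_i F i = `]- r, r[%classic.
  apply/seteqP; split => t /=.
    by move=> [i _]; rewrite /F/= in_itv/= in_itv/= => /andP[h1 h2]; have := rho_lt i; lra.
  rewrite in_itv/= -ltr_norml => tr.
  pose x : R := `|t| / r.
  have x1 : 0 <= x < 1 by rewrite /x divr_ge0 ?normr_ge0 ?(ltW r0)//= ltr_pdivrMr// mul1r.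
  have a0 : 0 < acos x by apply: acos_gt0; lra.
  have [i hi] : exists i, th i < acos x.
    have /archi_boundP hi : 0 <= (acos x)^-1.
    by rewrite invr_ge0 ltW.
    exists (Num.bound (acos x)^-1); rewrite /th invf_plt ?posrE ?ltr0n//.
    by apply: lt_le_trans hi _; rewrite ler_nat ltnW.
  exists i => //; rewrite /F/= in_itv/= -ler_norml.
  have : x <= cos (th i).
    rewrite -[X in X <= _](@acosK _ x) ?in_itv/=; last lra.
    rewrite ltW// ltr_cos// in_itv/= ltW//= acos_lepi//; lra.
  by rewrite /x ler_pdivrMr// mulrC.
rewrite [LHS](_ : _ = \int[mu]_(t in \bigcup_i F i) (profile j c (t ^+ 2))%:E)%E; last first.
  rewrite bigF [RHS]integral_mkcond; apply: eq_integral => t _.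
  rewrite patchE; case: ifPn => //; rewrite notin_setE/= in_itv/= => /negP.
  rewrite -ltr_norml -leNgt => rt; rewrite /profile ifF// rE.
  by apply/negbTE; rewrite -leNgt -[t ^+ 2]real_normK ?num_real// lerXn2r// ?nnegrE ltW.
have intF i : (\int[mu]_(t in F i) (profile j c (t ^+ 2))%:E =
   (r ^+ j * (P (pi - th i) - P (th i)))%:E)%E.
  exact: (integral_profile_cap c0 dP (th0 i)).
have cvg1 : (\int[mu]_(t in F i) (profile j c (t ^+ 2))%:E @[i --> \oo] -->
     \int[mu]_(t in \bigcup_i F i) (profile j c (t ^+ 2))%:E)%E.
  apply: ge0_nondecreasing_set_cvg_integral => //.
  - apply/nondecreasing_seqP => i; rewrite subsetEset; move=> t; rewrite /F/= !in_itv/=.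
    have : rho i <= rho i.+1.
      rewrite ler_pM2l// ltW// ltr_cos// ltf_pV2 ?posrE ?ltr0n// ltr_nat//.
    by move=> ? ?; lra.
  - by move=> i; exact: measurable_itv.
  - by move=> i; apply: measurable_funTS; exact: profile_measurable.
  - by move=> i x _; rewrite lee_fin profile_ge0.
have cvg2 : ((r ^+ j * (P (pi - th i) - P (th i)))%:E @[i --> \oo] --> (r ^+ j * (P pi - P 0))%:E)%E.
  apply: cvg_EFin; first exact: nearW.
  apply: cvgM; first exact: cvg_cst.
  have thc : th i @[i --> \oo] --> (0 : R).
    by have := @cvg_harmonic R; rewrite -(cvg_shiftS (@harmonic R)).
  have c1 : (fun x => P (pi - x)) x @[x --> (0:R)] --> P (pi - 0).
    by apply: is_derive_cts (der_comp (derB (der_cst _ _) (der_id _)) (dP _ _)); have := @pihalf_lt2 R; lra.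
  have c2 : P x @[x --> (0:R)] --> P 0.
    apply: is_derive_cts (dP _ _); lra.
  rewrite -[X in P X - P 0]subr0.
  by apply: cvgB; [exact: (cvg_comp _ _ thc c1) | exact: (cvg_comp _ _ thc c2)].
have := cvg_unique _ cvg1 (_ : _ --> (r ^+ j * (P pi - P 0))%:E) => -> //.
  by rewrite mulrC.
by under eq_fun do rewrite intF.
Qed.

End ball_integrals.

(** * The area of the sphere *)

Section sphere_area.
Context {R : realType}.
Local Notation mu := (@lebesgue_measure R).

Lemma sqnorm_row_mx k (t : R) (v : 'rV[R]_k) :
  sqnorm (row_mx (t%:M : 'M[R]_1) v) = t ^+ 2 + sqnorm v.
Proof.
rewrite /sqnorm (big_split_ord _ (m := 1) (n := k))/= big_ord1.
rewrite row_mxEl mxE eqxx mulr1n; congr (_ + _).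
by apply: eq_bigr => i _; rewrite row_mxEr.
Qed.

Lemma sqnorm_rV0 (v : 'rV[R]_0) : sqnorm v = 0.
Proof. by rewrite /sqnorm big_ord0. Qed.

(** The factors collected when [k] coordinates are integrated out one at a
    time, starting from the profile of index [j]: [ball_const k 1] is the
    volume of the unit ball of R^k and [ball_const k 0] the area of a unit
    hemisphere of R^(k+1). *)
Definition ball_const (k j : nat) : R := \prod_(i < k) (2 * wallis (j + i)).

Lemma ball_const_gt0 k j : 0 < ball_const k j.
Proof. by apply: prodr_gt0 => i _; rewrite mulr_gt0// wallis_gt0. Qed.

Lemma integral_rV_profile k j c :
  integral_rV (fun v : 'rV[R]_k => (profile j c (sqnorm v))%:E) =
  (ball_const k j * profile (j + k) c 0)%:E.
Proof.
elim: k c => [|k IH] c /=.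
  by rewrite sqnorm_rV0 addn0 /ball_const big_ord0 mul1r.
transitivity (\int[mu]_t ((ball_const k j)%:E * (profile (j + k) c (t ^+ 2))%:E))%E.
  apply: eq_integral => t _; rewrite -EFinM.
  have -> : profile (j + k) c (t ^+ 2) = profile (j + k) (c - t ^+ 2) 0.
    by rewrite /profile subr_gt0 subr0.
  rewrite -IH; congr integral_rV; apply/funext => v; congr EFin.
  rewrite sqnorm_row_mx /profile ltrBrDl.
  by rewrite (_ : c - (t ^+ 2 + sqnorm v) = c - t ^+ 2 - sqnorm v); last ring.
rewrite ge0_integralZl_EFin//.
- rewrite integral_profile -EFinM mulrA; congr (_ * _)%:E; last by rewrite addnS.
  by rewrite /ball_const big_ord_recr.
- by move=> t _; rewrite lee_fin profile_ge0.
- exact: profile_measurable.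
- exact: ltW (ball_const_gt0 _ _).
Qed.

Lemma sqnorm_line k (y : 'rV[R]_k) (i : 'I_k) (s : R) :
  sqnorm (y + s *: delta_mx ord0 i) = sqnorm y + 2 * y ord0 i * s + s ^+ 2.
Proof.
rewrite /sqnorm (bigD1 i)//= [in RHS](bigD1 i)//=.
rewrite !mxE !eqxx mulr1 (eq_bigr (fun j => y ord0 j ^+ 2)); first by ring.
by move=> j ji; rewrite !mxE eqxx (negbTE ji) mulr0 addr0.
Qed.

Lemma is_derive_line k (f : 'rV[R]_k -> R) (y v : 'rV[R]_k) (a : R) :
  is_derive (0 : R) 1 (fun s => f (y + s *: v)) a -> is_derive y v f a.
Proof.
have E : (fun h : R => h^-1 *: (((fun s => f (y + s *: v)) \o shift (0 : R)) (h *: (1 : R)) - f (y + (0 : R) *: v)))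
  = (fun h : R => h^-1 *: ((f \o shift y) (h *: v) - f y)).
  apply/funext => h /=.
  by rewrite scale0r !addr0 [h *: 1]mulr1 [y + _]addrC.
by case=> df <-; apply: DeriveDef; rewrite /derivable /derive -E.
Qed.

Lemma grad_hemisphere k (y : 'rV[R]_k) : sqnorm y < 1 ->
  Num.sqrt (1 + enorm (grad (fun z : 'rV[R]_k => Num.sqrt (1 - enorm z ^+ 2)) y) ^+ 2) =
  (Num.sqrt (1 - sqnorm y))^-1.
Proof.
move=> y1; rewrite enorm_sqr.
set r := Num.sqrt (1 - sqnorm y).
have r0 : 0 < r by rewrite sqrtr_gt0 subr_gt0.
have rE : r ^+ 2 = 1 - sqnorm y by rewrite sqr_sqrtr// subr_ge0 ltW.
have -> : sqnorm (grad (fun z : 'rV[R]_k => Num.sqrt (1 - enorm z ^+ 2)) y) =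
    sqnorm y / r ^+ 2.
  rewrite /sqnorm mulr_suml; apply: eq_bigr => i _.
  rewrite mxE /partial.
  have -> : 'D_(delta_mx ord0 i) (fun z : 'rV[R]_k => Num.sqrt (1 - enorm z ^+ 2)) y =
     - (y ord0 i / r).
    apply: derive_val; apply: is_derive_line.
    pose q (s : R) := 1 - (sqnorm y + 2 * y ord0 i * s + s ^+ 2).
    rewrite (_ : (fun _ => _) = (fun s => Num.sqrt (q s))); last first.
      by apply/funext => s; rewrite enorm_sqr sqnorm_line.
    have dq := derB (der_cst 1 0) (derD (derD (der_cst (sqnorm y) 0)
      (derM (der_cst (2 * y ord0 i) 0) (der_id (0 : R)))) (derX 2 (der_id (0:R)))).
    have q0 : q 0 = 1 - sqnorm y by rewrite /q; ring.
    have p : 0 < q 0 by rewrite q0 subr_gt0.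
    apply: (is_derive_eq (@der_comp _ _ q 0 _ _ dq (is_derive1_sqrt p))).
    rewrite q0 -/r /=; field; by rewrite gt_eqF.
  by rewrite sqrrN exprMn exprVn.
have -> : 1 + sqnorm y / r ^+ 2 = (r^-1) ^+ 2.
  have -> : sqnorm y = 1 - r ^+ 2 by rewrite rE; ring.
  by field; rewrite gt_eqF.
by rewrite sqrtr_sqr ger0_norm// invr_ge0 ltW.
Qed.

Lemma sphere_areaE n : sphere_area R n.+1 = 2 * ball_const n 0.
Proof.
rewrite /sphere_area /graph_area /=; congr (2 * _).
rewrite (_ : (_ \_ _) = (fun v : 'rV[R]_n => (profile 0 1 (sqnorm v))%:E)).
  rewrite integral_rV_profile/= /profile ltr01 subr0 sqrtr1 expr1n divr1 mulr1.
  by [].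
apply/funext => y; rewrite patchE /profile expr0 mul1r.
have -> : (y \in [set y : 'rV[R]_n | enorm y < 1]) = (sqnorm y < 1).
  apply/idP/idP; rewrite inE/=.
    by rewrite -enorm_sqr expr_lt1 ?enorm_ge0.
  by rewrite -enorm_sqr expr_lt1 ?enorm_ge0.
by case: ifPn => // y1; rewrite grad_hemisphere.
Qed.

(** In the quotient of the two sphere areas all factors of [ball_const]
    cancel but the last one, [2 * wallis k]. *)
Lemma div_constE k : div_const R k.+2 =
  (\int[mu]_(t in `[0%R, pi / 2])
    (Num.sqrt (1 + k.+2%:R * k%:R * cos t ^+ 2) * sin t ^+ k)) / wallis k.
Proof.
rewrite /div_const !sphere_areaE mulrC; congr (_ * _).
  congr (Rintegral _ _ _); apply/funext => t.
  by rewrite -natrB// subn2.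
rewrite /ball_const big_ord_recr/= add0n; field.
by rewrite !gt_eqF// ?wallis_gt0// ball_const_gt0.
Qed.

End sphere_area.

(** * Step functions on a grid *)

Section counting.
Context {R : realType}.
Local Notation mu := (@lebesgue_measure R).

(** The integral of a nonnegative function is the supremum of those of the
    simple functions below it, hence monotone. Under the iterated integral
    this compares step functions with indicators of balls. *)
Lemma le_integral_nonneg (f g : R -> \bar R) :
  (forall x, 0 <= f x)%E -> (forall x, f x <= g x)%E ->
  (\int[mu]_x f x <= \int[mu]_x g x)%E.
Proof.
move=> f0 fg; have g0 x : (0 <= g x)%E := le_trans (f0 x) (fg x).
rewrite !ge0_integralTE//; apply: ge_ereal_sup => _ [h hf <-].
by apply: ereal_sup_ubound; exists h => // x; exact: le_trans (hf x) (fg x).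
Qed.

Lemma integral_rV_ge0 k (f : 'rV[R]_k -> \bar R) :
  (forall x, 0 <= f x)%E -> (0 <= integral_rV f)%E.
Proof. by elim: k f => [|k IH] f f0 //=; apply: integral_ge0 => t _; apply: IH. Qed.

Lemma le_integral_rV k (f g : 'rV[R]_k -> \bar R) :
  (forall x, 0 <= f x)%E -> (forall x, f x <= g x)%E ->
  (integral_rV f <= integral_rV g)%E.
Proof.
elim: k f g => [|k IH] f g f0 fg //=.
apply: le_integral_nonneg => t; first exact: integral_rV_ge0.
exact: IH.
Qed.

(** The lower ends of [2 N] half-open intervals of length [d] that tile the
    interval from [- d N] to [d N]; the points of [grid] are the lower
    corners of the cubes that these intervals span. *)
Definition line (d : R) (N : nat) : seq R :=
  [seq d * (j%:R - N%:R) | j <- iota 0 (N + N)].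

Fixpoint grid (d : R) (N k : nat) : seq 'rV[R]_k :=
  match k with
  | 0 => [:: 0]
  | k'.+1 => [seq (row_mx (t%:M : 'M[R]_1) v : 'rV[R]_k'.+1) | t <- line d N, v <- grid d N k']
  end.

Lemma big_grid d N k (F : 'rV[R]_k.+1 -> R) :
  \sum_(q <- grid d N k.+1) F q =
  \sum_(t <- line d N) \sum_(v <- grid d N k) F (row_mx (t%:M : 'M[R]_1) v).
Proof. by rewrite /= big_allpairs_dep. Qed.

Definition in_cell1 (d t s : R) : bool := (t <= s) && (s < t + d).

Definition in_cell (d : R) k (q y : 'rV[R]_k) : bool :=
  [forall i, in_cell1 d (q ord0 i) (y ord0 i)].

Lemma in_cell_row_mx d k (t s : R) (q y : 'rV[R]_k) :
  in_cell d (row_mx (t%:M : 'M[R]_1) q) (row_mx (s%:M : 'M[R]_1) y) =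
  in_cell1 d t s && in_cell d q y.
Proof.
apply/forallP/andP => [h|[ht /forallP hq] i].
  split; first by have := h (lshift k (ord0 : 'I_1)); rewrite !row_mxEl !mxE eqxx !mulr1n.
  by apply/forallP => i; have := h (rshift 1 i); rewrite !row_mxEr.
by case: (split_ordP i) => j ->; rewrite ?row_mxEl ?row_mxEr// !ord1 !mxE eqxx !mulr1n.
Qed.

Lemma row_mx_decomp k (z : 'rV[R]_(1 + k)) :
  z = row_mx ((z ord0 ord0)%:M : 'M[R]_1) (rsubmx z).
Proof.
rewrite -[LHS]hsubmxK; congr row_mx; apply/rowP => i.
by rewrite !mxE !ord1 eqxx mulr1n; congr (z _ _); apply/val_inj.
Qed.

Lemma row_mx_addl k (s : R) (y : 'rV[R]_k) (z : 'rV[R]_(1 + k)) :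
  row_mx (s%:M : 'M[R]_1) y + z =
  row_mx ((s + z ord0 ord0)%:M : 'M[R]_1) (y + rsubmx z).
Proof.
rewrite [in LHS](row_mx_decomp z) add_row_mx; congr row_mx.
by apply/matrixP => i j; rewrite !mxE !ord1 eqxx !mulr1n.
Qed.

(** The indicator of a cell is the difference of the indicators of two
    consecutive half-lines, so the sum telescopes. *)
Lemma big_in_cell1 (d : R) N (s : R) : 0 <= d ->
  \sum_(t <- line d N) (in_cell1 d t s)%:R = (- (d * N%:R) <= s < d * N%:R)%R%:R :> R.
Proof.
move=> d0; rewrite /line big_map.
have -> : \sum_(j <- iota 0 (N + N)) (in_cell1 d (d * (j%:R - N%:R)) s)%:R =
  \sum_(0 <= j < N + N) ((s < d * (j.+1%:R - N%:R))%R%:R - (s < d * (j%:R - N%:R))%R%:R) :> R.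
  rewrite /index_iota subn0; apply: eq_bigr => j _.
  have e : d * (j%:R - N%:R) + d = d * (j.+1%:R - N%:R) by rewrite -natr1; ring.
  have le : d * (j%:R - N%:R) <= d * (j.+1%:R - N%:R) by rewrite -e lerDl.
  rewrite /in_cell1 e; case: (leP (d * (j%:R - N%:R)) s) => h1 /=.
    by rewrite subr0.
  by rewrite (lt_le_trans h1 le) subrr.
rewrite telescope_sumr// natrD.
rewrite (_ : d * (N%:R + N%:R - N%:R) = d * N%:R); last ring.
rewrite (_ : d * (0%:R - N%:R) = - (d * N%:R)); last by rewrite mulr0n; ring.
case: (leP (- (d * N%:R)) s) => h /=; first by rewrite subr0.
have le : - (d * N%:R) <= d * N%:R.
  by rewrite (@le_trans _ _ 0) ?oppr_le0 ?mulr_ge0.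
by rewrite (lt_le_trans h le) subrr.
Qed.

Definition in_box (b : R) k (y : 'rV[R]_k) : bool :=
  [forall i, (- b <= y ord0 i < b)%R].

Lemma in_box_row_mx b k (s : R) (y : 'rV[R]_k) :
  in_box b (row_mx (s%:M : 'M[R]_1) y) = (- b <= s < b)%R && in_box b y.
Proof.
apply/forallP/andP => [h|[ht /forallP hq] i].
  split; first by have := h (lshift k (ord0 : 'I_1)); rewrite !row_mxEl !mxE eqxx !mulr1n.
  by apply/forallP => i; have := h (rshift 1 i); rewrite !row_mxEr.
by case: (split_ordP i) => j ->; rewrite ?row_mxEl ?row_mxEr// !ord1 !mxE eqxx !mulr1n.
Qed.

Lemma big_in_cell (d : R) N k (y : 'rV[R]_k) : 0 <= d ->
  \sum_(q <- grid d N k) (in_cell d q y)%:R = (in_box (d * N%:R) y)%:R :> R.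
Proof.
move=> d0; elim: k y => [|k IH] y.
  rewrite big_seq1; congr (nat_of_bool _)%:R; transitivity true; [|symmetry];
  by apply/forallP; case.
rewrite big_grid [y]row_mx_decomp in_box_row_mx -mulnb natrM.
rewrite -IH -big_in_cell1// mulr_suml; apply: eq_bigr => t _.
rewrite mulr_sumr; apply: eq_bigr => v _.
by rewrite in_cell_row_mx -mulnb natrM.
Qed.

Lemma in_cell1_indic (d t z : R) :
  (fun s => (in_cell1 d t (s + z))%:R) = \1_(`[(t - z)%R, (t - z + d)%R[) :> (R -> R).
Proof.
apply/funext => s; rewrite indicE mem_setE/= in_itv/= /in_cell1 lerBlDr.
by congr (_ && _)%:R; rewrite addrAC ltrBrDr.
Qed.

Lemma integral_in_cell1 (d t z c : R) : 0 <= d -> 0 <= c ->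
  (\int[mu]_s ((in_cell1 d t (s + z))%:R * c)%:E = (d * c)%:E)%E.
Proof.
move=> d0 c0.
rewrite (_ : (fun s => _) = (fun s => c%:E * (\1_(`[(t - z)%R, (t - z + d)%R[) s)%:E)%E); last first.
  by apply/funext => s; rewrite -EFinM mulrC -in_cell1_indic.
rewrite ge0_integralZl_EFin//; last first.
  by apply/measurable_EFinP; exact: measurable_indic.
transitivity (c%:E * (if (t - z < t - z + d)%R then (t - z + d)%:E - (t - z)%:E else 0))%E.
  congr (_ * _)%E; rewrite integral_indic// setIT.
  by apply: etrans (lebesgue_measure_itv _) _; rewrite /= lte_fin.
case: ltP => h; first by rewrite -EFinB -EFinM mulrC; congr (_ * _)%:E; ring.
have -> : d = 0 by apply/eqP; rewrite eq_le d0 andbT; lra.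
by rewrite mule0 mul0r.
Qed.

(** The translation by [z] lets distances to [z] be measured from the
    origin: balls about [z] become balls centred at the origin, whose
    volume has been computed. *)
Lemma integral_rV_step (d : R) N k (z : 'rV[R]_k) (c : 'rV[R]_k -> R) :
  0 <= d -> (forall q, 0 <= c q) ->
  integral_rV (fun y => (\sum_(q <- grid d N k) (in_cell d q (y + z))%:R * c q)%:E) =
  (d ^+ k * \sum_(q <- grid d N k) c q)%:E.
Proof.
move=> d0; elim: k z c => [|k IH] z c c0 /=.
  rewrite !big_seq1 mul1r; have -> : in_cell d 0 (0 + z) by apply/forallP; case.
  by rewrite mul1r.
transitivity (\int[mu]_s \sum_(t <- line d N)
  ((in_cell1 d t (s + z ord0 ord0))%:R *
    (d ^+ k * \sum_(v <- grid d N k) c (row_mx (t%:M : 'M[R]_1) v)))%:E)%E.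
  apply: eq_integral => s _; rewrite sumEFin.
  have := IH (rsubmx (z : 'rV_(1 + k))) (fun v => \sum_(t <- line d N)
    (in_cell1 d t (s + z ord0 ord0))%:R * c (row_mx (t%:M : 'M[R]_1) v)).
  rewrite (_ : (d ^+ k * _)%:E = (\sum_(t <- line d N)
    ((in_cell1 d t (s + z ord0 ord0))%:R *
    (d ^+ k * \sum_(v <- grid d N k) c (row_mx (t%:M : 'M[R]_1) v))))%:E).
    move=> <-; last by move=> q; apply: sumr_ge0 => t _; rewrite mulr_ge0.
    congr integral_rV; apply/funext => y; congr EFin.
    rewrite big_grid exchange_big; apply: eq_bigr => v _.
    rewrite mulr_sumr; apply: eq_bigr => t _.
    by rewrite row_mx_addl in_cell_row_mx -mulnb natrM; ring.
  congr EFin; rewrite exchange_big mulr_sumr; apply: eq_bigr => t _.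
  by rewrite -mulr_sumr; ring.
rewrite ge0_integral_sum//.
- rewrite (eq_bigr (fun t => (d * (d ^+ k * \sum_(v <- grid d N k) c (row_mx (t%:M : 'M[R]_1) v)))%:E)).
    rewrite sumEFin; congr EFin; rewrite exprS big_allpairs_dep mulr_sumr.
    by apply: eq_bigr => t _; rewrite mulrA.
  move=> t _; apply: integral_in_cell1 => //.
  by rewrite mulr_ge0 ?exprn_ge0 ?sumr_ge0.
- move=> t; apply/measurable_EFinP; apply: measurable_funM => //.
  by rewrite in_cell1_indic; exact: measurable_indic.
- move=> t s _; rewrite lee_fin !mulr_ge0 ?exprn_ge0 ?sumr_ge0//.
Qed.

End counting.

(** * Sums of radial densities over a grid *)

Section quadrature.
Context {R : realType}.

Lemma enorm_cell (d : R) k (q y : 'rV[R]_k) : 0 <= d -> in_cell d q y ->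
  enorm (y - q) <= k%:R * d.
Proof.
move=> d0 /forallP qy; rewrite enorm_le ?mulr_ge0//.
apply: (@le_trans _ _ (\sum_(i < k) d ^+ 2)).
  apply: ler_sum => i _; have := qy i; rewrite /in_cell1 !mxE => /andP[h1 h2].
  by rewrite lerXn2r// ?nnegrE; lra.
rewrite sumr_const card_ord -[d ^+ 2 *+ k]mulr_natl exprMn ler_wpM2r ?sqr_ge0//.
by rewrite -natrX ler_nat; case: k {q y qy} => // k; rewrite expnS leq_pmulr// expn1.
Qed.

Definition grid_count (d : R) N k (z : 'rV[R]_k) (r : R) : R :=
  \sum_(q <- grid d N k) (enorm (q - z) < r)%R%:R.

Local Notation B k := (@ball_const R k 1).

Lemma profile_ball k (r : R) : 0 < r -> profile k.+1 (r ^+ 2) 0 = r ^+ k.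
Proof.
move=> r0; rewrite /profile exprn_gt0// subr0 sqrtr_sqr gtr0_norm//.
by rewrite exprS mulrAC divff ?gt_eqF// mul1r.
Qed.

Lemma profile_indicator (c s : R) : profile 1 c s = (s < c)%R%:R.
Proof.
by rewrite /profile; case: ifPn => // sc; rewrite expr1 divff// gt_eqF// sqrtr_gt0 subr_gt0.
Qed.

Lemma integral_rV_grid_count (d : R) N k (z : 'rV[R]_k) (r : R) : 0 <= d ->
  integral_rV (fun y => (\sum_(q <- grid d N k)
    (in_cell d q (y + z))%:R * (enorm (q - z) < r)%R%:R)%:E) =
  (d ^+ k * grid_count d N z r)%:E.
Proof. by move=> d0; rewrite integral_rV_step. Qed.

(** The cells of the points counted are disjoint, and they lie in the ball
    of radius [r + k d] about [z] since a cell has diameter at most [k d]: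
    their total volume is at most that of this ball. *)
Lemma grid_count_le (d : R) N k (z : 'rV[R]_k) (r : R) : 0 < d -> 0 <= r ->
  d ^+ k * grid_count d N z r <= B k * (r + k%:R * d) ^+ k.
Proof.
move=> d0 r0; rewrite -lee_fin -integral_rV_grid_count ?(ltW d0)//.
set p := r + k%:R * d; have p0 : 0 <= p by rewrite addr_ge0 ?mulr_ge0// ltW.
apply: (@le_trans _ _ (integral_rV (fun y : 'rV[R]_k => (profile 1 (p ^+ 2) (sqnorm y))%:E))).
  apply: le_integral_rV => y.
    by rewrite lee_fin sumr_ge0// => q _; rewrite mulr_ge0.
  rewrite lee_fin profile_indicator -enorm_lt//.
  have [yp|py] := ltP (enorm y) p.
    apply: (@le_trans _ _ (\sum_(q <- grid d N k) (in_cell d q (y + z))%:R)).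
      by apply: ler_sum => q _; rewrite -[leRHS]mulr1 ler_wpM2l// lern1 leq_b1.
    by rewrite big_in_cell ?(ltW d0)// lern1 leq_b1.
  rewrite big1// => q _; case: (boolP (in_cell _ _ _)) => [qy|_]; last by rewrite mul0r.
  rewrite mul1r; case: ltP => // qr; exfalso.
  have := enorm_cell (ltW d0) qy.
  have := enorm_triangle (y + z - q) (q - z).
  by rewrite addrA subrK addrK; move: py; rewrite /p; lra.
rewrite integral_rV_profile lee_fin ler_pM2l ?ball_const_gt0//.
have [p1|p1] := ltP 0 p; first by rewrite profile_ball.
by have -> : p = 0; [lra|rewrite /profile expr0n ltxx exprn_ge0].
Qed.

(** A cell that meets the ball of radius [r - k d] about [z] has its corner
    within [r] of [z], and these cells cover that ball, as it lies in the
    box tiled by the grid. *)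
Lemma grid_count_ge (d : R) N k (z : 'rV[R]_k) (r : R) : 0 < d -> k%:R * d < r ->
  enorm z + r <= d * N%:R ->
  B k * (r - k%:R * d) ^+ k <= d ^+ k * grid_count d N z r.
Proof.
move=> d0 r0 zN; rewrite -lee_fin -integral_rV_grid_count ?(ltW d0)//.
set p := r - k%:R * d; have p0 : 0 < p by rewrite subr_gt0.
have kd0 : 0 <= k%:R * d by rewrite mulr_ge0 ?(ltW d0).
rewrite -(profile_ball _ p0) -[k.+1]add1n -integral_rV_profile.
apply: le_integral_rV => y; first by rewrite lee_fin profile_ge0.
rewrite lee_fin profile_indicator -enorm_lt ?(ltW p0)//.
have [yp|py] := ltP (enorm y) p; last first.
  by rewrite sumr_ge0// => q _; rewrite mulr_ge0.
rewrite (eq_bigr (fun q => (in_cell d q (y + z))%:R)).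
  rewrite big_in_cell ?(ltW d0)// (_ : in_box _ _)//; apply/forallP => i.
  have := coord_le (y + z) i; have := enorm_triangle y z.
  by move=> h1 h2; have := le_trans h2 h1; rewrite ler_norml; move: yp; rewrite /p; lra.
move=> q _; case: (boolP (in_cell _ _ _)) => [qy|_]; last by rewrite mul0r.
have -> : enorm (q - z) < r; last by rewrite mulr1.
have := enorm_cell (ltW d0) qy; rewrite enormB_sym.
have := enorm_triangle (q - (y + z)) y.
by rewrite (_ : q - (y + z) + y = q - z); [move: yp; rewrite /p; lra | by apply/rowP => i; rewrite !mxE; ring].
Qed.

(** Summation by parts. With [D] the difference of two cumulated counts, it
    transfers the comparison of the counts to the sums weighted by the
    nonincreasing [h]. *)
Lemma abel_sum_ge0 (h D : nat -> R) m : (forall i, 0 <= h i.+1 <= h i) ->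
  (forall i, 0 <= D i) ->
  h m * D m <= \sum_(0 <= i < m) h i * (D i.+1 - D i) + h 0%N * D 0%N.
Proof.
move=> hdec D0; elim: m => [|m IH]; first by rewrite big_nil add0r.
rewrite big_nat_recr//=; have := D0 m.+1; have := hdec m; nra.
Qed.

(** A nonincreasing function of the distance [s] is at most its value on
    the inner sphere of the layer of thickness [d] that contains [s], and
    at least its value on the outer one in [layer_ge]. *)
Lemma layer_le (g : R -> R) (d s : R) m : 0 < d -> 0 <= s ->
  (forall r, 0 <= r -> 0 <= g r) ->
  (forall r t, 0 <= r -> r <= t -> g t <= g r) ->
  (s < m%:R * d)%R%:R * g s <=
  \sum_(0 <= i < m) g (i%:R * d) * ((s < i.+1%:R * d)%R%:R - (s < i%:R * d)%R%:R).
Proof.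
move=> d0 s0 g0 gdec; elim: m => [|m IH].
  by rewrite big_nil mul0r ltNge s0 mul0r.
rewrite big_nat_recr//=.
have md : m%:R * d < m.+1%:R * d by rewrite ltr_pM2r// ltr_nat.
have md0 : 0 <= m%:R * d by rewrite mulr_ge0// ltW.
move: IH; case: (ltP s (m%:R * d)) => [h1|h1].
  by rewrite (lt_trans h1 md) subrr mulr0 addr0.
rewrite mul0r subr0; case: (ltP s (m.+1%:R * d)) => h2 IH.
  by rewrite mul1r mulr1; have := gdec _ _ md0 h1; lra.
by rewrite mul0r mulr0 addr0.
Qed.

Lemma layer_ge (g : R -> R) (d s : R) m : 0 < d -> 0 <= s ->
  (forall r t, 0 <= r -> r <= t -> g t <= g r) ->
  \sum_(0 <= i < m) g (i.+1%:R * d) * ((s < i.+1%:R * d)%R%:R - (s < i%:R * d)%R%:R)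
  <= (s < m%:R * d)%R%:R * g s.
Proof.
move=> d0 s0 gdec; elim: m => [|m IH].
  by rewrite big_nil mul0r ltNge s0 mul0r.
rewrite big_nat_recr//=.
have md : m%:R * d < m.+1%:R * d by rewrite ltr_pM2r// ltr_nat.
move: IH; case: (ltP s (m%:R * d)) => [h1|h1].
  by rewrite (lt_trans h1 md) subrr mulr0 addr0.
rewrite mul0r subr0; case: (ltP s (m.+1%:R * d)) => h2 IH.
  by rewrite mul1r mulr1; have := gdec _ _ s0 (ltW h2); lra.
by rewrite mul0r mulr0 addr0.
Qed.

(** [Phi] is the integral of [k r ^ (k - 1) * g r] from [0], that is of [g]
    against the volume of balls, up to the volume of the unit ball.
    Two-sided bounds on its increments are the form in which it can be
    compared with the layers of a sum over a grid. *)
Definition radial (k : nat) (g Phi : R -> R) : Prop :=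
  [/\ forall r, 0 <= r -> 0 <= g r,
      forall r t, 0 <= r -> r <= t -> g t <= g r,
      Phi 0 = 0 &
      forall a b, 0 <= a -> a <= b ->
        g b * (b ^+ k - a ^+ k) <= Phi b - Phi a <= g a * (b ^+ k - a ^+ k)].

(** The sum is split into spherical layers of thickness [d]. Summation by
    parts replaces the number of points in balls by the volume [U] of the
    balls enlarged by [k d] ([grid_count_le]). The enlargement is paid by
    the slow variation [L] of [g], and the volumes of the layers then
    telescope into [Phi]. The term with [g 0] is the enlarged ball at
    radius [0]. *)
Lemma quadrature_le (d : R) N k (z : 'rV[R]_k) (g Phi : R -> R) (L Phioo : R) :
  0 < d -> radial k g Phi -> 0 <= L ->
  (forall r, 0 <= r -> g r <= L * g (r + k.+1%:R * d)) ->
  (forall r, 0 <= r -> Phi r <= Phioo) ->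
  d ^+ k * \sum_(q <- grid d N k) g (enorm (q - z)) <=
  B k * (L * Phioo + g 0 * (k%:R * d) ^+ k).
Proof.
move=> d0 [g0 gdec Phi0 dPhi] L0 gL Phile.
have [m hm] : exists m : nat, forall q, q \in grid d N k -> enorm (q - z) < m%:R * d.
  have [x hx] : exists x : R, forall q, q \in grid d N k -> enorm (q - z) <= x.
    exists (\sum_(q <- grid d N k) enorm (q - z)) => q qs.
    by rewrite (big_rem q)//= lerDl sumr_ge0// => ? _; exact: enorm_ge0.
  exists (Num.bound (`|x| / d)).
  move=> q /hx qx; rewrite -ltr_pdivrMr//.
  apply: le_lt_trans (archi_boundP _); last by rewrite divr_ge0// ltW.
  by rewrite ler_pM2r ?invr_gt0// (le_trans qx)// ler_norm.
have kd0 : 0 <= k%:R * d by rewrite mulr_ge0 ?(ltW d0).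
have id0 i : 0 <= i%:R * d by rewrite mulr_ge0 ?(ltW d0).
have dk0 : 0 <= d ^+ k by rewrite exprn_ge0 ?ltW.
have B0 := ball_const_gt0 k 1 : 0 < B k.
pose Nc (i : nat) : R := d ^+ k * grid_count d N z (i%:R * d).
pose U (i : nat) : R := B k * (i%:R * d + k%:R * d) ^+ k.
apply: (@le_trans _ _ (\sum_(0 <= i < m) g (i%:R * d) * (Nc i.+1 - Nc i))).
  rewrite mulr_sumr big_seq.
  apply: (@le_trans _ _ (\sum_(q <- grid d N k | q \in grid d N k) d ^+ k *
     \sum_(0 <= i < m) g (i%:R * d) * ((enorm (q - z) < i.+1%:R * d)%R%:R - (enorm (q - z) < i%:R * d)%R%:R))).
    apply: ler_sum => q qs; rewrite ler_wpM2l//.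
    have := layer_le m d0 (enorm_ge0 (q - z)) g0 gdec.
    by rewrite hm// mul1r.
  rewrite -big_seq -mulr_sumr exchange_big/= mulr_sumr; apply: ler_sum => i _.
  by rewrite -mulr_sumr sumrB /Nc /grid_count -!/(grid_count _ _ _ _) -mulrBr; lra.
have abel := @abel_sum_ge0 (fun i => g (i%:R * d)) (fun i => U i - Nc i) m.
have step i : g (i%:R * d) * (U i.+1 - U i) <=
    B k * L * (Phi (i.+1%:R * d + k%:R * d) - Phi (i%:R * d + k%:R * d)).
  have e : i.+1%:R * d = i%:R * d + d by rewrite -natr1 mulrDl mul1r.
  have /andP[+ _] := dPhi (i%:R * d + k%:R * d) (i.+1%:R * d + k%:R * d)
    (addr_ge0 (id0 i) kd0) (ltac:(by rewrite e; lra)).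
  (* one layer and the enlargement by [k d]: this is the shift by [(k + 1)
     d] in the slow variation of [g] *)
  have e2 : i%:R * d + k.+1%:R * d = i.+1%:R * d + k%:R * d.
    by rewrite -!natr1; ring.
  have := gL (i%:R * d) (id0 i); rewrite e2.
  have : (i%:R * d + k%:R * d) ^+ k <= (i.+1%:R * d + k%:R * d) ^+ k.
    by rewrite lerXn2r ?nnegrE ?addr_ge0// e; lra.
  rewrite /U -mulrBr; set A := _ ^+ k; set C := _ ^+ k; set G := g (i.+1%:R * d + _).
  move=> AC h1 h2.
  have h3 : g (i%:R * d) * (C - A) <= L * (G * (C - A)) by rewrite mulrA ler_wpM2r// subr_ge0.
  have h4 : L * (G * (C - A)) <= L * (Phi (i.+1%:R * d + k%:R * d) - Phi (i%:R * d + k%:R * d)).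
    by rewrite ler_wpM2l.
  by rewrite mulrCA -mulrA ler_pM2l//; lra.
have tele : \sum_(0 <= i < m) g (i%:R * d) * (U i.+1 - U i) <=
   B k * L * (Phi (m%:R * d + k%:R * d) - Phi (0%:R * d + k%:R * d)).
  rewrite -(@telescope_sumr _ 0 m (fun i => Phi (i%:R * d + k%:R * d)))// mulr_sumr.
  by apply: ler_sum => i _.
have abel1 : 0 <= \sum_(0 <= i < m) g (i%:R * d) * (U i.+1 - U i) -
   \sum_(0 <= i < m) g (i%:R * d) * (Nc i.+1 - Nc i) + g 0 * (U 0%N - Nc 0%N).
  apply: le_trans (le_trans (abel _ _) _).
  - rewrite mulr_ge0 ?g0// /U /Nc subr_ge0 grid_count_le//.
  - move=> i; rewrite g0//= gdec// ler_wpM2r ?(ltW d0)// ler_nat//.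
  - by move=> i; rewrite subr_ge0 /U /Nc grid_count_le.
  - rewrite mul0r lerD2r -sumrB; apply: ler_sum => i _; lra.
have N0 : 0 <= Nc 0%N by rewrite mulr_ge0// sumr_ge0.
have U0 : U 0%N = B k * (k%:R * d) ^+ k by rewrite /U mul0r add0r.
have g00 := g0 0 (lexx 0).
have PhiK : 0 <= Phi (0%:R * d + k%:R * d).
  have /andP[+ _] := dPhi 0 (0%:R * d + k%:R * d) (lexx 0) (ltac:(by rewrite mul0r add0r)).
  rewrite Phi0 subr0; apply: le_trans; apply: mulr_ge0; first by rewrite g0// mul0r add0r.
  by rewrite subr_ge0 lerXn2r ?nnegrE// mul0r add0r.
have gN : 0 <= g 0 * Nc 0%N by rewrite mulr_ge0.
have h5 : B k * L * (Phi (m%:R * d + k%:R * d) - Phi (0%:R * d + k%:R * d)) <= B k * L * Phioo.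
  apply: ler_wpM2l; first by rewrite mulr_ge0// ltW.
  by have := Phile _ (addr_ge0 (id0 m) kd0); lra.
move: abel1; rewrite U0 => abel1; lra.
Qed.

(** The same argument with the balls shrunk by [k d], which are empty for
    the first radii; hence the maximum with [0]. *)
Lemma quadrature_ge (d : R) N k (z : 'rV[R]_k) (g Phi : R -> R) (L : R) (m : nat) :
  0 < d -> (0 < k)%N -> radial k g Phi -> 0 <= L ->
  (forall r, 0 <= r -> g r <= L * g (r + k.+1%:R * d)) ->
  enorm z + m%:R * d <= d * N%:R ->
  B k * Phi (Num.max 0 (m%:R * d - k%:R * d)) <=
  L * (d ^+ k * \sum_(q <- grid d N k) (enorm (q - z) < m%:R * d)%R%:R * g (enorm (q - z))).
Proof.
move=> d0 k0 [g0 gdec Phi0 dPhi] L0 gL zN.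
have kd0 : 0 <= k%:R * d by rewrite mulr_ge0 ?(ltW d0).
have id0 i : 0 <= i%:R * d by rewrite mulr_ge0 ?(ltW d0).
have dk0 : 0 <= d ^+ k by rewrite exprn_ge0 ?ltW.
have B0 := ball_const_gt0 k 1 : 0 < B k.
pose Nc (i : nat) : R := d ^+ k * grid_count d N z (i%:R * d).
pose x (i : nat) : R := Num.max 0 (i%:R * d - k%:R * d).
have x0 i : 0 <= x i by rewrite /x le_max lexx.
have xS i : x i <= x i.+1.
  by rewrite /x ge_max !le_max lexx/= lerD2r ler_pM2r// ler_nat leqnSn orbT.
pose U (i : nat) : R := B k * x i ^+ k.
apply: (@le_trans _ _ (L * \sum_(0 <= i < m) g (i.+1%:R * d) * (Nc i.+1 - Nc i))); last first.
  rewrite ler_wpM2l// [leRHS]mulr_sumr.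
  apply: (@le_trans _ _ (\sum_(q <- grid d N k) d ^+ k *
     \sum_(0 <= i < m) g (i.+1%:R * d) * ((enorm (q - z) < i.+1%:R * d)%R%:R - (enorm (q - z) < i%:R * d)%R%:R))); last first.
    apply: ler_sum => q _; rewrite ler_wpM2l//.
    by apply: layer_ge => //; exact: enorm_ge0.
  rewrite -mulr_sumr exchange_big/= mulr_sumr; apply: ler_sum => i _.
  by rewrite -mulr_sumr sumrB /Nc /grid_count -!/(grid_count _ _ _ _) -mulrBr; lra.
have step i : B k * (Phi (x i.+1) - Phi (x i)) <= L * (g (i.+1%:R * d) * (U i.+1 - U i)).
  have /andP[_ h1] := dPhi (x i) (x i.+1) (x0 i) (xS i).
  have h2 : g (x i) <= L * g (i.+1%:R * d).
    apply: le_trans (gL _ (x0 i)) _; rewrite ler_wpM2l//; apply: gdec => //.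
    have : i%:R * d - k%:R * d <= x i by rewrite /x le_max lexx orbT.
    by rewrite -!natr1; lra.
  have h3 : 0 <= x i.+1 ^+ k - x i ^+ k by rewrite subr_ge0 lerXn2r ?nnegrE.
  rewrite /U (_ : L * _ = B k * (L * g (i.+1%:R * d) * (x i.+1 ^+ k - x i ^+ k))); last ring.
  by rewrite ler_pM2l//; apply: le_trans h1 _; rewrite ler_wpM2r.
have tele : B k * Phi (x m) <= L * \sum_(0 <= i < m) g (i.+1%:R * d) * (U i.+1 - U i).
  have xz : x 0%N = 0 by rewrite /x mul0r sub0r; apply/max_idPl; rewrite oppr_le0.
  have -> : Phi (x m) = \sum_(0 <= i < m) (Phi (x i.+1) - Phi (x i)).
    by rewrite (@telescope_sumr _ 0 m (fun i => Phi (x i)))// xz Phi0 subr0.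
  by rewrite !mulr_sumr; apply: ler_sum => i _.
apply: le_trans tele _; rewrite ler_wpM2l//.
have D0 i : (i <= m)%N -> 0 <= Nc i - U i.
  move=> im; rewrite subr_ge0 /U /Nc.
  have [h|h] := leP (i%:R * d - k%:R * d) 0.
    by rewrite /x (max_idPl h) expr0n gtn_eqF//= mulr0 mulr_ge0// sumr_ge0.
  rewrite /x (max_idPr (ltW h)); apply: grid_count_ge => //; first lra.
  apply: le_trans zN; rewrite lerD2l ler_pM2r// ler_nat//.
(* the lower bound on the number of points holds while the ball stays in
   the grid, that is for [i <= m]; the difference is set to [0] beyond *)
have abel := @abel_sum_ge0 (fun i => g (i.+1%:R * d)) (fun i => if (i <= m)%N then Nc i - U i else 0) m.
have : 0 <= \sum_(0 <= i < m) g (i.+1%:R * d) * ((Nc i.+1 - U i.+1) - (Nc i - U i)).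
  have xz : x 0%N = 0 by rewrite /x mul0r sub0r; apply/max_idPl; rewrite oppr_le0.
  have N0 : Nc 0%N = 0.
    rewrite /Nc /grid_count big1 ?mulr0// => q _; rewrite mul0r.
    by rewrite ltNge enorm_ge0.
  apply: le_trans (le_trans (abel _ _) _).
  - by rewrite leqnn mulr_ge0 ?D0// g0.
  - move=> i; rewrite g0//= gdec// ler_wpM2r ?(ltW d0)// ler_nat//.
  - by move=> i; case: ifP => // /D0.
  - rewrite leq0n /U xz N0 expr0n gtn_eqF//= mulr0 subrr mulr0 addr0.
    rewrite le_eqVlt; apply/orP; left; apply/eqP; apply: eq_big_nat => i /andP[_ im].
    by rewrite im (ltnW im).
rewrite -subr_ge0 -sumrB; congr (0 <= _); apply: eq_bigr => i _; ring.
Qed.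

End quadrature.

(** * The radial densities of the kernel and of its gradient *)

Section radial_profiles.
Context {R : realType}.
Variables (k : nat) (c : R).
Hypotheses (k0 : (0 < k)%N) (c0 : 0 <= c).
Local Notation mu := (@lebesgue_measure R).
Local Notation B := (@ball_const R k 1).

Definition inv_rho (r : R) : R := (Num.sqrt (1 + r ^+ 2))^-1.

(** With [n = k + 1], at a point of height [1] and at distance [r] from its
    foot this is the kernel [(w . nu) / |w|^n] for [c = 0], and the length
    of its gradient for [c = n (n - 2)]; see [kernel_emb] and
    [kernel_grad_emb]. The number [inv_rho r] is the cosine of the angle
    [atan r]. *)
Definition radial_density (r : R) : R :=
  inv_rho r ^+ k.+1 * Num.sqrt (1 + c * inv_rho r ^+ 2).

(** The density in the angle [t = atan r], multiplied by [r ^ (k - 1)] and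
    by the derivative of [tan t]. *)
Definition angular (t : R) : R := Num.sqrt (1 + c * cos t ^+ 2) * sin t ^+ k.-1.

Definition angular_mass : R := \int[mu]_(t in `[0, pi / 2]) angular t.

Lemma rho_gt0 (r : R) : 0 < Num.sqrt (1 + r ^+ 2).
Proof. by rewrite sqrtr_gt0 ltr_wpDr ?sqr_ge0. Qed.

Lemma inv_rho_gt0 r : 0 < inv_rho r.
Proof. by rewrite invr_gt0 rho_gt0. Qed.

Lemma inv_rho_sqr r : inv_rho r ^+ 2 = (1 + r ^+ 2)^-1.
Proof. by rewrite exprVn sqr_sqrtr// addr_ge0// sqr_ge0. Qed.

Lemma inv_rho_le (r t : R) : 0 <= r -> r <= t -> inv_rho t <= inv_rho r.
Proof.
move=> r0 rt; rewrite lef_pV2 ?posrE ?rho_gt0// ler_wsqrtr// lerD2l.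
by rewrite lerXn2r// nnegrE; lra.
Qed.

(** This is [1 + (r + a)^2 <= (1 + a)^2 (1 + r^2)]. *)
Lemma inv_rho_slow (r a : R) : 0 <= r -> 0 <= a -> inv_rho r <= (1 + a) * inv_rho (r + a).
Proof.
move=> r0 a0; rewrite /inv_rho ler_pdivlMr ?rho_gt0// mulrC ler_pdivrMr ?rho_gt0//.
rewrite -(@ler_pXn2r _ 2)// ?nnegrE ?mulr_ge0 ?sqrtr_ge0 ?addr_ge0//.
have e x : Num.sqrt (1 + x ^+ 2) ^+ 2 = 1 + x ^+ 2 :> R.
  by rewrite sqr_sqrtr// addr_ge0// sqr_ge0.
rewrite exprMn !e; have h1 : 0 <= a * (1 - r + r ^+ 2) by rewrite mulr_ge0//; nra.
by have := sqr_ge0 (a * r); nra.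
Qed.

Lemma radial_density_ge0 r : 0 <= radial_density r.
Proof. by rewrite mulr_ge0 ?sqrtr_ge0// exprn_ge0// ltW// inv_rho_gt0. Qed.

Lemma radial_density_le r t : 0 <= r -> r <= t -> radial_density t <= radial_density r.
Proof.
move=> r0 rt; have h := inv_rho_le r0 rt.
have h0 := ltW (inv_rho_gt0 t); have h1 := ltW (inv_rho_gt0 r).
apply: ler_pM; rewrite ?sqrtr_ge0 ?exprn_ge0//; first by rewrite lerXn2r.
by rewrite ler_wsqrtr// lerD2l ler_wpM2l// lerXn2r.
Qed.

Lemma radial_density_slow r a : 0 <= r -> 0 <= a -> radial_density r <= (1 + a) ^+ k.+2 * radial_density (r + a).
Proof.
move=> r0 a0; have h := inv_rho_slow r0 a0.
have h0 := ltW (inv_rho_gt0 (r + a)); have h1 := ltW (inv_rho_gt0 r).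
have a1 : 0 <= 1 + a by rewrite addr_ge0.
rewrite [X in X * _]exprSr /radial_density mulrACA -exprMn.
apply: ler_pM; rewrite ?sqrtr_ge0 ?exprn_ge0//; first by rewrite lerXn2r ?nnegrE ?mulr_ge0.
rewrite -[X in X * Num.sqrt _]ger0_norm// -sqrtr_sqr -sqrtrM ?sqr_ge0// ler_wsqrtr//.
have : inv_rho r ^+ 2 <= ((1 + a) * inv_rho (r + a)) ^+ 2 by rewrite lerXn2r ?nnegrE ?mulr_ge0.
rewrite exprMn; set x := inv_rho r ^+ 2; set y := inv_rho (r + a) ^+ 2 => xy.
have : c * x <= c * ((1 + a) ^+ 2 * y) by rewrite ler_wpM2l.
nra.
Qed.

Lemma cont_angular : continuous angular.
Proof.
move=> x; apply: cvgM; last exact: continuous_sinX.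
apply: (@continuous_comp _ _ _ (fun t : R => 1 + c * cos t ^+ 2) Num.sqrt); last exact: sqrt_continuous.
apply: cvgD; first exact: cvg_cst.
apply: cvgM; first exact: cvg_cst.
by apply: (@continuous_comp _ _ _ (@cos R) (fun y => y ^+ 2));
  [exact: continuous_cos | exact: exprn_continuous].
Qed.

Lemma angular_ge0 x : 0 <= x <= pi -> 0 <= angular x.
Proof. by move=> xpi; rewrite mulr_ge0 ?sqrtr_ge0// exprn_ge0// sin_ge0_pi. Qed.

Lemma sin_atan r : sin (atan r) = r * inv_rho r.
Proof.
by rewrite /inv_rho -cos_atan -{2}[r]atanK /tan mulfVK// cos_atan gt_eqF// inv_rho_gt0.
Qed.

(** By the substitution [r = tan t] the primitive is [k] times the integral
    of [angular] from [0] to [atan r]; its increments are bounded by the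
    mean value theorem applied to [Phi r - C r ^ k], with [C] an extreme
    value of the density. *)
Lemma radial_primitive : exists Phi : R -> R,
  [/\ radial k radial_density Phi,
      forall r : R, 0 <= r -> Phi r <= k%:R * angular_mass,
      Phi r @[r --> +oo] --> k%:R * angular_mass &
      (forall r t : R, 0 <= r -> r <= t -> Phi r <= Phi t)].
Proof.
have [P dP] := @antiderivative R _ (-1) 5 cont_angular.
have pi4 : pi < 4 :> R by have := @pihalf_lt2 R; lra.
have pi1 := @pihalf_ge1 R.
have mass : angular_mass = P (pi / 2) - P 0.
  apply: Rftc; first lra; first by move=> x _; exact: cont_angular.
  by move=> x ?; apply: dP; lra.
pose Phi (r : R) := k%:R * (P (atan r) - P 0).
have at0 (r : R) : 0 <= r -> 0 <= atan r < pi / 2.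
  by move=> r0; rewrite atan_ltpi2 andbT -(@atan0 R) le_atan.
have dPhi (r : R) : 0 <= r -> is_derive r 1 Phi (k%:R * (radial_density r * r ^+ k.-1)).
  move=> r0; have aI := at0 r r0.
  have d1 := der_comp (is_derive1_atan r) (dP (atan r) (ltac:(lra))).
  have d2 := derM (der_cst k%:R r) (derB d1 (der_cst (P 0) r)).
  apply: (is_derive_eq d2); rewrite mul0r add0r subr0; congr (_ * _).
  rewrite /angular cos_atan -/(inv_rho r) sin_atan -inv_rho_sqr /radial_density.
  by case: k k0 => // k' _ /=; rewrite exprMn !exprS; ring.
have dpow (r : R) : is_derive r 1 (fun x : R => x ^+ k) (k%:R * r ^+ k.-1).
  by apply: (is_derive_eq (derX k (der_id r))); rewrite mulr1.
have mono (a b : R) : 0 <= a -> a <= b ->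
    radial_density b * (b ^+ k - a ^+ k) <= Phi b - Phi a <= radial_density a * (b ^+ k - a ^+ k).
  move=> a0; rewrite le_eqVlt => /orP[/eqP<-|ab].
    by rewrite !subrr !mulr0 lexx.
  have [x xab|x /andP[ax xb] e1] := @mean_value R (fun r => Phi r - radial_density b * r ^+ k)
    (fun r => k%:R * (radial_density r * r ^+ k.-1) - (0 * r ^+ k + radial_density b * (k%:R * r ^+ k.-1))) a b ab.
    by apply: derB; [apply: dPhi; lra | exact: (derM (der_cst _ _) (dpow x))].
  have [y yab|y /andP[ay yb] e2] := @mean_value R (fun r => Phi r - radial_density a * r ^+ k)
    (fun r => k%:R * (radial_density r * r ^+ k.-1) - (0 * r ^+ k + radial_density a * (k%:R * r ^+ k.-1))) a b ab.
    by apply: derB; [apply: dPhi; lra | exact: (derM (der_cst _ _) (dpow y))].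
  have x1 : 0 <= x ^+ k.-1 by rewrite exprn_ge0; lra.
  have y1 : 0 <= y ^+ k.-1 by rewrite exprn_ge0; lra.
  have h1 : radial_density b <= radial_density x by apply: radial_density_le; lra.
  have h2 : radial_density y <= radial_density a by apply: radial_density_le; lra.
  have kp : 0 <= k%:R :> R by [].
  have f1 : 0 <= k%:R * (radial_density x * x ^+ k.-1) - (0 * x ^+ k + radial_density b * (k%:R * x ^+ k.-1)).
    have : 0 <= k%:R * ((radial_density x - radial_density b) * x ^+ k.-1) by rewrite !mulr_ge0// subr_ge0.
    lra.
  have f2 : 0 <= - (k%:R * (radial_density y * y ^+ k.-1) - (0 * y ^+ k + radial_density a * (k%:R * y ^+ k.-1))).
    have : 0 <= k%:R * ((radial_density a - radial_density y) * y ^+ k.-1) by rewrite !mulr_ge0// subr_ge0.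
    lra.
  have ba : 0 <= b - a by lra.
  have := mulr_ge0 f1 ba; rewrite -e1 => m1.
  have := mulr_ge0 f2 ba; rewrite mulNr -e2 => m2.
  by apply/andP; split; lra.
exists Phi; split.
- split => //; [by move=> r _; exact: radial_density_ge0 | exact: radial_density_le |].
  by rewrite /Phi atan0 subrr mulr0.
- move=> r r0; rewrite mass; apply: ler_wpM2l => //; rewrite lerD2r.
  have aI := at0 r r0.
  have [|x xI|x xI e] := @mean_value R P angular (atan r) (pi / 2); first lra.
    by apply: dP; lra.
  have : 0 <= angular x * (pi / 2 - atan r).
    by rewrite mulr_ge0 ?angular_ge0//; lra.
  by rewrite -e; lra.
- rewrite mass; apply: cvgM; first exact: cvg_cst.
  apply: cvgB; last exact: cvg_cst.
  apply: (cvg_comp _ _ (@cvgy_atan R)).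
  by apply: (is_derive_cts (dP _ _)); lra.
- move=> r t r0 rt; have /andP[h _] := mono r t r0 rt.
  rewrite -subr_ge0; apply: le_trans h.
  by rewrite mulr_ge0 ?radial_density_ge0// subr_ge0 lerXn2r ?nnegrE//; lra.
Qed.

(** The integral over R^k of the radial density, in polar coordinates. *)
Definition total_mass : R := @ball_const R k 1 * (k%:R * angular_mass).

Lemma total_mass_ge0 : 0 <= total_mass.
Proof.
apply: mulr_ge0; first exact: ltW (ball_const_gt0 _ _).
apply: mulr_ge0 => //; apply: Rintegral_ge0 => x.
by rewrite /= in_itv/= => xI; apply: angular_ge0; have := @pi_gt0 R; lra.
Qed.

Lemma radial_scale (Phi : R -> R) (s : R) : 0 < s -> radial k radial_density Phi ->
  radial k (fun r => radial_density (r / s)) (fun r => s ^+ k * Phi (r / s)).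
Proof.
move=> s0 [h1 h2 h3 h4]; split.
- by move=> r r0; apply: h1; rewrite divr_ge0// ltW.
- by move=> r t r0 rt; apply: h2; rewrite ?divr_ge0 ?(ltW s0)// ler_pM2r ?invr_gt0.
- by rewrite mul0r h3 mulr0.
- move=> a b a0 ab; rewrite -mulrBr.
  have -> : b ^+ k - a ^+ k = s ^+ k * ((b / s) ^+ k - (a / s) ^+ k).
    by rewrite mulrBr -!exprMn !(mulrC s) !divfK// gt_eqF.
  rewrite !(mulrCA _ (s ^+ k)) !ler_pM2l ?exprn_gt0//.
  by apply: h4; rewrite ?divr_ge0 ?(ltW s0)// ler_pM2r ?invr_gt0.
Qed.

Lemma scale_slow (d s : R) : 0 < d -> 0 < s -> forall r, 0 <= r ->
  radial_density (r / s) <= (1 + k.+1%:R * (d / s)) ^+ k.+2 * radial_density ((r + k.+1%:R * d) / s).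
Proof.
move=> d0 s0 r r0; have -> : (r + k.+1%:R * d) / s = r / s + k.+1%:R * (d / s) by ring.
apply: radial_density_slow; first by rewrite divr_ge0// ltW.
by rewrite mulr_ge0// divr_ge0// ltW.
Qed.

(** The bound of [quadrature_le] for the density scaled to height [s] is a
    continuous function [E] of [d / s] with value [total_mass] at [0]. *)
Lemma quad_sum_le (e : R) : 0 < e -> exists2 th : R, 0 < th &
  forall (d s : R) N (z : 'rV[R]_k), 0 < d -> 0 < s -> d <= th * s ->
  (d / s) ^+ k * \sum_(q <- grid d N k) radial_density (enorm (q - z) / s) <= total_mass + e.
Proof.
move=> e0; have [Phi [rad Phile _ _]] := radial_primitive.
pose E (x : R) : R := @ball_const R k 1 * ((1 + k.+1%:R * x) ^+ k.+2 * (k%:R * angular_mass) + radial_density 0 * (k%:R * x) ^+ k).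
have E0 : E 0 = total_mass.
  by rewrite /E !mulr0 addr0 expr1n mul1r expr0n gtn_eqF// mulr0 addr0.
have cE : {for 0, continuous E}.
  have dx := der_id (0 : R).
  have d1 := derX k.+2 (derD (der_cst 1 0) (derM (der_cst k.+1%:R 0) dx)).
  have d2 := derX k (derM (der_cst k%:R 0) dx).
  exact: is_derive_cts (derM (der_cst _ _) (derD (derM d1 (der_cst _ _)) (derM (der_cst _ _) d2))).
have [|th th0 hth] := continuous_lt_ball (b := total_mass + e) cE.
  by rewrite E0 ltrDl.
exists (th / 2); first by rewrite divr_gt0.
move=> d s N z d0 s0 ds.
have x0 : 0 < d / s by rewrite divr_gt0.
have xth : d / s < th.
  by rewrite ltr_pdivrMr//; apply: le_lt_trans ds _; rewrite ltr_pM2r// ltr_pdivrMr//; lra.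
have := hth (d / s); rewrite subr0 gtr0_norm// => /(_ xth) /ltW; apply: le_trans.
have := @quadrature_le R d N k z (fun r => radial_density (r / s)) (fun r => s ^+ k * Phi (r / s))
  ((1 + k.+1%:R * (d / s)) ^+ k.+2) (s ^+ k * (k%:R * angular_mass)) d0 (radial_scale s0 rad).
have L0 : 0 <= (1 + k.+1%:R * (d / s)) ^+ k.+2.
  by rewrite exprn_ge0// addr_ge0// mulr_ge0// ltW.
move=> /(_ L0 (scale_slow d0 s0)) h.
have Ple r : 0 <= r -> s ^+ k * Phi (r / s) <= s ^+ k * (k%:R * angular_mass).
  by move=> r0; rewrite ler_pM2l ?exprn_gt0//; apply: Phile; rewrite divr_ge0// ltW.
rewrite expr_div_n mulrAC ler_pdivrMr ?exprn_gt0//.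
apply: le_trans (h Ple) _.
rewrite /E mul0r le_eqVlt; apply/orP; left; apply/eqP.
have -> : k%:R * (d / s) = (k%:R * d) / s by rewrite mulrA.
rewrite expr_div_n; field; by rewrite gt_eqF ?expf_neq0 ?gt_eqF// exprn_gt0.
Qed.

(** Points beyond [Lam * s] carry less than [e / 2] of the mass when [Lam]
    is large; the points within are summed by [quadrature_ge], with [Lam -
    1] leaving room for the shrinking of the balls. *)
Lemma quad_sum_ge (e : R) : 0 < e -> exists th Lam : R, [/\ 0 < th, 0 < Lam &
  forall (d s : R) N (z : 'rV[R]_k), 0 < d -> 0 < s -> d <= th * s ->
  enorm z + Lam * s <= d * N%:R ->
  total_mass - e <= (d / s) ^+ k *
    \sum_(q <- grid d N k) (enorm (q - z) < Lam * s)%R%:R * radial_density (enorm (q - z) / s)].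
Proof.
move=> e0; have [Phi [rad Phile Phicvg Phimono]] := radial_primitive.
have B0 := @ball_const_gt0 R k 1.
have [Lam Lam1 hL] : exists2 Lam : R, 1 < Lam & total_mass - e / 2 <= @ball_const R k 1 * Phi (Lam - 1).
  have : k%:R * angular_mass - e / 2 / @ball_const R k 1 < k%:R * angular_mass.
    by rewrite ltrBlDr ltrDl !divr_gt0.
  move=> /(cvgr_gt _ Phicvg) [M [_ hM]].
  exists (Num.max M 1 + 2); first by rewrite (@lt_le_trans _ _ (1 + 2)) ?ltrDl// lerD2r le_max lexx orbT.
  have Mm : M < Num.max M 1 + 2 - 1.
    by have : M <= Num.max M 1 by [rewrite le_max lexx]; lra.
  have {hM Mm} := ltW (hM _ Mm).
  rewrite -(ler_pM2l B0); apply: le_trans.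
  rewrite le_eqVlt; apply/orP; left; apply/eqP; rewrite /total_mass.
  by field; rewrite gt_eqF.
(* a sum above [T] is large enough; below [T], the loss due to the factor
   [L] of [quadrature_ge] is at most [T * (L - 1)], a continuous function
   of [d / s] that vanishes at [0] *)
pose T := total_mass + 1.
have T0 : 0 < T by have := total_mass_ge0; rewrite /T; lra.
have dx := der_id (0 : R).
have d1 := derX k.+2 (derD (der_cst 1 0) (derM (der_cst k.+1%:R 0) dx)).
have /= c1 := is_derive_cts (derM (der_cst T 0) (derB d1 (der_cst 1 _))).
have [|th th0 hth] := continuous_lt_ball (b := e / 2) c1.
  by rewrite mulr0 addr0 expr1n subrr mulr0 divr_gt0.
exists (Num.min (th / 2) (k.+1%:R^-1)), Lam; split; first 2 last.
- move=> d s N z d0 s0 ds zN.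
  have x0 : 0 < d / s by rewrite divr_gt0.
  have xm : d / s <= Num.min (th / 2) (k.+1%:R^-1) by rewrite ler_pdivrMr.
  have xth : d / s < th by move: xm; rewrite le_min => /andP[h _]; lra.
  have xk : k.+1%:R * (d / s) <= 1.
    by move: xm; rewrite le_min => /andP[_ h]; rewrite mulrC -ler_pdivlMr// div1r.
  pose m := Num.truncn (Lam * s / d).
  have Ls0 : 0 <= Lam * s / d by rewrite divr_ge0 ?mulr_ge0//; lra.
  have /andP[m1 m2] : m%:R <= Lam * s / d < m.+1%:R by exact: truncn_itv.
  have md : m%:R * d <= Lam * s by rewrite -ler_pdivlMr.
  have md2 : Lam * s < m%:R * d + d.
    by move: m2; rewrite ltr_pdivrMr// -natr1 mulrDl mul1r.
  have L0 : 0 <= (1 + k.+1%:R * (d / s)) ^+ k.+2.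
    by rewrite exprn_ge0// addr_ge0// mulr_ge0// ltW.
  have L1 : 1 <= (1 + k.+1%:R * (d / s)) ^+ k.+2.
    by apply: exprn_ege1; rewrite lerDl mulr_ge0// ltW.
  have zm : enorm z + m%:R * d <= d * N%:R by lra.
  have := @quadrature_ge R d N k z (fun r => radial_density (r / s)) (fun r => s ^+ k * Phi (r / s))
    ((1 + k.+1%:R * (d / s)) ^+ k.+2) m d0 k0 (radial_scale s0 rad) L0 (scale_slow d0 s0) zm.
  set S := \sum_(q <- _) _ => h.
  set S' := \sum_(q <- _) _.
  have SS' : S <= S'.
    apply: ler_sum => q _; rewrite ler_wpM2r ?radial_density_ge0//.
    case: ltP => //= h1; first by rewrite (lt_le_trans h1 md).
  have {}h : @ball_const R k 1 * Phi (Lam - 1) <= (1 + k.+1%:R * (d / s)) ^+ k.+2 * ((d / s) ^+ k * S').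
    rewrite -(ler_pM2l (exprn_gt0 k s0)).
    apply: (@le_trans _ _ (@ball_const R k 1 * (s ^+ k * Phi (Num.max 0 (m%:R * d - k%:R * d) / s)))).
      rewrite mulrCA ler_pM2l// ler_pM2l ?exprn_gt0//; apply: Phimono; first lra.
      rewrite ler_pdivlMr// le_max; apply/orP; right.
      have : k.+1%:R * d <= s by move: xk; rewrite mulrA ler_pdivrMr// mul1r.
      by rewrite -natr1; lra.
    apply: le_trans h _.
    rewrite (_ : s ^+ k * _ = (1 + k.+1%:R * (d / s)) ^+ k.+2 * (d ^+ k * S')).
      by rewrite ler_wpM2l// ler_wpM2l// exprn_ge0// ltW.
    rewrite mulrCA; congr (_ * _).
    by rewrite mulrA -exprMn mulrC [s * _]mulrC divfK ?gt_eqF// mulrC.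
  have S0 : 0 <= (d / s) ^+ k * S'.
    rewrite mulr_ge0 ?exprn_ge0 ?(ltW x0)//; apply: sumr_ge0 => q _.
    by rewrite mulr_ge0 ?radial_density_ge0.
  have := hth (d / s); rewrite subr0 gtr0_norm// => /(_ xth).
  move: h hL L1 S0; set A := _ * Phi _; set L := _ ^+ k.+2; set X := _ * S'.
  move=> h hL L1 S0 hT.
  have [XT|XT] := leP X T; last by move: XT; rewrite /T; lra.
  have : X * (L - 1) <= T * (L - 1) by rewrite ler_wpM2r//; lra.
  lra.
- by rewrite lt_min divr_gt0//= invr_gt0 ltr0n.
- lra.
Qed.

End radial_profiles.

(** * Second derivatives along lines *)

Section second_derivatives.
Context {R : realType}.
Variable n : nat.
Implicit Types (f : 'rV[R]_n -> R) (y v : 'rV[R]_n).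

Lemma line_derive f y v (s a : R) : is_derive (y + s *: v) v f a ->
  is_derive s 1 (fun s : R => f (y + s *: v)) a.
Proof.
have E : (fun h : R => h^-1 *: (((fun s => f (y + s *: v)) \o shift s) (h *: (1 : R)) - f (y + s *: v)))
  = (fun h : R => h^-1 *: ((f \o shift (y + s *: v)) (h *: v) - f (y + s *: v))).
  apply/funext => h /=.
  by rewrite [h *: 1]mulr1 scalerDl addrCA.
by case=> df <-; apply: DeriveDef; rewrite /derivable /derive E.
Qed.

(** Second derivatives are taken along lines because maxima are tested line
    by line, and because the restrictions of the kernel and of the barrier
    to lines are explicit functions of one variable. *)
Definition second_derive f y v (a : R) : Prop :=
  exists d : R -> R, exists r : R, [/\ 0 < r,
    forall s : R, `|s| < r -> is_derive s 1 (fun s => f (y + s *: v)) (d s) &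
    is_derive (0 : R) 1 d a].

Lemma second_deriveD f g y v a b : second_derive f y v a ->
  second_derive g y v b -> second_derive (fun x => f x + g x) y v (a + b).
Proof.
move=> [d [r [r0 hd da]]] [e [t [t0 he eb]]].
exists (fun s => d s + e s), (Num.min r t); split; first by rewrite lt_min r0.
  by move=> s; rewrite lt_min => /andP[sr st]; exact: (derD (hd s sr) (he s st)).
exact: derD.
Qed.

Lemma second_deriveZ c f y v a : second_derive f y v a ->
  second_derive (fun x => c * f x) y v (c * a).
Proof.
move=> [d [r [r0 hd da]]]; exists (fun s => c * d s), r; split => //.
  move=> s sr; apply: (is_derive_eq (derM (der_cst c s) (hd s sr))).
  by rewrite mul0r add0r.
by apply: (is_derive_eq (derM (der_cst c _) da)); rewrite mul0r add0r.
Qed.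

Lemma second_derive_cst c y v : second_derive (fun=> c) y v 0.
Proof.
exists (fun=> 0), 1; split => //; first by move=> s _; exact: der_cst.
exact: der_cst.
Qed.

Lemma second_derive_sum (I : Type) (r : seq I) (F : I -> 'rV[R]_n -> R)
    (a : I -> R) y v : (forall i, second_derive (F i) y v (a i)) ->
  second_derive (fun x => \sum_(i <- r) F i x) y v (\sum_(i <- r) a i).
Proof.
move=> h; elim: r => [|i r IH].
  rewrite big_nil (_ : (fun x => _) = fun=> 0); first exact: second_derive_cst.
  by apply/funext => x; rewrite big_nil.
rewrite big_cons (_ : (fun x => _) = fun x => F i x + \sum_(i <- r) F i x).
  exact: second_deriveD.
by apply/funext => x; rewrite big_cons.
Qed.

(** The first derivative [d] vanishes at the maximum; if its own derivative
    were positive, [f] would increase on one side. *)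
Lemma second_derive_max f y v a (r : R) : second_derive f y v a -> 0 < r ->
  (forall s : R, `|s| < r -> f (y + s *: v) <= f y) -> a <= 0.
Proof.
move=> [d [r' [r'0 hd da]]] r0 fmax; rewrite leNgt; apply/negP => a0.
pose t := Num.min r r'; have t0 : 0 < t by rewrite lt_min r0.
have d0 : d 0 = 0.
  have h0 : is_derive (0 : R) 1 (fun s => f (y + s *: v)) (d 0) by apply: hd; rewrite normr0.
  have h1 : is_derive (0 : R) 1 (fun s => f (y + s *: v)) 0.
    apply: (@derive1_at_max R (fun s => f (y + s *: v)) (- t) t 0).
    - by rewrite ge0_cp// ltW.
    - move=> s; rewrite in_itv/= -ltr_norml lt_min => /andP[_ sr].
      by have [] := hd s sr.
    - by rewrite in_itv/= oppr_lt0 t0.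
    - move=> s; rewrite in_itv/= -ltr_norml lt_min => /andP[sr _].
      by rewrite scale0r addr0 fmax.
  by rewrite -(@derive_val _ _ _ _ _ _ _ h0) (@derive_val _ _ _ _ _ _ _ h1).
have [e e0 he] : exists2 e : R, 0 < e & forall s : R, 0 < s < e -> 0 < d s.
  case: da => dd da.
  have : (fun h : R => h^-1 *: ((d \o shift 0) (h *: (1 : R)) - d 0)) x @[x --> 0^'] --> a.
    by rewrite -da; exact: dd.
  move=> /cvgr_gt/(_ 0 a0) [e /= e0 he]; exists e => // s /andP[s0 se].
  have := he s; rewrite /ball/= sub0r normrN gtr0_norm// => /(_ se).
  rewrite gt_eqF// => /(_ isT).
  by rewrite /= d0 subr0 addr0 [s *: 1]mulr1 /GRing.scale/= pmulr_rgt0// invr_gt0.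
pose s := Num.min t e / 2.
have m0 : 0 < Num.min t e by rewrite lt_min t0.
have s0 : 0 < s by rewrite divr_gt0.
have st : s < t by have : Num.min t e <= t by [rewrite ge_min lexx]; rewrite /s; lra.
have se : s < e by have : Num.min t e <= e by [rewrite ge_min lexx orbT]; rewrite /s; lra.
have [|x xs xe] := @mean_value R (fun s => f (y + s *: v)) d 0 s s0.
  move=> x xs; apply: hd; rewrite ger0_norm; last lra.
  by move: st; rewrite /t lt_min => /andP[_]; lra.
have : f (y + s *: v) <= f y.
  by apply: fmax; rewrite gtr0_norm//; move: st; rewrite /t lt_min => /andP[].
have : 0 < d x * (s - 0) by rewrite mulr_gt0 ?subr0// he//; lra.
rewrite -xe scale0r addr0; lra.
Qed.

End second_derivatives.

(** * The Poisson kernel and the barrier of a half-space *)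

Section kernels.
Context {R : realType}.

(** On the line [w + s *: delta_mx ord0 i] the squared norm is [quad B b s]
    with [B = sqnorm w] and [b] the [i]-th coordinate of [w], and the inner
    product with [nu] is [A + s * al] with [A = dot w nu] and [al] the
    [i]-th coordinate of [nu]. The calculus of the kernel and of the
    barrier is done in terms of these four numbers. *)
Definition quad (B b s : R) : R := B + 2 * b * s + s ^+ 2.
Definition iroot (B b s : R) : R := (Num.sqrt (quad B b s))^-1.

Lemma quad_derive (B b s : R) : is_derive s 1 (quad B b) (2 * (b + s)).
Proof.
have d := derD (derD (der_cst B s) (derM (der_cst (2 * b) s) (der_id s))) (derX 2 (der_id s)).
by apply: (is_derive_eq d); rewrite /=; ring.
Qed.

Lemma iroot_gt0 (B b s : R) : 0 < quad B b s -> 0 < iroot B b s.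
Proof. by move=> q0; rewrite invr_gt0 sqrtr_gt0. Qed.

Lemma iroot_sqr (B b s : R) : 0 < quad B b s -> iroot B b s ^+ 2 * quad B b s = 1.
Proof. by move=> q0; rewrite exprVn sqr_sqrtr ?ltW// mulVf// gt_eqF. Qed.

Lemma iroot_derive (B b s : R) : 0 < quad B b s ->
  is_derive s 1 (iroot B b) (- (b + s) * iroot B b s ^+ 3).
Proof.
move=> q0; have s0 : 0 < Num.sqrt (quad B b s) by rewrite sqrtr_gt0.
have d1 := der_comp (quad_derive B b s) (is_derive1_sqrt q0).
have d2 := @derV _ (fun x => Num.sqrt (quad B b x)) s _ (lt0r_neq0 s0) d1.
by apply: (is_derive_eq d2); rewrite /iroot; field; rewrite gt_eqF.
Qed.

Lemma quad_gt0_near (B b : R) : 0 < B ->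
  exists2 r : R, 0 < r & forall s : R, `|s| < r -> 0 < quad B b s.
Proof.
move=> B0; have c := is_derive_cts (derN (quad_derive B b 0)).
have [|r r0 h] := continuous_lt_ball (b := 0) c.
  by rewrite /quad mulr0 expr0n !addr0 oppr_lt0.
by exists r => // s sr; rewrite -oppr_lt0; apply: h; rewrite subr0.
Qed.

Section kernel_on_a_line.
Variables (n : nat) (A al B b : R).
Local Notation i_ := (iroot B b).

Definition kline (s : R) : R := (A + s * al) * i_ s ^+ n.
Definition kline1 (s : R) : R :=
  al * i_ s ^+ n - n%:R * (A + s * al) * (b + s) * i_ s ^+ n.+2.
Definition kline2 (s : R) : R :=
  - 2 * n%:R * al * (b + s) * i_ s ^+ n.+2 - n%:R * (A + s * al) * i_ s ^+ n.+2
  + n%:R * n.+2%:R * (A + s * al) * (b + s) ^+ 2 * i_ s ^+ n.+4.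

Lemma ilin_derive (s : R) : is_derive s 1 (fun s : R => A + s * al) al.
Proof.
apply: (is_derive_eq (derD (der_cst A s) (derM (der_id s) (der_cst al s)))).
by rewrite mulr0 mul1r add0r addr0.
Qed.

Lemma ipow_derive m (s : R) : 0 < quad B b s ->
  is_derive s 1 (fun s => i_ s ^+ m) (- m%:R * (b + s) * i_ s ^+ m.+2).
Proof.
move=> q0; apply: (is_derive_eq (derX m (iroot_derive q0))).
case: m => [|m]; first by rewrite !mul0r oppr0 !mul0r.
by rewrite /= !exprS; ring.
Qed.

Lemma kline_derive s : 0 < quad B b s -> is_derive s 1 kline (kline1 s).
Proof.
move=> q0; apply: (is_derive_eq (derM (ilin_derive s) (ipow_derive n q0))).
by rewrite /kline1; ring.
Qed.

Lemma kline1_derive s : 0 < quad B b s -> is_derive s 1 kline1 (kline2 s).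
Proof.
move=> q0.
have db := derD (der_cst b s) (der_id s).
have d1 := derM (der_cst al s) (ipow_derive n q0).
have d2 := derM (derM (derM (der_cst n%:R s) (ilin_derive s)) db) (ipow_derive n.+2 q0).
by apply: (is_derive_eq (derB d1 d2)); rewrite /kline2; ring.
Qed.

(** Up to the factor [|w| ^ - (n + 1)], the second derivative is a
    polynomial in [al] and in the quotients [x], [y] of [A + s * al] and [b
    + s] by [|w|], all of absolute value at most [1]. *)
Lemma kline2_bound s : 0 < quad B b s -> `|al| <= 1 ->
  (A + s * al) ^+ 2 <= quad B b s -> (b + s) ^+ 2 <= quad B b s ->
  `|kline2 s| <= (n%:R * (n%:R + 5)) * i_ s ^+ n.+1.
Proof.
move=> q0 al1 A1 b1.
have i0 := iroot_gt0 q0; have i2 := iroot_sqr q0.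
pose x := (A + s * al) * i_ s; pose y := (b + s) * i_ s.
have norm1 (t : R) : t ^+ 2 <= quad B b s -> `|t * i_ s| <= 1.
  move=> h; rewrite -(@ler_pXn2r _ 2)// ?nnegrE// expr1n real_normK ?num_real//.
  by rewrite exprMn -i2 mulrC ler_pM2l// exprn_gt0.
have x1 : `|x| <= 1 by exact: norm1.
have y1 : `|y| <= 1 by exact: norm1.
have -> : kline2 s = (- 2 * n%:R * al * y - n%:R * x + n%:R * n.+2%:R * x * y ^+ 2) * i_ s ^+ n.+1.
  by rewrite /kline2 /x /y !exprS; ring.
rewrite normrM [X in _ * X <= _]ger0_norm ?exprn_ge0 ?(ltW i0)//.
rewrite ler_wpM2r ?exprn_ge0 ?(ltW i0)//.
have ay : `|al * y| <= 1 by rewrite normrM -[leRHS]mulr1 ler_pM.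
have y2 : `|x * y ^+ 2| <= 1.
  by rewrite normrM normrX -[leRHS]mulr1 ler_pM ?exprn_ge0// exprn_ile1.
have n0 : 0 <= n%:R :> R by [].
have -> : - 2 * n%:R * al * y - n%:R * x + n%:R * n.+2%:R * x * y ^+ 2 =
  n%:R * (- 2 * (al * y) - x + n.+2%:R * (x * y ^+ 2)) by ring.
rewrite normrM ger0_norm// ler_wpM2l//.
have n2 : 0 <= n.+2%:R :> R by [].
apply: le_trans (ler_normD _ _) _.
have : `|- 2 * (al * y) - x| <= 3.
  apply: le_trans (ler_normB _ _) _; rewrite normrM normrN normr_nat; lra.
have : `|n.+2%:R * (x * y ^+ 2)| <= n.+2%:R.
  by rewrite normrM normr_nat -[leRHS]mulr1 ler_wpM2l.
have -> : n.+2%:R = n%:R + 2 :> R by rewrite -addn2 natrD.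
lra.
Qed.

End kernel_on_a_line.

Section kernel.
Variables (n : nat) (nu : 'rV[R]_n).
Hypothesis nu1 : sqnorm nu = 1.

(** Up to a constant, the Poisson kernel, with pole at the origin, of the
    half-space with inner normal [nu]. *)
Definition poisson_kernel (w : 'rV[R]_n) : R := dot w nu * (enorm w)^-1 ^+ n.

Definition kernel_grad (w : 'rV[R]_n) : 'rV[R]_n :=
  (enorm w)^-1 ^+ n *: nu - (n%:R * dot w nu * (enorm w)^-1 ^+ n.+2) *: w.

Lemma dot_delta (w : 'rV[R]_n) i : dot (delta_mx ord0 i) w = w ord0 i.
Proof.
rewrite /dot (bigD1 i)//= mxE !eqxx mul1r big1 ?addr0// => j ji.
by rewrite mxE eqxx (negbTE ji) mul0r.
Qed.

Lemma dot_line (w : 'rV[R]_n) i s :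
  dot (w + s *: delta_mx ord0 i) nu = dot w nu + s * nu ord0 i.
Proof. by rewrite dotDl dotZl dot_delta. Qed.

Lemma kernel_line (w : 'rV[R]_n) i s : poisson_kernel (w + s *: delta_mx ord0 i) =
  kline n (dot w nu) (nu ord0 i) (sqnorm w) (w ord0 i) s.
Proof.
by rewrite /poisson_kernel /kline dot_line /iroot /quad -sqnorm_line /enorm.
Qed.

Lemma iroot0 (w : 'rV[R]_n) i : iroot (sqnorm w) (w ord0 i) 0 = (enorm w)^-1.
Proof. by rewrite /iroot /quad mulr0 expr0n !addr0. Qed.

Lemma kernel_second_derive (p y : 'rV[R]_n) i : 0 < sqnorm (y - p) ->
  second_derive (fun y => poisson_kernel (y - p)) y (delta_mx ord0 i)
   (kline2 n (dot (y - p) nu) (nu ord0 i) (sqnorm (y - p)) ((y - p) ord0 i) 0).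
Proof.
move=> w0; have [r r0 hr] := quad_gt0_near ((y - p) ord0 i) w0.
exists (kline1 n (dot (y - p) nu) (nu ord0 i) (sqnorm (y - p)) ((y - p) ord0 i)), r.
split => //; last by apply: kline1_derive; apply: hr; rewrite normr0.
move=> s /hr q0; have := @kline_derive n (dot (y - p) nu) (nu ord0 i) _ _ _ q0.
congr (is_derive _ _ _ _); apply/funext => t.
by rewrite addrAC kernel_line.
Qed.

(** The three terms of [kline2] sum to the multiples [- 2 n], [- n^2] and
    [n (n + 2)] of the same quantity. *)
Lemma kernel_laplacian (w : 'rV[R]_n) : 0 < sqnorm w ->
  \sum_(i < n) kline2 n (dot w nu) (nu ord0 i) (sqnorm w) (w ord0 i) 0 = 0.
Proof.
move=> w0; set I := (enorm w)^-1; set A := dot w nu.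
have I2 : I ^+ 2 * sqnorm w = 1 by rewrite exprVn enorm_sqr mulVf// gt_eqF.
under eq_bigr => i _.
  rewrite /kline2 iroot0 -/I mul0r !addr0.
  rewrite (_ : _ + _ = (- 2 * n%:R * I ^+ n.+2) * (w ord0 i * nu ord0 i)
     - n%:R * A * I ^+ n.+2 + n%:R * n.+2%:R * A * I ^+ n.+4 * w ord0 i ^+ 2); last ring.
  over.
rewrite big_split/= sumrB/= sumr_const card_ord -!mulr_sumr -/(dot w nu) -/A -/(sqnorm w).
rewrite -[(n%:R * A * I ^+ n.+2) *+ n]mulr_natl.
have -> : I ^+ n.+4 = I ^+ n.+2 * I ^+ 2 by rewrite -exprD addn2.
rewrite (_ : n.+2%:R = n%:R + 2); last by rewrite -addn2 natrD.
have -> : n%:R * (n%:R + 2) * A * (I ^+ n.+2 * I ^+ 2) * sqnorm w =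
  n%:R * (n%:R + 2) * A * I ^+ n.+2 * (I ^+ 2 * sqnorm w) by ring.
by rewrite I2; ring.
Qed.

Lemma kernel_grad_coord (w : 'rV[R]_n) i : kernel_grad w ord0 i =
  kline1 n (dot w nu) (nu ord0 i) (sqnorm w) (w ord0 i) 0.
Proof. by rewrite /kernel_grad !mxE /kline1 iroot0 mul0r !addr0; ring. Qed.

(** The quotient [dot w nu / enorm w] is the cosine of the angle between
    [w] and [nu]; this is where the integrand of [div_const] comes from. *)
Lemma kernel_grad_norm (w : 'rV[R]_n) : 0 < sqnorm w -> enorm (kernel_grad w) =
  (enorm w)^-1 ^+ n *
  Num.sqrt (1 + n%:R * (n%:R - 2) * (dot w nu * (enorm w)^-1) ^+ 2).
Proof.
move=> w0; set I := (enorm w)^-1; set A := dot w nu.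
have I0 : 0 <= I by rewrite invr_ge0 enorm_ge0.
have I2 : I ^+ 2 * sqnorm w = 1 by rewrite exprVn enorm_sqr mulVf// gt_eqF.
have In : I ^+ n = Num.sqrt ((I ^+ n) ^+ 2) by rewrite sqrtr_sqr ger0_norm// exprn_ge0.
rewrite [in RHS]In -sqrtrM ?sqr_ge0//.
rewrite /enorm -/(sqnorm _); congr Num.sqrt.
rewrite /kernel_grad -/I -/A -scaleNr sqnormD !sqnormZ dotZl dotZr nu1 (dotC nu) -/A.
have -> : I ^+ n.+2 = I ^+ n * I ^+ 2 by rewrite -exprD addn2.
have -> : (- (n%:R * A * (I ^+ n * I ^+ 2))) ^+ 2 * sqnorm w =
  (n%:R * A * I ^+ n) ^+ 2 * I ^+ 2 * (I ^+ 2 * sqnorm w) by ring.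
by rewrite I2; ring.
Qed.

Lemma dot_nu_le (w : 'rV[R]_n) : dot w nu ^+ 2 <= sqnorm w.
Proof. by have := cauchy_schwarz w nu; rewrite nu1 mulr1. Qed.

(** Two applications of the mean value theorem. Along the segment the norm
    stays above half of [enorm w], whence the power of [2]. *)
Lemma kernel_taylor (w : 'rV[R]_n) i (t : R) : 0 < t -> 0 < enorm w ->
  2 * t <= enorm w ->
  `|poisson_kernel (w + t *: delta_mx ord0 i) - poisson_kernel w - t * kernel_grad w ord0 i| <=
  t ^+ 2 * (n%:R * (n%:R + 5) * 2 ^+ n.+1 * (enorm w)^-1 ^+ n.+1).
Proof.
move=> t0 w0 tw.
set A := dot w nu; set al := nu ord0 i; set B := sqnorm w; set b := w ord0 i.
have qE s : quad B b s = sqnorm (w + s *: delta_mx ord0 i) by rewrite sqnorm_line.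
have e1 : enorm (delta_mx ord0 i : 'rV[R]_n) = 1.
  by rewrite /enorm -/(sqnorm _) sqnormE dot_delta mxE !eqxx sqrtr1.
have big s : 0 <= s <= t -> enorm w / 2 <= enorm (w + s *: delta_mx ord0 i).
  move=> st; have := enorm_triangle (w + s *: delta_mx ord0 i) (- (s *: delta_mx ord0 i)).
  rewrite addrK enormN enormZ e1 ger0_norm; last lra.
  by lra.
have q0 s : 0 <= s <= t -> 0 < quad B b s.
  by move=> /big h; rewrite qE -enorm_sqr exprn_gt0//; lra.
have b2 s : 0 <= s <= t -> `|kline2 n A al B b s| <=
    n%:R * (n%:R + 5) * 2 ^+ n.+1 * (enorm w)^-1 ^+ n.+1.
  move=> st; apply: le_trans (kline2_bound _ (q0 s st) _ _ _) _.
  - by have := coord_le nu i; rewrite /enorm -/(sqnorm _) nu1 sqrtr1.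
  - by rewrite qE -dot_line dot_nu_le.
  - by rewrite qE; have := sqr_coord_le (w + s *: delta_mx ord0 i) i;
      rewrite !mxE !eqxx mulr1.
  - rewrite -[leRHS]mulrA ler_wpM2l ?mulr_ge0//.
    rewrite -exprMn lerXn2r ?nnegrE ?mulr_ge0 ?invr_ge0 ?enorm_ge0 ?sqrtr_ge0//.
    rewrite /iroot qE -/(enorm _) -[2]invrK -invfM lef_pV2 ?posrE.
    + by have := big s st; lra.
    + by have := big s st; lra.
    + by rewrite mulr_gt0.
have [|c ct ce] := @mean_value R (kline n A al B b) (kline1 n A al B b) 0 t t0.
  by move=> s st; apply: kline_derive; exact: q0.
have c0 : 0 < c by lra.
have [|c' ct' ce'] := @mean_value R (kline1 n A al B b) (kline2 n A al B b) 0 c c0.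
  by move=> s st; apply: kline1_derive; apply: q0; lra.
rewrite kernel_grad_coord -/A -/al -/B -/b kernel_line -/A -/al -/B -/b.
have -> : poisson_kernel w = kline n A al B b 0.
  by rewrite -kernel_line scale0r addr0.
rewrite ce subr0 mulrC -mulrBr ce' subr0 !normrM gtr0_norm// (gtr0_norm c0).
have h := b2 c' (ltac:(lra)).
have h0 : 0 <= `|kline2 n A al B b c'| by [].
rewrite expr2 -mulrA ler_pM2l// mulrC; apply: ler_pM => //; lra.
Qed.

(** This is [ln (enorm w) + (n - 1) * ln (dot w nu)]. The first term makes
    it grow at infinity; its Laplacian [(n - 2) / |w|^2] is outweighed by
    the Laplacian [- (n - 1) / (w . nu)^2] of the second term. *)
Definition barrier (w : 'rV[R]_n) : R :=
  2^-1 * ln (sqnorm w) + (n%:R - 1) * ln (dot w nu).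

Lemma barrier_second_derive (p y : 'rV[R]_n) i : 0 < dot (y - p) nu ->
  let w := y - p in
  second_derive (fun y => barrier (y - p)) y (delta_mx ord0 i)
   ((sqnorm w)^-1 - 2 * w ord0 i ^+ 2 / sqnorm w ^+ 2
     - (n%:R - 1) * nu ord0 i ^+ 2 / dot w nu ^+ 2).
Proof.
move=> A0 w; set A := dot w nu; set al := nu ord0 i; set B := sqnorm w; set b := w ord0 i.
have B0 : 0 < B by rewrite (lt_le_trans _ (dot_nu_le w))// exprn_gt0.
have [r r0 hr] := quad_gt0_near b B0.
have [|r' r'0 hr'] := continuous_lt_ball (b := 0) (is_derive_cts (derN (ilin_derive A al 0))).
  by rewrite mul0r addr0 oppr_lt0.
have {}hr' s : `|s| < r' -> 0 < A + s * al.
  by move=> sr; rewrite -oppr_lt0; apply: hr'; rewrite subr0.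
exists (fun s => 2^-1 * ((quad B b s)^-1 * (2 * (b + s))) + (n%:R - 1) * ((A + s * al)^-1 * al)), (Num.min r r').
split; first by rewrite lt_min r0.
  move=> s; rewrite lt_min => /andP[/hr q0 /hr' l0].
  have d1 := der_comp (quad_derive B b s) (is_derive1_ln q0).
  have d2 := der_comp (ilin_derive A al s) (is_derive1_ln l0).
  have d := derD (derM (der_cst 2^-1 s) d1) (derM (der_cst (n%:R - 1) s) d2).
  have := is_derive_eq d (_ : _ = 2^-1 * ((quad B b s)^-1 * (2 * (b + s))) + (n%:R - 1) * ((A + s * al)^-1 * al)).
  rewrite !mul0r !add0r => /(_ erefl).
  congr (is_derive _ _ _ _); apply/funext => t.
  by rewrite addrAC -/w /barrier sqnorm_line dot_line.
have q0 := hr 0 (ltac:(by rewrite normr0)); have l0 := hr' 0 (ltac:(by rewrite normr0)).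
have d1 := @derV _ (quad B b) 0 _ (lt0r_neq0 q0) (quad_derive B b 0).
have d2 := @derV _ (fun s => A + s * al) 0 _ (lt0r_neq0 l0) (ilin_derive A al 0).
have d3 := derM (der_cst 2 0) (derD (der_cst b 0) (der_id (0 : R))).
have d := derD (derM (der_cst 2^-1 0) (derM d1 d3)) (derM (der_cst (n%:R - 1) 0) (derM d2 (der_cst al 0))).
apply: (is_derive_eq d); rewrite /quad !mulr0 !mul0r !expr0n !addr0 !add0r.
by field; rewrite !gt_eqF.
Qed.

Lemma barrier_le (w : 'rV[R]_n) (X : R) : (0 < n)%N -> 1 <= dot w nu -> enorm w <= X ->
  barrier w <= n%:R * ln X.
Proof.
move=> n0 w1 wX.
have dw : dot w nu <= enorm w.
  apply: le_trans (ler_norm _) (le_trans (dot_le _ _) _).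
  by rewrite [enorm nu]/enorm -/(sqnorm _) nu1 sqrtr1 mulr1.
have d0 : 0 < dot w nu by exact: lt_le_trans w1.
have e0 : 0 < enorm w by exact: lt_le_trans dw.
have X0 : 0 < X by exact: lt_le_trans wX.
have l1 : ln (enorm w) <= ln X by rewrite ler_ln.
have l2 : ln (dot w nu) <= ln X by rewrite ler_ln// (le_trans dw).
rewrite /barrier -enorm_sqr expr2 lnM ?posrE//.
have : (n%:R - 1) * ln (dot w nu) <= (n%:R - 1) * ln X.
  by rewrite ler_wpM2l// subr_ge0 ler1n.
by move: l1; clear; lra.
Qed.

Lemma barrier_superharmonic (w : 'rV[R]_n) : (1 < n)%N -> 0 < dot w nu ->
  \sum_(i < n) ((sqnorm w)^-1 - 2 * w ord0 i ^+ 2 / sqnorm w ^+ 2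
     - (n%:R - 1) * nu ord0 i ^+ 2 / dot w nu ^+ 2) < 0.
Proof.
move=> n1 A0; set A := dot w nu; set B := sqnorm w.
have AB : A ^+ 2 <= B := dot_nu_le w.
have B0 : 0 < B by rewrite (lt_le_trans _ AB)// exprn_gt0.
rewrite !sumrB sumr_const card_ord.
have -> : \sum_(i < n) 2 * w ord0 i ^+ 2 / B ^+ 2 = 2 / B ^+ 2 * B.
  transitivity (2 / B ^+ 2 * \sum_(i < n) w ord0 i ^+ 2) => //.
  by rewrite mulr_sumr; apply: eq_bigr => i _; ring.
have -> : \sum_(i < n) (n%:R - 1) * nu ord0 i ^+ 2 / A ^+ 2 = (n%:R - 1) / A ^+ 2.
  rewrite -[RHS]mulr1 -nu1 mulr_sumr; apply: eq_bigr => i _; ring.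
rewrite -[B^-1 *+ n]mulr_natl.
have -> : n%:R / B - 2 / B ^+ 2 * B = (n%:R - 2) / B by field; rewrite gt_eqF.
have n2 : 2 <= n%:R :> R by rewrite ler_nat.
have h : B^-1 <= (A ^+ 2)^-1 by rewrite lef_pV2// posrE exprn_gt0.
have a0 : 0 < (A ^+ 2)^-1 by rewrite invr_gt0 exprn_gt0.
nra.
Qed.

End kernel.
End kernels.

(** * Continuity and compactness for the Euclidean norm *)

Section continuity_at_a_point.
Context {R : realType} {T : topologicalType}.
Implicit Types (f g : T -> R) (y : T).

Lemma continuousD_at f g y : {for y, continuous f} -> {for y, continuous g} ->
  {for y, continuous (fun t => f t + g t)}.
Proof. by move=> cf cg; exact: cvgD. Qed.

Lemma continuousN_at f y : {for y, continuous f} -> {for y, continuous (fun t => - f t)}.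
Proof. by move=> cf; exact: cvgN. Qed.

Lemma continuousM_at f g y : {for y, continuous f} -> {for y, continuous g} ->
  {for y, continuous (fun t => f t * g t)}.
Proof. by move=> cf cg; exact: cvgM. Qed.

Lemma continuous_cst_at (c : R) y : {for y, continuous (fun=> c)}.
Proof. exact: cvg_cst. Qed.

Lemma continuous_comp_at f (h : R -> R) y : {for y, continuous f} ->
  {for (f y), continuous h} -> {for y, continuous (fun t => h (f t))}.
Proof. by move=> cf ch; exact: (@continuous_comp _ _ _ f h). Qed.

Lemma continuous_sum_at (I : Type) (r : seq I)
    (F : I -> T -> R) (y : T) : (forall i, {for y, continuous (F i)}) ->
  {for y, continuous (fun t : T => \sum_(i <- r) F i t)}.
Proof.
move=> cF; apply: (@cvg_big R I +%R 0 xpredT _ T (nbhs y) r F (fun i => F i y)).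
  exact: add_continuous.
by move=> i _; exact: cF.
Qed.

End continuity_at_a_point.

Section topology_of_enorm.
Context {R : realType}.
Variable n : nat.
Implicit Types (x y p : 'rV[R]_n).

Lemma norm_le_enorm y : `|y| <= enorm y.
Proof.
rewrite [leLHS]mx_normrE; apply: bigmax_le; first exact: enorm_ge0.
by move=> [i j] _; rewrite (ord1 i); exact: coord_le.
Qed.

Lemma coord_cts p (i : 'I_n) y : {for y, continuous (fun y => (y - p) ord0 i)}.
Proof.
rewrite (_ : (fun y => _) = fun y : 'rV[R]_n => y ord0 i + - p ord0 i); last first.
  by apply/funext => z; rewrite !mxE.
by apply: continuousD_at; [exact: coord_continuous | exact: continuous_cst_at].
Qed.

Lemma dot_continuous p (nu : 'rV[R]_n) y : {for y, continuous (fun y => dot (y - p) nu)}.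
Proof.
apply: continuous_sum_at => i.
by apply: continuousM_at; [exact: coord_cts | exact: continuous_cst_at].
Qed.

Lemma sqnorm_continuous p y : {for y, continuous (fun y => sqnorm (y - p))}.
Proof.
apply: continuous_sum_at => i.
apply: (@continuous_comp_at _ _ _ (fun t => t ^+ 2)); first exact: coord_cts.
exact: exprn_continuous.
Qed.

Lemma enorm_continuous p y : {for y, continuous (fun y => enorm (y - p))}.
Proof.
apply: (@continuous_comp_at _ _ (fun y => sqnorm (y - p)) Num.sqrt).
  exact: sqnorm_continuous.
exact: sqrt_continuous.
Qed.

Lemma open_enorm_ball (U : set 'rV[R]_n) y : open U -> U y ->
  exists2 r : R, 0 < r & forall z, enorm (z - y) < r -> U z.
Proof.
move=> oU Uy; have /nbhs_ballP[r /= r0 hr] : nbhs y U by exact: open_nbhs_nbhs.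
exists r => // z zy; apply: hr; rewrite -ball_normE/= distrC.
exact: le_lt_trans (norm_le_enorm _) zy.
Qed.

Lemma enorm_ball_nbhs y (r : R) : 0 < r -> nbhs y [set z | enorm (z - y) < r].
Proof.
move=> r0; have := cvgr_lt _ (@enorm_continuous y y) r.
by rewrite subrr -(scale0r 0) enormZ normr0 mul0r; apply.
Qed.

Lemma compact_enorm_ball p (L : R) : compact [set y : 'rV[R]_n | enorm (y - p) <= L].
Proof.
apply: bounded_closed_compact.
  exists (L + enorm p); split; first exact: num_real.
  move=> M LM y /= yL; apply: le_trans (norm_le_enorm y) _.
  have := enorm_triangle (y - p) p; rewrite subrK => h; lra.
apply: (@closed_comp _ _ (fun y : 'rV[R]_n => enorm (y - p)) [set t | t <= L]).
  by move=> y _; exact: enorm_continuous.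
exact: closed_le.
Qed.

Lemma uniformly_close (I : finType) (f : I -> 'rV[R]_n -> R) (K : set 'rV[R]_n)
    (e : R) :
  compact K -> 0 < e -> (forall i y, K y -> {for y, continuous (f i)}) ->
  exists2 r : R, 0 < r & forall i y y', K y -> enorm (y' - y) < r ->
    `|f i y' - f i y| < e.
Proof.
move=> /compact_near_coveringP cK e0 cf.
have [r /= r0 hr] : \forall r \near (0:R)^'+, K `<=` [set y | forall y', enorm (y' - y) < r ->
    forall i, `|f i y' - f i y| < e].
  apply: cK => x Kx.
  have : \forall z \near x, forall i, `|f i z - f i x| < e / 2.
    apply: (@filter_forall _ _ (fun i z => `|f i z - f i x| < e / 2) (nbhs x)) => i.
    have e20 : 0 < e / 2 by rewrite divr_gt0.
    have /cvgrPdist_lt/(_ _ e20) := cf i x Kx.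
    by apply: filterS => z; rewrite distrC.
  move=> /nbhs_ballP[r /= r0 hr].
  have hr' z : enorm (z - x) < r -> forall i, `|f i z - f i x| < e / 2.
    move=> zr; apply: hr; rewrite -ball_normE/= distrC.
    exact: le_lt_trans (norm_le_enorm _) zr.
  exists ([set z | enorm (z - x) < r / 2], [set s : R | s < r / 2]) => /=.
    split; first by apply: enorm_ball_nbhs; rewrite divr_gt0.
    by apply: nbhs_right_lt; rewrite divr_gt0.
  move=> [z s] /= [zx sr] y' y'z i.
  have h1 := hr' z (ltac:(lra)) i.
  have h2 := hr' y' (ltac:(have := enorm_triangle (y' - z) (z - x); rewrite addrA subrK; lra)) i.
  have -> : f i y' - f i z = (f i y' - f i x) - (f i z - f i x) by ring.
  by apply: le_lt_trans (ler_normB _ _) _; lra.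
exists (r / 2); first by rewrite divr_gt0.
move=> i y y' Ky yy'; apply: (hr (r / 2) _ _ y Ky) => //.
  by rewrite /= sub0r normrN gtr0_norm ?divr_gt0//; lra.
by rewrite divr_gt0.
Qed.

End topology_of_enorm.

(** * The maximum principle *)

Section maximum_principle.
Context {R : realType}.
Variable n : nat.
Implicit Types (f F : 'rV[R]_n -> R).

Lemma enorm_delta (i : 'I_n) : enorm (delta_mx ord0 i : 'rV[R]_n) = 1.
Proof. by rewrite /enorm -/(sqnorm _) sqnormE dot_delta mxE !eqxx sqrtr1. Qed.

Lemma C2_second_derive (A : set 'rV[R]_n) f y i : open A -> C2_on A f -> A y ->
  second_derive f y (delta_mx ord0 i) (partial i (partial i f) y).
Proof.
move=> oA [f1 f2] Ay; have [r r0 hr] := open_enorm_ball oA Ay.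
exists (fun s => partial i f (y + s *: delta_mx ord0 i)), r; split; first exact: r0.
  move=> s sr; apply: line_derive.
  have [_ /(_ i)[df _]] := f1 _ (hr (y + s *: delta_mx ord0 i) (ltac:(by rewrite addrAC subrr add0r enormZ enorm_delta mulr1))).
  exact: DeriveDef.
apply: line_derive; rewrite scale0r addr0.
have [_ /(_ i)[df _]] := f2 i _ Ay.
exact: DeriveDef.
Qed.

(** At an interior maximum all second derivatives are nonpositive, which
    contradicts the positivity of their sum. *)
Lemma maximum_principle (K U : set 'rV[R]_n) F : compact K -> open U -> U `<=` K ->
  (forall y, K y -> {for y, continuous F}) ->
  (forall y, K y -> ~ U y -> F y <= 0) ->
  (forall y, U y -> exists a : 'I_n -> R,
     (forall i, second_derive F y (delta_mx ord0 i) (a i)) /\ 0 < \sum_(i < n) a i) ->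
  forall y, K y -> F y <= 0.
Proof.
move=> cK oU UK cF bF hF y Ky.
have [c|c] := @EVT_max_rV R n F K (ex_intro _ y Ky) cK.
  by apply: continuous_in_subspaceT => z; rewrite inE; exact: cF.
rewrite inE => Kc cmax.
apply: (@le_trans _ _ (F c)); first by apply: cmax; rewrite inE.
have [Uc|nUc] := pselect (U c); last exact: bF.
have [a [ha a0]] := hF c Uc; exfalso.
have [r r0 hr] := open_enorm_ball oU Uc.
suff : \sum_(i < n) a i <= 0 by rewrite leNgt a0.
apply: sumr_le0 => i _; apply: (second_derive_max (ha i) r0) => s sr.
apply: cmax; rewrite inE; apply/UK/hr.
by rewrite addrAC subrr add0r enormZ enorm_delta mulr1.
Qed.

Variable nu : 'rV[R]_n.
Hypotheses (nu1 : sqnorm nu = 1) (n1 : (1 < n)%N).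

Lemma kernel_continuous (p y : 'rV[R]_n) : 0 < sqnorm (y - p) ->
  {for y, continuous (fun y : 'rV[R]_n => poisson_kernel nu (y - p))}.
Proof.
move=> w0; apply: continuousM_at; first exact: dot_continuous.
apply: (@continuous_comp_at _ _ _ (fun t : R => t^-1 ^+ n)); first exact: enorm_continuous.
apply: (@continuous_comp_at _ _ _ (fun t : R => t ^+ n)); last exact: exprn_continuous.
by apply: inv_continuous; rewrite gt_eqF// sqrtr_gt0.
Qed.

Lemma barrier_continuous (p y : 'rV[R]_n) : 0 < dot (y - p) nu ->
  {for y, continuous (fun y : 'rV[R]_n => barrier nu (y - p))}.
Proof.
move=> d0; have w0 : 0 < sqnorm (y - p).
  by rewrite (lt_le_trans _ (dot_nu_le nu1 _))// exprn_gt0.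
apply: continuousD_at; apply: continuousM_at; (try exact: continuous_cst_at).
  by apply: (@continuous_comp_at _ _ _ (@ln R)); [exact: sqnorm_continuous | exact: continuous_ln].
by apply: (@continuous_comp_at _ _ _ (@ln R)); [exact: dot_continuous | exact: continuous_ln].
Qed.

(** A Phragmen-Lindelof estimate. The maximum principle is applied to the
    difference of [f] and the right-hand side on the points of the
    half-space within distance [L] of [p0 - nu]. There the barrier, centred
    at [p0 - nu] so that both logarithms are nonnegative, is nonnegative,
    and it is at least [ln L] on the spherical part of the boundary; its
    multiple by [M / ln L] beats the bound [M] of [f] there, and [f <= e]
    on the flat part. *)
Lemma half_space_comparison (p0 : 'rV[R]_n) (eta L M e : R) f :
  0 < eta -> 1 < L -> 0 < M -> 0 <= e ->
  (forall y : 'rV[R]_n, eta <= dot (y - p0) nu -> {for y, continuous f}) ->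
  (forall y : 'rV[R]_n, eta <= dot (y - p0) nu -> exists a : 'I_n -> R,
     (forall i, second_derive f y (delta_mx ord0 i) (a i)) /\ \sum_(i < n) a i = 0) ->
  (forall y : 'rV[R]_n, eta <= dot (y - p0) nu -> f y <= M) ->
  (forall y : 'rV[R]_n, eta = dot (y - p0) nu -> enorm (y - p0) <= L -> f y <= e) ->
  forall y : 'rV[R]_n, eta <= dot (y - p0) nu -> enorm (y - (p0 - nu)) <= L ->
  f y <= e + M / ln L * barrier nu (y - (p0 - nu)).
Proof.
move=> eta0 L1 M0 e0 cf hf fM fe y0 y0eta y0L.
set p := p0 - nu.
have lnL : 0 < ln L by rewrite ln_gt0.
pose C := M / ln L; have C0 : 0 < C by rewrite divr_gt0.
have dotp y : dot (y - p) nu = dot (y - p0) nu + 1.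
  by rewrite /p opprB addrCA addrC dotDl -sqnormE nu1.
pose K := [set y : 'rV[R]_n | eta <= dot (y - p0) nu] `&` [set y : 'rV[R]_n | enorm (y - p) <= L].
pose U := [set y : 'rV[R]_n | eta < dot (y - p0) nu] `&` [set y : 'rV[R]_n | enorm (y - p) < L].
have K1 y : K y -> 1 <= dot (y - p) nu by move=> [/= h _]; rewrite dotp; lra.
have bar0 y : K y -> ln (enorm (y - p)) <= barrier nu (y - p) /\ 0 <= ln (enorm (y - p)).
  move=> /K1 h; have d0 : 0 < dot (y - p) nu by lra.
  have s1 : 1 <= enorm (y - p).
    apply: le_trans h (le_trans (ler_norm _) (le_trans (dot_le _ _) _)).
    by rewrite [enorm nu]/enorm -/(sqnorm _) nu1 sqrtr1 mulr1.
  split; last by rewrite ln_ge0.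
  rewrite /barrier -enorm_sqr expr2 lnM ?posrE; try lra.
  have : 0 <= (n%:R - 1) * ln (dot (y - p) nu).
    by rewrite mulr_ge0 ?ln_ge0// subr_ge0 ler1n ltnW.
  lra.
suff H : forall y, K y -> f y + - (e + C * barrier nu (y - p)) <= 0.
  by have := H y0 (conj y0eta y0L); rewrite -/C; lra.
apply: (@maximum_principle K U).
- apply: (subclosed_compact _ (@compact_enorm_ball _ _ p L)); last by move=> y [].
  apply: closedI.
    apply: (@closed_comp _ _ (fun y : 'rV[R]_n => dot (y - p0) nu) [set t | eta <= t]).
      by move=> y _; exact: dot_continuous.
    exact: closed_ge.
  apply: (@closed_comp _ _ (fun y : 'rV[R]_n => enorm (y - p)) [set t | t <= L]).
    by move=> y _; exact: enorm_continuous.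
  exact: closed_le.
- apply: openI.
    apply: (@open_comp _ _ (fun y : 'rV[R]_n => dot (y - p0) nu) [set t | eta < t]).
      by move=> y _; exact: dot_continuous.
    exact: open_gt.
  apply: (@open_comp _ _ (fun y : 'rV[R]_n => enorm (y - p)) [set t | t < L]).
    by move=> y _; exact: enorm_continuous.
  exact: open_lt.
- by move=> y [/= h1 h2]; split; exact: ltW.
- move=> y Ky; have [/= h1 _] := Ky; apply: continuousD_at; first exact: cf.
  apply: continuousN_at; apply: continuousD_at; first exact: continuous_cst_at.
  apply: continuousM_at; first exact: continuous_cst_at.
  by apply: barrier_continuous; have := K1 y Ky; lra.
- move=> y Ky nUy; have [/= h1 h2] := Ky; have [b1 b2] := bar0 y Ky.
  have bb : 0 <= C * barrier nu (y - p) by rewrite mulr_ge0 ?(ltW C0)//; lra.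
  have [h3|h3] := ltP eta (dot (y - p0) nu); last first.
    have e1 : eta = dot (y - p0) nu by apply/eqP; rewrite eq_le h1.
    have : f y <= e; last lra.
    apply: fe => //; apply: le_trans h2.
    rewrite enorm_le ?enorm_ge0// enorm_sqr.
    have -> : y - p = (y - p0) + nu by rewrite /p opprB addrCA addrC.
    by rewrite (sqnormD (y - p0) nu) nu1 -e1; lra.
  have h4 : L <= enorm (y - p) by rewrite leNgt; apply/negP => h; apply: nUy.
  have : C * ln L <= C * barrier nu (y - p).
    rewrite ler_wpM2l ?(ltW C0)//; apply: le_trans b1.
    by rewrite ler_ln ?posrE//; lra.
  rewrite {1}/C divfK ?gt_eqF//; have := fM y h1; lra.
- move=> y [/= h1 h2]; have [a [ha sa]] := hf y (ltW h1).
  have d0 : 0 < dot (y - p) nu by rewrite dotp; lra.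
  pose b i := (sqnorm (y - p))^-1 - 2 * (y - p) ord0 i ^+ 2 / sqnorm (y - p) ^+ 2
     - (n%:R - 1) * nu ord0 i ^+ 2 / dot (y - p) nu ^+ 2.
  exists (fun i => a i + - 1 * (0 + C * b i)); split.
    move=> i; have := second_deriveD (ha i) (second_deriveZ (- 1)
      (second_deriveD (second_derive_cst e y (delta_mx ord0 i))
      (second_deriveZ C (barrier_second_derive nu1 i d0)))).
    congr second_derive; apply/funext => z; by rewrite mulN1r.
  rewrite big_split/= sa add0r -mulr_sumr.
  under eq_bigr do rewrite add0r.
  rewrite -mulr_sumr mulN1r oppr_gt0 pmulr_rlt0//.
  exact: barrier_superharmonic.
Qed.

End maximum_principle.

(** * An orthonormal frame of a hyperplane *)

Section orthonormal_frame.
Context {R : realType}.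

Lemma mul_tr_scalar n (u v : 'rV[R]_n) : u *m v^T = (dot u v)%:M.
Proof. by rewrite [LHS]mx11_scalar dotE. Qed.

(** The reflection that exchanges [nu] and the first basis vector. *)
Lemma householder n (nu : 'rV[R]_n.+1) : sqnorm nu = 1 ->
  exists Q : 'M[R]_n.+1, Q *m Q^T = 1%:M /\ row ord0 Q = nu.
Proof.
move=> nu1; pose a : 'rV[R]_n.+1 := delta_mx ord0 ord0.
have aa : dot a a = 1 by rewrite /a dot_delta mxE !eqxx.
have [e|ne] := eqVneq nu a.
  exists 1%:M; rewrite trmx1 mulmx1; split => //.
  by rewrite rowE mulmx1 e.
pose w := nu - a; have w0 : sqnorm w != 0.
  by apply/eqP => /sqnorm_eq0/eqP; rewrite subr_eq0; exact/negP.
have wE : sqnorm w = 2 - 2 * dot a nu.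
  by rewrite /w sqnormD sqnormN nu1 dotNr (dotC nu) sqnormE aa; ring.
pose c := 2 / sqnorm w; pose Q : 'M[R]_n.+1 := 1%:M - c *: (w^T *m w).
have QT : Q^T = Q by rewrite /Q linearB/= linearZ/= trmx_mul trmxK trmx1.
exists Q; rewrite QT; split.
  have ww : (w^T *m w) *m (w^T *m w) = sqnorm w *: (w^T *m w).
    by rewrite mulmxA -(mulmxA w^T) mul_tr_scalar -sqnormE mul_mx_scalar -scalemxAl.
  rewrite /Q mulmxBr mulmx1 mulmxBl mul1mx -scalemxAl -scalemxAr ww !scalerA.
  rewrite (_ : c * c * sqnorm w = c + c); last by rewrite /c; field.
  by rewrite scalerDl opprB addrK subrK.
rewrite rowE -/a /Q mulmxBr mulmx1 -scalemxAr mulmxA mul_tr_scalar mul_scalar_mx scalerA.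
have -> : c * dot a w = - 1.
  have -> : dot a w = - (sqnorm w / 2) by rewrite wE /w dotDr dotNr aa; field.
  by rewrite /c; field.
by rewrite scaleN1r opprK /w addrC subrK.
Qed.

Lemma orthonormal_frame k (nu : 'rV[R]_k.+1) : sqnorm nu = 1 ->
  exists E : 'M[R]_(k, k.+1),
    [/\ E *m E^T = 1%:M, nu *m E^T = 0 & E^T *m E + nu^T *m nu = 1%:M].
Proof.
move=> /householder[Q [QQ Q0]].
pose Q' : 'M[R]_(1 + k, k.+1) := Q.
have Qc : Q' = col_mx nu (dsubmx Q').
  rewrite -[LHS]vsubmxK; congr col_mx; rewrite -Q0.
  by apply/rowP => j; rewrite !mxE; congr (Q _ _); apply/val_inj.
pose E := dsubmx Q'; exists E.
have QQ1 : Q' *m Q'^T = block_mx 1%:M 0 0 1%:M :=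
  etrans QQ (@scalar_mx_block R 1 k 1).
have QQ2 : Q'^T *m Q' = 1%:M := mulmx1C QQ.
move: QQ1; rewrite Qc tr_col_mx mul_col_row -/E => /eq_block_mx[_ h1 _ h2].
split => //.
by move: QQ2; rewrite Qc tr_col_mx mul_row_col addrC.
Qed.

End orthonormal_frame.

(** * The kernel on a hyperplane *)

Section half_space_quadrature.
Context {R : realType}.
Variables (k : nat) (nu p0 : 'rV[R]_k.+1) (E : 'M[R]_(k, k.+1)).
Hypotheses (k0 : (0 < k)%N) (nu1 : sqnorm nu = 1).
Hypotheses (EE : E *m E^T = 1%:M) (nuE : nu *m E^T = 0)
  (EnuE : E^T *m E + nu^T *m nu = 1%:M).
Implicit Types (q : 'rV[R]_k) (y : 'rV[R]_k.+1).

(** [emb] is an isometric parametrization of the hyperplane through [p0]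
    orthogonal to [nu], and [proj] gives the coordinates of the foot of a
    point on it. *)
Definition emb q : 'rV[R]_k.+1 := p0 + q *m E.
Definition proj y : 'rV[R]_k := (y - p0) *m E^T.

Lemma dot_emb y q : dot (y - emb q) nu = dot (y - p0) nu.
Proof.
rewrite /emb opprD addrA (dotDl (y - p0)) dotNl (_ : dot (q *m E) nu = 0) ?subr0//.
rewrite dotE -mulmxA; have -> : E *m nu^T = 0.
  by rewrite -[E]trmxK -trmx_mul nuE trmx0.
by rewrite mulmx0 mxE.
Qed.

Lemma sqnorm_split (w : 'rV[R]_k.+1) :
  sqnorm w = dot w nu ^+ 2 + sqnorm (w *m E^T).
Proof.
have {1}-> : w = w *m E^T *m E + dot w nu *: nu.
  by rewrite -mul_scalar_mx -mul_tr_scalar -!mulmxA -mulmxDr EnuE mulmx1.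
have o : dot (w *m E^T *m E) nu = 0.
  rewrite dotE -mulmxA (_ : E *m nu^T = 0) ?mulmx0 ?mxE//.
  by rewrite -[E]trmxK -trmx_mul nuE trmx0.
rewrite sqnormD sqnormZ nu1 mulr1 dotZr o !mulr0 addr0 addrC; congr (_ + _).
by rewrite !sqnormE !dotE trmx_mul mulmxA -(mulmxA (w *m E^T)) EE mulmx1.
Qed.

Lemma sqnorm_emb y q :
  sqnorm (y - emb q) = dot (y - p0) nu ^+ 2 + sqnorm (q - proj y).
Proof.
rewrite sqnorm_split dot_emb; congr (_ + _); rewrite -sqnormN; congr sqnorm.
rewrite /emb /proj opprD addrA mulmxBl -mulmxA EE mulmx1.
by rewrite opprB.
Qed.

Lemma enorm_proj y : enorm (proj y) <= enorm (y - p0).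
Proof.
rewrite enorm_le ?enorm_ge0// enorm_sqr [leRHS]sqnorm_split lerDr.
exact: sqr_ge0.
Qed.

Local Notation n := k.+1.
Definition grad_coef : R := n%:R * (n%:R - 2).

Lemma grad_coef_ge0 : 0 <= grad_coef.
Proof. by rewrite mulr_ge0// subr_ge0 ler_nat. Qed.

(** Lengths are measured in units of the height [s] of [y], so that the
    quotient of the distance to the foot by [s] is the tangent of the angle
    between [y - emb q] and [nu]. *)
Lemma inv_rho_emb y q (s := dot (y - p0) nu) : 0 < s ->
  inv_rho (enorm (q - proj y) / s) = s * (enorm (y - emb q))^-1.
Proof.
move=> s0; rewrite /inv_rho expr_div_n enorm_sqr.
rewrite (_ : 1 + _ = sqnorm (y - emb q) / s ^+ 2); last first.
  by rewrite sqnorm_emb -/s; field; rewrite gt_eqF.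
rewrite sqrtrM ?sqnorm_ge0// sqrtrV ?sqr_ge0// sqrtr_sqr gtr0_norm// -/(enorm _).
by rewrite invfM invrK mulrC.
Qed.

Lemma kernel_emb y q (s := dot (y - p0) nu) : 0 < s ->
  poisson_kernel nu (y - emb q) = s^-1 ^+ k * radial_density k 0 (enorm (q - proj y) / s).
Proof.
move=> s0; rewrite /radial_density inv_rho_emb// -/s mul0r addr0 sqrtr1 mulr1.
rewrite /poisson_kernel dot_emb -/s exprMn (exprSr s k) !mulrA -exprMn mulVf ?gt_eqF//.
by rewrite expr1n mul1r.
Qed.

Lemma kernel_grad_emb y q (s := dot (y - p0) nu) : 0 < s ->
  enorm (kernel_grad nu (y - emb q)) =
  s^-1 * (s^-1 ^+ k * radial_density k grad_coef (enorm (q - proj y) / s)).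
Proof.
move=> s0; rewrite kernel_grad_norm//; last first.
  by rewrite sqnorm_emb -/s ltr_wpDr ?sqnorm_ge0// exprn_gt0.
rewrite dot_emb -/s /radial_density inv_rho_emb// -/s -/grad_coef.
set r := Num.sqrt _; set I := (enorm _)^-1.
have -> : I ^+ n = s^-1 * (s^-1 ^+ k * (s * I) ^+ n).
  by rewrite mulrA -exprS -exprMn mulrA mulVf ?gt_eqF// mul1r.
by rewrite -!mulrA.
Qed.

Local Notation T0 := (@total_mass R k 0).
Local Notation T1 := (@total_mass R k grad_coef).

Lemma angular_mass0 : @angular_mass R k 0 = wallis k.-1.
Proof.
apply: eq_Rintegral => t _; by rewrite /angular mul0r addr0 sqrtr1 mul1r.
Qed.

Lemma total_mass0_gt0 : 0 < T0.
Proof. by rewrite !mulr_gt0 ?ball_const_gt0 ?angular_mass0 ?wallis_gt0// ltr0n. Qed.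

End half_space_quadrature.

(** * Approximation of harmonic functions by sums of kernels *)

Section poisson_sums.
Context {R : realType}.
Variables (k : nat) (nu p0 : 'rV[R]_k.+1) (E : 'M[R]_(k, k.+1)).
Hypotheses (k0 : (0 < k)%N) (nu1 : sqnorm nu = 1).
Hypotheses (EE : E *m E^T = 1%:M) (nuE : nu *m E^T = 0)
  (EnuE : E^T *m E + nu^T *m nu = 1%:M).
Local Notation n := k.+1.
Local Notation T0 := (@total_mass R k 0).
Local Notation T1 := (@total_mass R k (@grad_coef R k)).
Local Notation emb := (emb p0 E).
Local Notation proj := (proj p0 E).
Local Notation height y := (dot (y - p0) nu).

(** The volume of a cell over the total mass of the kernel, so that the
    weights at any given point have sum close to [1]. *)
Definition weight (d : R) : R := d ^+ k / T0.

Definition poisson_weight (d : R) (y : 'rV[R]_n) (q : 'rV[R]_k) : R :=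
  weight d * poisson_kernel nu (y - emb q).

Definition poisson_sum (d : R) (N : nat) (f : 'rV[R]_n -> R) (y : 'rV[R]_n) : R :=
  \sum_(q <- grid d N k) f (emb q) * poisson_weight d y q.

Lemma height_emb q : height (emb q) = 0.
Proof.
by rewrite -opprB dotNl (dot_emb p0 nuE) subrr -(scale0r nu) dotZl mul0r oppr0.
Qed.

Lemma height_gt0_neq y q : 0 < height y -> 0 < sqnorm (y - emb q).
Proof.
by move=> s0; rewrite (sqnorm_emb p0 nu1 EE nuE EnuE) ltr_wpDr ?sqnorm_ge0// exprn_gt0.
Qed.

Lemma poisson_weightE d y q (s := height y) : 0 < s -> poisson_weight d y q =
  T0^-1 * ((d / s) ^+ k * radial_density k 0 (enorm (q - proj y) / s)).
Proof.
move=> s0; rewrite /poisson_weight /weight (kernel_emb nu1 EE nuE EnuE)//.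
by rewrite -/s [in RHS]exprMn; ring.
Qed.

Lemma poisson_weight_ge0 d y q : 0 <= d -> 0 < height y -> 0 <= poisson_weight d y q.
Proof.
move=> d0 s0; rewrite poisson_weightE//; apply: mulr_ge0.
  by rewrite invr_ge0 ltW// total_mass0_gt0.
by rewrite mulr_ge0 ?radial_density_ge0// exprn_ge0// divr_ge0// ltW.
Qed.

Lemma poisson_weight_sum_le (e : R) : 0 < e -> exists2 th : R, 0 < th &
  forall (d : R) N y, 0 < d -> 0 < height y -> d <= th * height y ->
  \sum_(q <- grid d N k) poisson_weight d y q <= 1 + e.
Proof.
move=> e0; have T00 := total_mass0_gt0 k0 : 0 < T0.
have [th th0 h] := quad_sum_le k0 (lexx 0) (mulr_gt0 e0 T00).
exists th => // d N y d0 s0 dle.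
under eq_bigr do rewrite poisson_weightE//.
rewrite -!mulr_sumr mulrC ler_pdivrMr// mulrDl mul1r.
exact: h.
Qed.

(** With [poisson_weight_sum_le], this makes the weights an approximate
    probability, almost all of it within [Lam * height y] of the foot of
    [y]. *)
Lemma poisson_weight_sum_ge (e : R) : 0 < e -> exists th Lam : R, [/\ 0 < th, 0 < Lam &
  forall (d : R) N y, 0 < d -> 0 < height y -> d <= th * height y ->
  enorm (y - p0) + Lam * height y <= d * N%:R ->
  1 - e <= \sum_(q <- grid d N k) poisson_weight d y q *
     (enorm (q - proj y) < Lam * height y)%R%:R].
Proof.
move=> e0; have T00 := total_mass0_gt0 k0 : 0 < T0.
have [th [Lam [th0 Lam0 h]]] := quad_sum_ge k0 (lexx 0) (mulr_gt0 e0 T00).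
exists th, Lam; split => // d N y d0 s0 dle yN.
have zN : enorm (proj y) + Lam * height y <= d * N%:R.
  by apply: le_trans yN; rewrite lerD2r (enorm_proj p0 nu1 EE nuE EnuE).
rewrite (eq_bigr (fun q => T0^-1 * ((d / height y) ^+ k *
  ((enorm (q - proj y) < Lam * height y)%R%:R * radial_density k 0 (enorm (q - proj y) / height y))))).
  rewrite -!mulr_sumr mulrC ler_pdivlMr// mulrBl mul1r.
  exact: h.
by move=> q _; rewrite poisson_weightE//; ring.
Qed.

Lemma kernel_grad_sum_le (e : R) y : 0 < e -> 0 < height y -> exists2 th : R, 0 < th &
  forall (d : R) N, 0 < d -> d <= th ->
  \sum_(q <- grid d N k) weight d * enorm (kernel_grad nu (y - emb q)) <=
  T1 / T0 / height y + e.
Proof.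
move=> e0; set h := height y => h0; have T00 := total_mass0_gt0 k0 : 0 < T0.
have [th th0 H] := quad_sum_le k0 (grad_coef_ge0 k0) (mulr_gt0 (mulr_gt0 e0 h0) T00).
exists (th * h); first exact: mulr_gt0.
move=> d N d0 dle.
rewrite (eq_bigr (fun q => T0^-1 * h^-1 * ((d / h) ^+ k *
  radial_density k (@grad_coef R k) (enorm (q - proj y) / h)))); last first.
  move=> q _; rewrite (kernel_grad_emb nu1 EE nuE EnuE)// -/h /weight [in RHS]exprMn.
  by ring.
rewrite -!mulr_sumr; apply: (@le_trans _ _ (T0^-1 * h^-1 * (T1 + e * h * T0))).
  by rewrite ler_wpM2l ?H// ltW// mulr_gt0 ?invr_gt0.
rewrite le_eqVlt; apply/orP; left; apply/eqP; field.
by rewrite !gt_eqF.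
Qed.

Lemma poisson_sum_continuous d N f y : 0 < height y ->
  {for y, continuous (poisson_sum d N f)}.
Proof.
move=> s0; apply: continuous_sum_at => q.
do 2 (apply: continuousM_at; first exact: continuous_cst_at).
exact: kernel_continuous (height_gt0_neq q s0).
Qed.

Lemma poisson_sum_harmonic d N f y : 0 < height y -> exists a : 'I_n -> R,
  (forall j, second_derive (poisson_sum d N f) y (delta_mx ord0 j) (a j)) /\
  \sum_(j < n) a j = 0.
Proof.
move=> s0.
exists (fun j => \sum_(q <- grid d N k) f (emb q) * (weight d *
  kline2 n (dot (y - emb q) nu) (nu ord0 j) (sqnorm (y - emb q)) ((y - emb q) ord0 j) 0)).
split=> [j|].
  apply: second_derive_sum => q; do 2 apply: second_deriveZ.
  exact: kernel_second_derive (height_gt0_neq q s0).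
rewrite exchange_big/= big1// => q _.
by rewrite -!mulr_sumr kernel_laplacian ?mulr0// height_gt0_neq.
Qed.

End poisson_sums.

(** The difference [phi i - c] is at most [e] at the indices in [near], and
    at most [2 * M] at the others, whose total weight is at most [2 * e]. *)
Lemma approximate_identity (R : realType) (I : Type) (s : seq I) (W phi : I -> R)
    (near : I -> bool) (c e M : R) : 0 <= e <= 1 -> 0 <= M ->
  (forall i, 0 <= W i) -> \sum_(i <- s) W i <= 1 + e ->
  1 - e <= \sum_(i <- s) W i * (near i)%:R ->
  (forall i, `|phi i| <= M) -> `|c| <= M ->
  (forall i, near i -> `|phi i - c| <= e) ->
  `|\sum_(i <- s) phi i * W i - c| <= e * (2 + 5 * M).
Proof.
move=> /andP[e0 e1] M0 W0 Wle Wge phiM cM phic.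
have term i : `|(phi i - c) * W i| <= W i * e + 2 * M * (W i - W i * (near i)%:R).
  rewrite mulrC normrM (ger0_norm (W0 i)); case: (boolP (near i)) => [/phic h|_].
    by rewrite mulr1 subrr mulr0 addr0 ler_wpM2l.
  rewrite mulr0 subr0 -[X in _ <= X]addrC [2 * M * _]mulrC -mulrDr ler_wpM2l//.
  by apply: le_trans (ler_normB _ _) _; have := phiM i; lra.
have WW : \sum_(i <- s) W i * (near i)%:R <= \sum_(i <- s) W i.
  by apply: ler_sum => i _; rewrite -[leRHS]mulr1 ler_wpM2l// lern1 leq_b1.
have -> : \sum_(i <- s) phi i * W i - c =
    \sum_(i <- s) (phi i - c) * W i + (\sum_(i <- s) W i - 1) * c.
  rewrite mulrBl mul1r mulr_suml addrA -big_split/=; congr (_ - _).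
  by apply: eq_bigr => i _; ring.
have h1 : `|\sum_(i <- s) (phi i - c) * W i| <= (1 + e) * e + 2 * M * (2 * e).
  apply: le_trans (ler_norm_sum _ _ _) _.
  apply: le_trans (ler_sum _ (fun i _ => term i)) _.
  rewrite big_split/= -mulr_suml -[X in _ + X <= _]mulr_sumr sumrB; apply: lerD.
    exact: ler_wpM2r.
  by apply: ler_wpM2l; [rewrite mulr_ge0 | move: Wle Wge; clear; lra].
have h2 : `|(\sum_(i <- s) W i - 1) * c| <= e * M.
  rewrite normrM; apply: ler_pM => //.
  by rewrite ler_norml; apply/andP; split; move: Wle Wge WW; clear; lra.
have h3 : (1 + e) * e <= 2 * e by rewrite ler_wpM2r//; move: e1; clear; lra.
by apply: le_trans (ler_normD _ _) _; move: h1 h2 h3; clear; lra.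
Qed.

Section poisson_approximation.
Context {R : realType}.
Variables (k : nat) (nu p0 : 'rV[R]_k.+1) (E : 'M[R]_(k, k.+1)).
Hypotheses (k0 : (0 < k)%N) (nu1 : sqnorm nu = 1).
Hypotheses (EE : E *m E^T = 1%:M) (nuE : nu *m E^T = 0)
  (EnuE : E^T *m E + nu^T *m nu = 1%:M).
Local Notation n := k.+1.
Local Notation T0 := (@total_mass R k 0).
Local Notation T1 := (@total_mass R k (@grad_coef R k)).
Local Notation emb := (emb p0 E).
Local Notation proj := (proj p0 E).
Local Notation height y := (dot (y - p0) nu).
Local Notation poisson_sum := (poisson_sum nu p0 E).

Variables (I : finType) (f : I -> 'rV[R]_n -> R) (M : R).
Hypothesis M0 : 0 < M.
Hypothesis fcont : forall i y, 0 <= height y -> {for y, continuous (f i)}.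
Hypothesis fM : forall i y, 0 <= height y -> `|f i y| <= M.

(** At the height [eta] the weights are concentrated within a distance [(1
    + Lam) * eta] over which [f] varies little, uniformly on the compact
    part of the half-space where [enorm (y - p0) <= L]. *)
Lemma poisson_near_boundary (e L h : R) : 0 < e -> 0 < h ->
  exists eta th b : R, [/\ 0 < eta, eta <= h, 0 < th &
    forall d N, 0 < d -> d <= th -> L + b <= d * N%:R -> forall i y,
      (eta <= height y -> `|poisson_sum d N (f i) y| <= 2 * M) /\
      (eta = height y -> enorm (y - p0) <= L -> `|poisson_sum d N (f i) y - f i y| <= e)].
Proof.
move=> e0 h0.
(* the error in [approximate_identity] is [e1 * (2 + 5 * M)] *)
pose e1 := Num.min 1 (e / (2 + 5 * M)).
have den0 : 0 < 2 + 5 * M by rewrite addr_gt0// mulr_gt0.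
have e10 : 0 < e1 by rewrite lt_min ltr01/= divr_gt0.
have e11 : e1 <= 1 by rewrite ge_min lexx.
have e1e : e1 * (2 + 5 * M) <= e by rewrite -ler_pdivlMr// ge_min lexx orbT.
pose K := [set y : 'rV[R]_n | 0 <= height y] `&` [set y : 'rV[R]_n | enorm (y - p0) <= L].
have cK : compact K.
  apply: (subclosed_compact _ (@compact_enorm_ball _ _ p0 L)); last by move=> y [].
  apply: closedI.
    apply: (@closed_comp _ _ (fun y : 'rV[R]_n => height y) [set t | 0 <= t]).
      by move=> y _; exact: dot_continuous.
    exact: closed_ge.
  apply: (@closed_comp _ _ (fun y : 'rV[R]_n => enorm (y - p0)) [set t | t <= L]).
    by move=> y _; exact: enorm_continuous.
  exact: closed_le.
have fK (i : I) y : K y -> {for y, continuous (f i)} by move=> [Ky _]; exact: fcont.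
have [r r0 hr] := uniformly_close cK e10 fK.
have [th1 th10 q1] := poisson_weight_sum_le p0 k0 nu1 EE nuE EnuE e10.
have [th2 [Lam [th20 Lam0 q2]]] := poisson_weight_sum_ge p0 k0 nu1 EE nuE EnuE e10.
have Lam1 : 0 < 1 + Lam by rewrite addr_gt0.
pose eta := Num.min h (r / (2 * (1 + Lam))).
have eta0 : 0 < eta by rewrite lt_min h0 divr_gt0// mulr_gt0.
have etar : eta * (1 + Lam) < r.
  have : eta <= r / (2 * (1 + Lam)) by rewrite ge_min lexx orbT.
  by rewrite ler_pdivlMr ?mulr_gt0//; move: r0; lra.
pose th := Num.min th1 th2.
have th0 : 0 < th by rewrite lt_min th10.
exists eta, (th * eta), (Lam * eta); split; [by [] | by rewrite ge_min lexx | exact: mulr_gt0 |].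
move=> d N d0 dle dN i y.
have femb q : `|f i (emb q)| <= M by apply: fM; rewrite (height_emb p0 nuE).
have dles s : eta <= s -> d <= th1 * s /\ d <= th2 * s.
  move=> es; have a1 : th <= th1 by rewrite ge_min lexx.
  have a2 : th <= th2 by rewrite ge_min lexx orbT.
  by split; apply: le_trans dle _; apply: ler_pM => //; exact: ltW.
have Wsum : eta <= height y -> \sum_(q <- grid d N k) poisson_weight nu p0 E d y q <= 1 + e1.
  by move=> es; apply: q1 => //; [exact: lt_le_trans es | exact: (dles _ es).1].
have W0 q : eta <= height y -> 0 <= poisson_weight nu p0 E d y q.
  by move=> es; apply: poisson_weight_ge0 => //; [exact: ltW | exact: lt_le_trans es].
split=> [es|ys yL].
  apply: le_trans (ler_norm_sum _ _ _) _.
  apply: (@le_trans _ _ (\sum_(q <- grid d N k) M * poisson_weight nu p0 E d y q)).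
    by apply: ler_sum => q _; rewrite normrM (ger0_norm (W0 q es)) ler_wpM2r ?W0.
  rewrite -mulr_sumr mulrC ler_pM2r//.
  by apply: le_trans (Wsum es) _; move: e11; lra.
have es : eta <= height y by rewrite ys.
have s0 : 0 < height y by rewrite -ys.
apply: le_trans e1e; apply: (approximate_identity
  (near := fun q => enorm (q - proj y) < Lam * height y)) => //.
- by rewrite ltW.
- exact: ltW.
- by move=> q; exact: W0.
- exact: Wsum.
- apply: q2 => //; first exact: (dles _ es).2.
  by rewrite -ys; apply: le_trans dN; rewrite lerD2r.
- by apply: fM; exact: ltW.
- move=> q hq; apply/ltW/hr; first by split => //=; exact: ltW.
  rewrite enormB_sym enorm_lt ?(ltW r0)// (sqnorm_emb p0 nu1 EE nuE EnuE) -ys.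
  apply: (@le_lt_trans _ _ ((eta * (1 + Lam)) ^+ 2)); last first.
    by rewrite ltrXn2r// ?nnegrE ?mulr_ge0 ?(ltW eta0) ?(ltW r0) ?(ltW Lam1).
  have : enorm (q - proj y) ^+ 2 <= (Lam * eta) ^+ 2.
    by rewrite lerXn2r ?nnegrE ?enorm_ge0 ?mulr_ge0 ?(ltW Lam0) ?(ltW eta0)// ys ltW.
  have : 0 <= eta * (Lam * eta) by rewrite !mulr_ge0 ?(ltW Lam0) ?(ltW eta0).
  by rewrite enorm_sqr; lra.
Qed.

Variable O : set 'rV[R]_n.
Hypotheses (oO : open O) (OH : forall y, 0 <= height y -> O y).
Hypothesis fharm : forall i, harmonic_on O (f i).

Lemma error_harmonic (sg : R) d N i y : 0 < height y -> exists a : 'I_n -> R,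
  (forall j, second_derive (fun z => sg * (poisson_sum d N (f i) z + - 1 * f i z))
     y (delta_mx ord0 j) (a j)) /\ \sum_(j < n) a j = 0.
Proof.
move=> s0; have Oy : O y by apply: OH; exact: ltW.
have [C2f lap0] := fharm i.
have [a [ha sa]] := poisson_sum_harmonic nu1 EE nuE EnuE d N (f i) s0.
exists (fun j => sg * (a j + - 1 * partial j (partial j (f i)) y)); split.
  move=> j; apply/second_deriveZ/second_deriveD => //.
  by apply: second_deriveZ; exact: C2_second_derive oO C2f Oy.
by rewrite -mulr_sumr big_split/= sa -mulr_sumr -/(laplacian _ _) lap0// mulr0 addr0 mulr0.
Qed.

(** The error is harmonic above the height [eta], at most [e / 2] at that
    height up to distance [L], and at most [3 * M] everywhere. For [L]
    large the contribution of the barrier in [half_space_comparison] is at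
    most [e / 2] up to distance [X]. *)
Lemma poisson_approximation (e X h : R) : 0 < e -> 1 < X -> 0 < h ->
  exists (d : R) (N : nat), [/\ 0 < d,
    forall i y, h / 2 <= height y -> enorm (y - (p0 - nu)) <= X ->
      `|f i y - poisson_sum d N (f i) y| <= e,
    \sum_(q <- grid d N k) weight k d * poisson_kernel nu (p0 + h *: nu - emb q) <= 2 &
    \sum_(q <- grid d N k) weight k d * enorm (kernel_grad nu (p0 + h *: nu - emb q))
      <= T1 / T0 / h + e].
Proof.
move=> e0 X1 h0.
have lnX : 0 < ln X by rewrite ln_gt0.
(* up to distance [X] the barrier is at most [n ln X], so [3 M / ln L]
   times it must be at most [e / 2]; the summand [ln X] gives [X <= L] *)
pose lnL := ln X + 6 * M * n%:R * ln X / e.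
have t0 : 0 < 6 * M * n%:R * ln X / e by rewrite divr_gt0 ?mulr_gt0.
have lnL0 : 0 < lnL by rewrite addr_gt0.
pose L := expR lnL; have L1 : 1 < L by rewrite expR_gt1.
have XL : X <= L.
  by rewrite /L -[X]lnK ?posrE ?(lt_trans ltr01)// ler_expR lerDl ltW.
have hh0 : 0 < h / 2 by rewrite divr_gt0.
have e20 : 0 < e / 2 by rewrite divr_gt0.
have hx : height (p0 + h *: nu) = h.
  by rewrite addrAC subrr add0r dotZl -sqnormE nu1 mulr1.
have hx0 : 0 < height (p0 + h *: nu) by rewrite hx.
have [eta [th [b [eta0 etah th0 near]]]] := poisson_near_boundary L e20 hh0.
have [th1 th10 sum1] := poisson_weight_sum_le p0 k0 nu1 EE nuE EnuE ltr01.
have [th2 th20 sum2] := kernel_grad_sum_le k0 nu1 EE nuE EnuE e0 hx0.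
rewrite hx in sum2.
pose d := Num.min th (Num.min (th1 * h) th2).
have d0 : 0 < d by rewrite !lt_min th0 th20 mulr_gt0.
have dth : d <= th by rewrite ge_min lexx.
have dth1 : d <= th1 * h by rewrite !ge_min lexx orbT.
have dth2 : d <= th2 by rewrite !ge_min lexx !orbT.
pose N := Num.bound (`|L + b| / d).
have dN : L + b <= d * N%:R.
  have : 0 <= `|L + b| / d by rewrite divr_ge0 ?(ltW d0).
  move=> /archi_boundP/ltW; rewrite ler_pdivrMr// [_ * d]mulrC.
  exact: le_trans (ler_norm _).
(* both signs of the error are needed, as the comparison bounds it from
   above *)
have interior (sg : R) i y : `|sg| = 1 -> h / 2 <= height y -> enorm (y - (p0 - nu)) <= X ->
    sg * (poisson_sum d N (f i) y + - 1 * f i y) <= e.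
  move=> sg1 yh yX; have pos z : eta <= height z -> 0 < height z by exact: lt_le_trans.
  have normle z (c : R) : `|poisson_sum d N (f i) z - f i z| <= c ->
     sg * (poisson_sum d N (f i) z + - 1 * f i z) <= c.
    by move=> hc; apply: le_trans (ler_norm _) _; rewrite normrM sg1 mul1r mulN1r.
  have M30 : 0 < 3 * M by rewrite mulr_gt0.
  have := @half_space_comparison R n nu nu1 k0 p0 eta L (3 * M) (e / 2)
    (fun y => sg * (poisson_sum d N (f i) y + - 1 * f i y)) eta0 L1 M30 (ltW e20).
  move=> /(_ _ (fun z zs => error_harmonic sg d N i (pos z zs)) _ _
    y (le_trans etah yh) (le_trans yX XL)) H.
  apply: le_trans (H _ _ _) _.
  - move=> z zs; apply: continuousM_at; first exact: continuous_cst_at.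
    apply: continuousD_at; first by apply: poisson_sum_continuous => //; exact: pos.
    by apply: continuousM_at; [exact: continuous_cst_at | apply: fcont; exact: ltW (pos z zs)].
  - move=> z zs; apply: normle; apply: le_trans (ler_normB _ _) _.
    have := (near d N d0 dth dN i z).1 zs; have := fM i (ltW (pos z zs)).
    by lra.
  - by move=> z zs zL; apply: normle; exact: (near d N d0 dth dN i z).2 zs zL.
  have w1 : 1 <= dot (y - (p0 - nu)) nu.
    rewrite opprB addrCA addrC dotDl -sqnormE nu1 lerDr.
    exact: le_trans (ltW hh0) yh.
  have bX : 3 * M / lnL * barrier nu (y - (p0 - nu)) <= 3 * M / lnL * (n%:R * ln X).
    by apply: ler_wpM2l; [rewrite ltW// divr_gt0 | exact: barrier_le].
  have lL : 3 * M / lnL * (n%:R * ln X) <= e / 2.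
    rewrite mulrAC ler_pdivrMr//.
    have eq1 : 6 * M * n%:R * ln X / e * (e / 2) = 3 * M * (n%:R * ln X).
      by field; rewrite gt_eqF.
    have le1 : 0 <= ln X * (e / 2) by rewrite mulr_ge0// ltW.
    by rewrite /lnL mulrDr mulrC [e / 2 * _]mulrC; move: eq1 le1; lra.
  by rewrite expRK; move: bX lL; lra.
exists d, N; split => //.
- move=> i y yh yX; have h1 := interior 1 i y (normr1 _) yh yX.
  have h2 := interior (- 1) i y (ltac:(by rewrite normrN1)) yh yX.
  by rewrite distrC ler_norml; apply/andP; split; move: h1 h2; lra.
- by rewrite [leRHS](_ : _ = 1 + 1)//; apply: sum1; rewrite ?hx.
- exact: sum2.
Qed.

End poisson_approximation.

(** * The estimate on a half-space *)

Section half_space_estimate.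
Context {R : realType}.
Variables (k : nat) (nu p0 : 'rV[R]_k.+1).
Hypotheses (k0 : (0 < k)%N) (nu1 : sqnorm nu = 1).
Local Notation n := k.+1.
Local Notation T0 := (@total_mass R k 0).
Local Notation T1 := (@total_mass R k (@grad_coef R k)).
Variables (O : set 'rV[R]_n) (u : 'rV[R]_n -> 'rV[R]_n) (M h : R).
Hypotheses (oO : open O) (M0 : 0 < M) (h0 : 0 < h).
Hypothesis OH : forall y : 'rV[R]_n, 0 <= dot (y - p0) nu -> O y.
Hypothesis uharm : forall i : 'I_n, harmonic_on O (fun y => u y ord0 i).
Hypothesis uM : forall y : 'rV[R]_n, 0 <= dot (y - p0) nu -> enorm (u y) <= M.
Local Notation x := (p0 + h *: nu).

(** The approximating sums are known to be close to [u] in value but not in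
    derivative, so the divergence is reached through differences of step
    [t], with sums that are accurate up to [t ^ 2]. Expanding the kernel to
    first order makes another error of order [t ^ 2]; its constant does not
    depend on the grid because the weights sum to at most [2]. *)
Lemma divergence_difference_quotient : exists2 C : R, 0 <= C &
  forall t : R, 0 < t -> t <= h / 2 ->
  `|\sum_(i < n) (u (x + t *: delta_mx ord0 i) ord0 i - u x ord0 i)| <=
  t * (T1 / T0 / h * M) + C * t ^+ 2.
Proof.
have [E [EE nuE EnuE]] := orthonormal_frame nu1.
pose c0 : R := n%:R * (n%:R + 5) * 2 ^+ n.+1.
have c00 : 0 <= c0 by apply: mulr_ge0; [apply: mulr_ge0 => //; exact: addr_ge0 | exact: exprn_ge0].
pose c1 := n%:R * M * c0 / h ^+ 2.
have c10 : 0 <= c1.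
  by apply: divr_ge0; [apply: mulr_ge0 => //; apply: mulr_ge0 => //; exact: ltW | exact: sqr_ge0].
exists (2 * n%:R + M * h + 2 * c1).
  apply: addr_ge0; last by rewrite mulr_ge0.
  by apply: addr_ge0; rewrite mulr_ge0// ltW.
move=> t t0 th.
(* [X] bounds the distance to [p0 - nu] of [x] and of the points at
   distance [t <= h / 2] from it *)
pose X := enorm (x - (p0 - nu)) + h + 1.
have X1 : 1 < X by rewrite /X; have := enorm_ge0 (x - (p0 - nu)); have := h0; lra.
have t20 : 0 < t ^+ 2 by rewrite exprn_gt0.
have fM (i : 'I_n) (y : 'rV[R]_n) : 0 <= dot (y - p0) nu -> `|u y ord0 i| <= M.
  by move=> /uM; apply: le_trans; exact: coord_le.
have fcont (i : 'I_n) (y : 'rV[R]_n) : 0 <= dot (y - p0) nu ->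
    {for y, continuous (fun y => u y ord0 i)}.
  by move=> /OH Oy; have [[cu _] _] := uharm i; exact: (cu y Oy).1.
have [d [N [d0 approx Ksum Gsum]]] :=
  poisson_approximation k0 nu1 EE nuE EnuE M0 fcont fM oO OH uharm t20 X1 h0.
pose v (i : 'I_n) := poisson_sum nu p0 E d N (fun y => u y ord0 i).
have hx : dot (x - p0) nu = h.
  by rewrite addrAC subrr add0r dotZl -sqnormE nu1 mulr1.
have ei (i : 'I_n) : `|dot (delta_mx ord0 i) nu| <= 1.
  by rewrite dot_delta; have := coord_le nu i; rewrite /enorm -/(sqnorm _) nu1 sqrtr1.
have ax i : `|u x ord0 i - v i x| <= t ^+ 2.
  by apply: approx; [rewrite hx; have := h0; lra | rewrite /X; have := h0; lra].
have at_ i : `|u (x + t *: delta_mx ord0 i) ord0 i - v i (x + t *: delta_mx ord0 i)| <= t ^+ 2.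
  apply: approx.
    rewrite addrAC dotDl hx dotZl.
    have : `|t * dot (delta_mx ord0 i) nu| <= t.
      by rewrite normrM gtr0_norm// -[leRHS]mulr1 ler_pM2l.
    by rewrite ler_norml; lra.
  rewrite addrAC; apply: le_trans (enorm_triangle _ _) _.
  rewrite enormZ enorm_delta mulr1 gtr0_norm// /X; have := h0; lra.
pose e_ i := delta_mx ord0 i : 'rV[R]_n.
pose w q := x - emb p0 E q.
have dotw q : dot (w q) nu = h by rewrite /w (dot_emb p0 nuE) hx.
have wh q : h <= enorm (w q).
  rewrite -{1}(dotw q); apply: le_trans (ler_norm _) (le_trans (dot_le _ _) _).
  by rewrite [enorm nu]/enorm -/(sqnorm _) nu1 sqrtr1 mulr1.
have w0 q : 0 < enorm (w q) by apply: lt_le_trans (wh q).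
have wt0 : 0 <= weight k d.
  by rewrite divr_ge0 ?exprn_ge0 ?(ltW d0)// ltW// total_mass0_gt0.
have uemb q : enorm (u (emb p0 E q)) <= M.
  apply: uM; rewrite -opprB dotNl (dot_emb p0 nuE) subrr.
  by rewrite -(scale0r nu) dotZl mul0r oppr0.
(* the contribution of the grid point [q]: pairing [u] with the gradient
   first, then bounding, is what produces [enorm (u q) * enorm (grad)] in
   place of a sum over coordinates *)
have term q : `|\sum_(i < n) u (emb p0 E q) ord0 i *
     (poisson_kernel nu (w q + t *: e_ i) - poisson_kernel nu (w q))| <=
     t * M * enorm (kernel_grad nu (w q)) + c1 * t ^+ 2 * poisson_kernel nu (w q).
  have -> : \sum_(i < n) u (emb p0 E q) ord0 i * (poisson_kernel nu (w q + t *: e_ i) - poisson_kernel nu (w q)) =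
     t * dot (u (emb p0 E q)) (kernel_grad nu (w q)) + \sum_(i < n) u (emb p0 E q) ord0 i *
     (poisson_kernel nu (w q + t *: e_ i) - poisson_kernel nu (w q) - t * kernel_grad nu (w q) ord0 i).
    rewrite /dot mulr_sumr -big_split/=; apply: eq_bigr => i _; ring.
  apply: le_trans (ler_normD _ _) (lerD _ _).
    rewrite normrM gtr0_norm// -mulrA ler_pM2l//; apply: le_trans (dot_le _ _) _.
    by rewrite ler_wpM2r ?enorm_ge0.
  apply: le_trans (ler_norm_sum _ _ _) _.
  have Kw : poisson_kernel nu (w q) = h * (enorm (w q))^-1 ^+ n by rewrite /poisson_kernel dotw.
  apply: (@le_trans _ _ (\sum_(i < n) M * (t ^+ 2 * (c0 * ((h ^+ 2)^-1 * poisson_kernel nu (w q)))))).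
    apply: ler_sum => i _; rewrite normrM; apply: ler_pM => //.
      exact: le_trans (coord_le _ _) (uemb q).
    apply: le_trans (kernel_taylor nu1 i t0 (w0 q) _) _; first by have := wh q; lra.
    rewrite ler_pM2l// /c0 ler_wpM2l// Kw exprS.
    have -> : (h ^+ 2)^-1 * (h * (enorm (w q))^-1 ^+ n) = h^-1 * (enorm (w q))^-1 ^+ n.
      by field; rewrite gt_eqF// expf_neq0// gt_eqF.
    rewrite ler_wpM2r ?exprn_ge0 ?invr_ge0 ?enorm_ge0//.
    by rewrite lef_pV2 ?posrE.
  rewrite sumr_const card_ord -[_ *+ n]mulr_natl /c1 le_eqVlt; apply/orP; left; apply/eqP.
  by ring.
have vdiff : `|\sum_(i < n) (v i (x + t *: e_ i) - v i x)| <=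
    t * M * (T1 / T0 / h + t ^+ 2) + c1 * t ^+ 2 * 2.
  have -> : \sum_(i < n) (v i (x + t *: e_ i) - v i x) =
    \sum_(q <- grid d N k) weight k d * \sum_(i < n) u (emb p0 E q) ord0 i *
     (poisson_kernel nu (w q + t *: e_ i) - poisson_kernel nu (w q)).
    rewrite /v /poisson_sum; under eq_bigr do rewrite -sumrB.
    rewrite exchange_big/=; apply: eq_bigr => q _; rewrite mulr_sumr.
    apply: eq_bigr => i _; rewrite /poisson_weight /w [x + _ - _]addrAC; ring.
  apply: le_trans (ler_norm_sum _ _ _) _.
  apply: (@le_trans _ _ (\sum_(q <- grid d N k) (t * M * (weight k d * enorm (kernel_grad nu (w q)))
     + c1 * t ^+ 2 * (weight k d * poisson_kernel nu (w q))))).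
    apply: ler_sum => q _; rewrite normrM ger0_norm//.
    have := ler_wpM2l wt0 (term q); lra.
  rewrite big_split/= -!mulr_sumr; apply: lerD.
    by apply: ler_wpM2l; [apply: mulr_ge0; exact: ltW | rewrite mulr_sumr].
  by apply: ler_wpM2l; [apply: mulr_ge0 => //; exact: ltW | rewrite mulr_sumr].
have -> : \sum_(i < n) (u (x + t *: delta_mx ord0 i) ord0 i - u x ord0 i) =
  \sum_(i < n) (v i (x + t *: e_ i) - v i x) +
  \sum_(i < n) ((u (x + t *: e_ i) ord0 i - v i (x + t *: e_ i)) - (u x ord0 i - v i x)).
  rewrite -big_split/=; apply: eq_bigr => i _; rewrite /e_; ring.
apply: le_trans (ler_normD _ _) _.
have rest : `|\sum_(i < n) ((u (x + t *: e_ i) ord0 i - v i (x + t *: e_ i)) - (u x ord0 i - v i x))|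
    <= 2 * n%:R * t ^+ 2.
  apply: le_trans (ler_norm_sum _ _ _) _.
  apply: (@le_trans _ _ (\sum_(i < n) 2 * t ^+ 2)).
    apply: ler_sum => i _; apply: le_trans (ler_normB _ _) _.
    by have := at_ i; have := ax i; rewrite /e_; lra.
  by rewrite sumr_const card_ord -[_ *+ n]mulr_natl mulrCA mulrA.
have tM : t * M * t ^+ 2 <= M * h * t ^+ 2.
  rewrite ler_pM2r// mulrC ler_pM2l//; have := h0; lra.
lra.
Qed.

Lemma half_space_estimate : `|divergence u x| <= T1 / T0 / h * M.
Proof.
have [C C0 hC] := divergence_difference_quotient.
rewrite leNgt; apply/negP => lt.
set A := T1 / T0 / h * M in lt hC.
have Ox : O x.
  by apply: OH; rewrite addrAC subrr add0r dotZl -sqnormE nu1 mulr1 ltW.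
have cv : \sum_(i < n) (t^-1 *: (u (t *: delta_mx ord0 i + x) ord0 i - u x ord0 i))
   @[t --> (0:R)^'] --> divergence u x.
  apply: (@cvg_big R 'I_n +%R 0 xpredT _ R ((0 : R)^') _ _ (fun i => partial i (fun y => u y ord0 i) x)).
    exact: add_continuous.
  move=> i _; have [[c1 _] _] := uharm i.
  by have [_ /(_ i)[dv _]] := c1 x Ox; exact: dv.
pose A' := (A + `|divergence u x|) / 2.
have A'1 : A < A' by rewrite /A'; lra.
have A'2 : A' < `|divergence u x| by rewrite /A'; lra.
have := cvgr_norm_gt _ cv _ A'2.
move=> [r /= r0 hr].
pose t := Num.min (r / 2) (Num.min (h / 2) ((A' - A) / (C + 1))).
have C1 : 0 < C + 1 by lra.
have t0 : 0 < t by rewrite !lt_min !divr_gt0//= subr_gt0.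
have tr : t < r by rewrite (@le_lt_trans _ _ (r / 2)) ?ge_min ?lexx//; lra.
have th : t <= h / 2 by rewrite !ge_min lexx orbT.
have tC : t * (C + 1) <= A' - A.
  by rewrite -ler_pdivlMr// !ge_min lexx !orbT.
have := hr t; rewrite /ball/= sub0r normrN gtr0_norm// => /(_ tr).
rewrite gt_eqF// => /(_ isT) h1.
have := hC t t0 th; apply/negP; rewrite -ltNge.
have e : t * `|\sum_(i < n) t^-1 *: (u (t *: delta_mx ord0 i + x) ord0 i - u x ord0 i)| =
    `|\sum_(i < n) (u (x + t *: delta_mx ord0 i) ord0 i - u x ord0 i)|.
  rewrite -{1}(gtr0_norm t0) -normrM mulr_sumr; congr (`|_|); apply: eq_bigr => i _.
  rewrite [_ *: (_ - _)](_ : _ = t^-1 * (u (t *: delta_mx ord0 i + x) ord0 i - u x ord0 i))//.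
  by rewrite mulrA divff ?gt_eqF// mul1r [x + _]addrC.
rewrite -e; have : t * A' < t * `|\sum_(i < n) t^-1 *: (u (t *: delta_mx ord0 i + x) ord0 i - u x ord0 i)|.
  by rewrite ltr_pM2l.
apply: le_lt_trans.
have h2 : t * (t * (C + 1)) <= t * (A' - A) by rewrite ler_pM2l.
have := sqr_ge0 t; lra.
Qed.

End half_space_estimate.

(** * Nearest points of a convex set *)

Section geometry.
Context {R : realType}.
Variable n : nat.

Lemma convex_segment (G : set 'rV[R]_n)
    (hG : convex_set (G : set (convex_lmodType 'rV[R]_n))) (a b : 'rV[R]_n) (t : R) :
  G a -> G b -> 0 <= t <= 1 -> G (t *: a + (1 - t) *: b).
Proof.
move=> Ga Gb /andP[t0 t1].
have := hG a b (Itv01 t0 t1); rewrite !inE => /(_ Ga Gb).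
by rewrite /conv/=.
Qed.

Lemma closure_enorm (G : set 'rV[R]_n) (y : 'rV[R]_n) (r : R) : closure G y -> 0 < r ->
  exists2 z, G z & enorm (z - y) < r.
Proof.
move=> cG r0; have [z [Gz zr]] := cG _ (enorm_ball_nbhs y r0).
by exists z.
Qed.

Lemma nearest_point (C : set 'rV[R]_n) (x : 'rV[R]_n) : closed C -> C !=set0 ->
  exists2 xi, C xi & forall y, C y -> enorm (xi - x) <= enorm (y - x).
Proof.
move=> clC [c Cc].
pose K := C `&` [set y : 'rV[R]_n | enorm (y - x) <= enorm (c - x)].
have cK : compact K.
  apply: (subclosed_compact _ (@compact_enorm_ball _ _ x (enorm (c - x)))); last by move=> y [].
  apply: closedI => //.
  apply: (@closed_comp _ _ (fun y : 'rV[R]_n => enorm (y - x)) [set t | t <= enorm (c - x)]).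
    by move=> y _; exact: enorm_continuous.
  exact: closed_le.
have [xi|xi] := @EVT_min_rV R n (fun y => enorm (y - x)) K (ex_intro _ c (conj Cc (lexx _))) cK.
  by apply: continuous_in_subspaceT => z _; exact: enorm_continuous.
rewrite inE => -[Cxi _] ximin; exists xi => // y Cy.
have [yc|yc] := leP (enorm (y - x)) (enorm (c - x)).
  by apply: ximin; rewrite inE.
apply: le_trans (ltW yc); apply: ximin; rewrite inE; split => //=.
Qed.

(** If [y] in [G] had a positive inner product, moving from [xi] towards
    [y] would decrease the distance to [x]. As [xi] is only in the closure
    of [G], the segment is approximated by segments of [G]. *)
Lemma supporting_half_space (G : set 'rV[R]_n) (x xi : 'rV[R]_n) :
  convex_set (G : set (convex_lmodType 'rV[R]_n)) -> closure G xi ->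
  (forall y, closure G y -> enorm (xi - x) <= enorm (y - x)) ->
  forall y, closure G y -> dot (y - xi) (x - xi) <= 0.
Proof.
move=> hG Gxi ximin.
have sG y t : G y -> 0 < t <= 1 -> enorm (xi - x) <= enorm (t *: y + (1 - t) *: xi - x).
  move=> Gy t01; rewrite leNgt; apply/negP => lt.
  have lt' := lt; rewrite -subr_gt0 in lt'.
  have [z Gz zxi] := closure_enorm Gxi lt'.
  have Gw : G (t *: y + (1 - t) *: z) by apply: convex_segment => //; lra.
  have := ximin _ (subset_closure Gw); rewrite leNgt => /negP; apply.
  have -> : t *: y + (1 - t) *: z - x =
     (t *: y + (1 - t) *: xi - x) + (1 - t) *: (z - xi).
    by apply/rowP => i; rewrite !mxE; ring.
  apply: le_lt_trans (enorm_triangle _ _) _; rewrite enormZ ger0_norm; last lra.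
  have := enorm_ge0 (z - xi); nra.
have GH y : G y -> dot (y - xi) (x - xi) <= 0.
  move=> Gy; rewrite leNgt; apply/negP => D0.
  set D := dot _ _ in D0; pose S := sqnorm (y - xi).
  have S0 : 0 <= S := sqnorm_ge0 _.
  pose t := Num.min 1 (D / (S + 1)).
  have t0 : 0 < t by rewrite lt_min ltr01 divr_gt0//; lra.
  have t1 : t <= 1 by rewrite ge_min lexx.
  have tS : t * (S + 1) <= D.
    by rewrite -ler_pdivlMr ?ge_min ?lexx ?orbT//; lra.
  have := sG y t Gy (ltac:(by rewrite t0)).
  rewrite enorm_le ?enorm_ge0// enorm_sqr.
  have -> : t *: y + (1 - t) *: xi - x = - (x - xi) + t *: (y - xi).
    by apply/rowP => i; rewrite !mxE; ring.
  have -> : xi - x = - (x - xi) by rewrite opprB.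
  rewrite (sqnormD (- (x - xi))) sqnormN sqnormZ dotNl dotZr dotC -/D -/S.
  rewrite -addrA lerDl; have : t * (t * (S + 1)) <= t * D by rewrite ler_pM2l.
  have := mulr_gt0 t0 D0; have := mulr_gt0 t0 t0; lra.
have cH : closed [set y : 'rV[R]_n | dot (y - xi) (x - xi) <= 0].
  apply: (@closed_comp _ _ (fun y : 'rV[R]_n => dot (y - xi) (x - xi)) [set t | t <= 0]).
    by move=> y _; exact: dot_continuous.
  exact: closed_le.
move=> y Gy; have := closure_subset (GH : G `<=` [set y | dot (y - xi) (x - xi) <= 0]) Gy.
by rewrite -(closure_id _).1.
Qed.

(** The points of the segment from [xi] to [x] are closer to [x] than [xi],
    hence outside [C], so [xi] is a boundary point; and every boundary
    point of the complement of the closed set [C] belongs to [C]. *)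
Lemma dist_boundary_complement (C : set 'rV[R]_n) (x xi : 'rV[R]_n) : closed C ->
  ~ C x -> C xi -> (forall y, C y -> enorm (xi - x) <= enorm (y - x)) ->
  dist_boundary (~` C) x = enorm (x - xi).
Proof.
move=> clC nCx Cxi ximin.
have bxi : boundary (~` C) xi.
  split; last by move=> /interior_subset; apply.
  move=> B /nbhs_ballP[r /= r0 hr].
  pose d := enorm (x - xi).
  have d0 : 0 < d.
    rewrite lt_def enorm_ge0 andbT; apply/eqP => d0; apply: nCx.
    have := enorm_sqr (x - xi); rewrite -/d d0 expr0n/= => /esym/sqnorm_eq0/eqP.
    by rewrite subr_eq0 => /eqP ->.
  pose t := Num.min 1 (r / (2 * d)).
  have t0 : 0 < t by rewrite lt_min ltr01 divr_gt0// mulr_gt0.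
  have t1 : t <= 1 by rewrite ge_min lexx.
  have td : t * d < r.
    have : t <= r / (2 * d) by rewrite ge_min lexx orbT.
    by rewrite ler_pdivlMr ?mulr_gt0//; lra.
  exists (xi + t *: (x - xi)); split.
    move=> /ximin; apply/negP; rewrite -ltNge.
    have -> : xi + t *: (x - xi) - x = (1 - t) *: (xi - x).
      by apply/rowP => i; rewrite !mxE; ring.
    rewrite enormZ ger0_norm ?subr_ge0// [enorm (xi - x)]enormB_sym -/d.
    have := mulr_gt0 t0 d0; lra.
  apply: hr; rewrite -ball_normE/= opprD addrA subrr sub0r normrN.
  by apply: le_lt_trans (norm_le_enorm _) _; rewrite enormZ gtr0_norm.
apply/eqP; rewrite eq_le; apply/andP; split.
  apply: ge_inf; last by exists xi.
  by exists 0 => _ [y _ <-]; exact: enorm_ge0.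
apply: lb_le_inf; first by exists (enorm (x - xi)), xi.
move=> _ [y [cy ny] <-]; rewrite enormB_sym [enorm (x - y)]enormB_sym; apply: ximin.
have [//|nCy] := pselect (C y); exfalso; apply: ny.
by apply: open_nbhs_nbhs; split => //; exact: closed_openC.
Qed.

End geometry.

(** * The estimate outside a convex set *)

Lemma bounded_has_sup (R : realType) (n : nat) (Omega : set 'rV[R]_n)
    (u : 'rV[R]_n -> 'rV[R]_n) :
  (forall i : 'I_n, [bounded u y ord0 i | y in Omega]) ->
  has_ubound [set enorm (u y) | y in Omega].
Proof.
move=> bd.
have /boolp.choice[M hM] : forall i : 'I_n, exists M : R, forall y, Omega y -> `|u y ord0 i| <= M.
  move=> i; have [c [_ hc]] := bd i; exists (c + 1) => y Oy.
  by apply: hc => //; rewrite ltrDl.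
exists (Num.sqrt (\sum_(i < n) M i ^+ 2)) => _ [y Oy <-].
apply: ler_wsqrtr; apply: ler_sum => i _.
rewrite -[X in X <= _]real_normK ?num_real//; apply: lerXn2r.
- by rewrite nnegrE.
- by rewrite nnegrE (le_trans _ (hM i y Oy)).
- exact: hM.
Qed.

Lemma div_const_total_mass (R : realType) (k : nat) :
  div_const R k.+2 = total_mass k.+1 (@grad_coef R k.+1) / total_mass k.+1 0.
Proof.
rewrite div_constE /total_mass angular_mass0/=.
have -> : @angular_mass R k.+1 (@grad_coef R k.+1) = \int[lebesgue_measure]_(t in `[0%R, pi / 2])
    (Num.sqrt (1 + k.+2%:R * k%:R * cos t ^+ 2) * sin t ^+ k).
  apply: eq_Rintegral => t _; rewrite /angular /grad_coef/=.
  by rewrite (_ : k.+2%:R - 2 = k%:R :> R)// -addn2 natrD addrK.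
by field; rewrite !gt_eqF// ?wallis_gt0// ball_const_gt0.
Qed.

Theorem proposition5 (R : realType) (n : nat) (hn : (2 <= n)%N)
    (G : set 'rV[R]_n) (hG : domain G)
    (hGconv : convex_set (G : set (convex_lmodType 'rV[R]_n)))
    (Omega : set 'rV[R]_n) (hOmega : Omega = ~` closure G)
    (u : 'rV[R]_n -> 'rV[R]_n)
    (hharm : forall i : 'I_n, harmonic_on Omega (fun y => u y ord0 i))
    (hbdd : forall i : 'I_n, [bounded u y ord0 i | y in Omega])
    (x : 'rV[R]_n) (hx : Omega x) :
  `|divergence u x| <=
    div_const R n / dist_boundary Omega x * sup [set enorm (u y) | y in Omega].
Proof.
case: n hn G hG hGconv Omega hOmega u hharm hbdd x hx => [|[|k]] // _.
move=> G [oG [g0 Gg0] _] hG Omega hOmega u hharm hbdd x hx.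
have clC : closed (closure G) by exact: closed_closure.
have [xi Cxi ximin] : exists2 xi, closure G xi & forall y, closure G y -> enorm (xi - x) <= enorm (y - x).
  by apply: nearest_point => //; exists g0; exact: subset_closure.
have nCx : ~ closure G x by move: hx; rewrite hOmega.
rewrite hOmega (dist_boundary_complement clC nCx Cxi ximin) -hOmega.
set d := enorm (x - xi).
have d0 : 0 < d.
  rewrite lt_def enorm_ge0 andbT; apply/eqP => e0; apply: nCx.
  have := enorm_sqr (x - xi); rewrite -/d e0 expr0n/= => /esym/sqnorm_eq0/eqP.
  by rewrite subr_eq0 => /eqP ->.
pose nu := d^-1 *: (x - xi).
have nu1 : sqnorm nu = 1.
  by rewrite /nu sqnormZ -enorm_sqr -/d exprVn mulVf// expf_neq0// gt_eqF.
have xE : x = xi + d *: nu.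
  by rewrite /nu scalerA divff ?gt_eqF// scale1r addrC subrK.
have oO : open Omega by rewrite hOmega; exact: closed_openC.
have OH y : 0 < dot (y - xi) nu -> Omega y.
  move=> yp; rewrite hOmega => /(supporting_half_space hG Cxi ximin).
  apply/negP; rewrite -ltNge; move: yp; rewrite /nu dotZr.
  by rewrite pmulr_rgt0// invr_gt0.
set S := sup _.
have ub := bounded_has_sup hbdd.
have Sle y : Omega y -> enorm (u y) <= S.
  by move=> Oy; apply: ub_le_sup => //; exists y.
have S0 : 0 <= S := le_trans (enorm_ge0 _) (Sle x hx).
(* the hyperplane is moved by [e] towards [x], so that the closed
   half-space is in [Omega] and [u] is continuous up to its edge; [S + e]
   is positive even when [u] vanishes *)
have est (e : R) : 0 < e -> e < d -> `|divergence u x| <= div_const R k.+2 / (d - e) * (S + e).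
  move=> e0 ed; have h0 : 0 < d - e by rewrite subr_gt0.
  have M0 : 0 < S + e by lra.
  pose p0 := xi + e *: nu.
  have dotp y : dot (y - xi) nu = dot (y - p0) nu + e.
    have -> : y - xi = (y - p0) + e *: nu by apply/rowP => i; rewrite !mxE; ring.
    by rewrite (dotDl (y - p0)) dotZl -sqnormE nu1 mulr1.
  have xp : x = p0 + (d - e) *: nu.
    by rewrite {1}xE; apply/rowP => i; rewrite !mxE; ring.
  have OH' y : 0 <= dot (y - p0) nu -> Omega y by move=> h; apply: OH; rewrite dotp; lra.
  have := @half_space_estimate R k.+1 nu p0 isT nu1 Omega u (S + e) (d - e) oO M0 h0 OH' hharm.
  rewrite -xp -div_const_total_mass; apply.
  by move=> y /OH' /Sle; lra.
rewrite leNgt; apply/negP => lt.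
(* the bound in [est] is continuous in [e] at [0] *)
have dn0 : d - 0 != 0 by rewrite subr0 gt_eqF.
have c1 := @derV _ (fun e : R => d - e) 0 _ dn0 (derB (der_cst d 0) (der_id (0 : R))).
have c2 := derM (derM (der_cst (div_const R k.+2) 0) c1) (derD (der_cst S 0) (der_id (0 : R))).
have [|r r0 hr] := continuous_lt_ball (b := `|divergence u x|) (is_derive_cts c2).
  by rewrite subr0 addr0.
pose e := Num.min r d / 2.
have m0 : 0 < Num.min r d by rewrite lt_min r0.
have e0 : 0 < e by rewrite divr_gt0.
have er : e < r by have : Num.min r d <= r by [rewrite ge_min lexx]; rewrite /e; lra.
have ed : e < d by have : Num.min r d <= d by [rewrite ge_min lexx orbT]; rewrite /e; lra.
have := hr e; rewrite subr0 gtr0_norm// => /(_ er); apply/negP; rewrite -leNgt.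
exact: est.
Qed.
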